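(* Let $n\ge2$, $1\le k\le n$, let $\Omega\subset\mathbb{R}^n$ be a bounded domain and let $f$ be a positive $C^2$ function on $\overline{\Omega}\times\mathbb{R}\times\mathbb{R}^n$. Let $\varphi\in C^4(\Omega)\cap C^2(\overline{\Omega})$ be an $(\eta,k)$-convex solution of $$\sigma_k(\lambda(\eta))=f(x,\varphi,\nabla\varphi)\quad\text{in }\Omega,\qquad \eta_{ij}=(\Delta\varphi)\delta_{ij}-\varphi_{ij}.$$ Then there exists a constant $C$ depending only on $n$, $k$, $\|\varphi\|_{C^1}$, $\inf f$, $\|f\|_{C^2}$ and $\Omega$ such that $$\sup_\Omega|\nabla^2\varphi|\le C\Big(1+\sup_{\partial\Omega}|\nabla^2\varphi|\Big).$$
   Context: $\lambda(\eta)=(\lambda_1,\dots,\lambda_n)$ denotes the eigenvalues of the symmetric matrix $(\eta_{ij})$, $\sigma_k(\lambda)=\sum_{i_1<\dots<i_k}\lambda_{i_1}\cdots\lambda_{i_k}$ is the $k$-th elementary symmetric function, and $\Gamma_k=\{\lambda\in\mathbb{R}^n : \sigma_j(\lambda)>0,\ j=1,\dots,k\}$. The function $\varphi$ is called $(\eta,k)$-convex if $\lambda(\eta)\in\Gamma_k$ at every $x\in\Omega$. The quantities $\inf f$ and $\|f\|_{C^2}$ are taken over the compact set $\{(x,z,p)\in\overline{\Omega}\times\mathbb{R}\times\mathbb{R}^n : |z|\le\|\varphi\|_{C^1},\ |p|\le\|\varphi\|_{C^1}\}$. *)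

(* Defs.v *)
From HB Require Import structures.
From mathcomp Require Import all_boot all_order all_algebra.
From mathcomp Require Import all_classical all_reals all_analysis.

Set Implicit Arguments.
Unset Strict Implicit.
Unset Printing Implicit Defensive.

Import Order.TTheory GRing.Theory Num.Theory.
Import numFieldNormedType.Exports.

Local Open Scope classical_set_scope.
Local Open Scope ring_scope.

(* The library norm `|M| of a matrix is the max norm; this is the Euclidean
   (Frobenius) one, used for gradients (row vectors) and Hessians. *)
Definition enorm (R : realType) (m n : nat) (M : 'M[R]_(m, n)) : R :=
  Num.sqrt (\sum_(i < m) \sum_(j < n) M i j ^+ 2).

Section Calculus.
Variables (R : realType) (m : nat).
Local Notation V := 'rV[R]_m.
Implicit Types (A K : set V) (u g : V -> R) (s : seq 'I_m).

Definition partial (i : 'I_m) u : V -> R := 'D_(delta_mx 0 i) u.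

(* pderivs [:: i1; ...; ir] u = d_i1 (... (d_ir u)) *)
Definition pderivs s u : V -> R := foldr partial u s.

(* C^k(A), for A open *)
Definition Ck (k : nat) A u : Prop :=
  forall s, (size s <= k)%N ->
    (forall x, A x -> {for x, continuous (pderivs s u)}) /\
    ((size s < k)%N ->
      forall (i : 'I_m) x, A x -> derivable (pderivs s u) x (delta_mx 0 i)).

(* C^k of the closure of an open set A: all the derivatives of order <= k
   extend continuously from A to its closure.  No derivative is taken at points
   outside A, where u may be arbitrary (on the closure, only continuity of u
   itself is required). *)
Definition Ck_closure (k : nat) A u : Prop :=
  [/\ Ck k A u,
      {within closure A, continuous u} &
      forall s, (size s <= k)%N ->
        exists2 g, {within closure A, continuous g} &
                   forall x, A x -> g x = pderivs s u x].

(* The value at a point x of the closure of A of the continuous extension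
   of g from A *)
Definition extend A g (x : V) : R := lim (g y @[y --> within A (nbhs x)]).

Definition grad u (x : V) : 'rV[R]_m := \row_i partial i u x.
Definition hess u (x : V) : 'M[R]_m := \matrix_(i, j) partial i (partial j u) x.
Definition laplacian u (x : V) : R := \sum_(i < m) partial i (partial i u) x.

Definition grad_ext A u (x : V) : 'rV[R]_m := \row_i extend A (partial i u) x.
Definition hess_ext A u (x : V) : 'M[R]_m :=
  \matrix_(i, j) extend A (partial i (partial j u)) x.

(* The C^1 and C^2 norms over a subset K of the closure of A, for u regular up
   to the closure of A.  The suprema are finite as soon as K is bounded. *)
Definition normC1 A K u : R :=
  sup [set `|u x| | x in K] + sup [set enorm (grad_ext A u x) | x in K].
Definition normC2 A K u : R :=
  normC1 A K u + sup [set enorm (hess_ext A u x) | x in K].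

End Calculus.

Section Jets.
Variables (R : realType) (n : nat).
Local Notation J := 'rV[R]_(n + (1 + n)).
Implicit Types (Omega : set 'rV[R]_n) (f : 'rV[R]_n -> R -> 'rV[R]_n -> R).

(* A point (x, z, p) of R^n x R x R^n is encoded as the concatenated row vector,
   so that the notions above apply to functions of (x, z, p). *)
Definition jx (y : J) : 'rV[R]_n := lsubmx y.
Definition jz (y : J) : R := lsubmx (rsubmx y) 0 0.
Definition jp (y : J) : 'rV[R]_n := rsubmx (rsubmx y).

Definition jfun f : J -> R := fun y => f (jx y) (jz y) (jp y).

(* Omega x R x R^n; its closure is (closure Omega) x R x R^n *)
Definition jet_dom Omega : set J := [set y | Omega (jx y)].

Definition jet_cpt Omega (M : R) : set J :=
  [set y | [/\ closure Omega (jx y), `|jz y| <= M & enorm (jp y) <= M]].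

End Jets.

Section Hessian_type.
Variables (R : realType) (n : nat).
Implicit Types (lam : 'rV[R]_n) (A : 'M[R]_n) (u : 'rV[R]_n -> R).

(* The eigenvalues with multiplicity, in an unspecified order; sigma below is
   symmetric in lam.  Such a lam exists when A is symmetric; the default 0 is
   returned when the characteristic polynomial does not split. *)
Definition eigenvalues A : 'rV[R]_n :=
  xget 0 [set lam : 'rV[R]_n |
    char_poly A = \prod_(i < n) ('X - (lam 0 i)%:P)].

Definition sigma (k : nat) lam : R :=
  \sum_(I : {set 'I_n} | #|I| == k) \prod_(i in I) lam 0 i.

Definition Gamma (k : nat) : set 'rV[R]_n :=
  [set lam | forall j : nat, (1 <= j <= k)%N -> 0 < sigma j lam].

Definition eta u (x : 'rV[R]_n) : 'M[R]_n := (laplacian u x)%:M - hess u x.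

Definition eta_convex (k : nat) (Omega : set 'rV[R]_n) u : Prop :=
  forall x, Omega x -> Gamma k (eigenvalues (eta u x)).

End Hessian_type.

(* Main.v *)
(* Maximise the second derivative of phi in the direction xi, divided by
   v = K - |grad phi|^2 / 2 - |x|^2 / 2, over the closure of Omega and all unit
   vectors xi.  At an interior maximum (x0, e_i), with e an eigenframe of the
   Hessian and kap its eigenvalues, u_i + mu (|grad phi|^2 / 2 + |x|^2 / 2) is
   maximal at x0, where u_b is the second derivative of phi along e_b and
   mu = kap_i / v(x0).

   The equation enters only through the supporting hyperplane of the concave
   function ln sigma_k at lambda(eta(x0)): with F the derivative of ln sigma_k with
   respect to the Hessian, sum_b F_b u_b - (1 - f(x0) / f) is minimal at x0.  No
   derivative of an eigenvalue is needed.  The concavity follows Marcus and Lopes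
   from Newton's inequality, that is, from Gauss-Lucas and Laguerre for real-rooted
   polynomials; diagonalisation and the Schur-type inequality passing from
   eigenvalues to diagonal entries both come from minimising a weighted diagonal
   over the orthogonal group.

   Combining the two second-order conditions along the frame gives
   sum F kap^2 + sum F <= C (1 + kap_i).  For k < n, Newton's inequality with a
   constant < 1 makes the two largest eta-derivatives of ln sigma_k comparable, so
   F_i is bounded below; for k = n >= 3, sum F grows at least like kap_i^2.  Either
   way kap_i is bounded.  For n = k = 2 the weight is
   v = exp (- beta |grad phi|^2 / 2) instead, and the determinant is compared with
   the product of the diagonal entries. *)

Require Import Defs.
From mathcomp Require Import all_boot all_order all_algebra.
From mathcomp Require Import all_classical all_reals all_analysis.
From mathcomp Require Import complex ring lra zify.

Set Implicit Arguments.
Unset Strict Implicit.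
Unset Printing Implicit Defensive.

Import Order.TTheory GRing.Theory Num.Theory.
Import numFieldNormedType.Exports.

Local Open Scope classical_set_scope.
Local Open Scope ring_scope.

(** * Elementary symmetric functions and Garding cones *)

(** Points and unit vectors are maximised together so that the direction can be frozen afterwards:
    the second derivative of [phi] along a fixed vector is as smooth as the Hessian, even where the
    largest eigenvalue is multiple. The coefficients F are frozen at x0 too, so the equation is
    never differentiated twice; one-sided inequalities between second-order expansions along lines
    suffice.

    What remains must beat terms of order kap_i^2 coming from f(x, phi, grad phi), whose gradient
    slot moves with speed kap_i. The factor mu, itself of order kap_i, reduces them to order 1 +
    kap_i. For n = k = 2 this is not enough: sum F kap^2 is just kap_1 + kap_2, of that same order.
    The coefficient in front of it must be made large, and the exponential weight supplies a free
    beta. The price is an error with beta^2 kap_a^2 p_a^2 along e_a, ruinous for a = i. Hence the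
    second-order condition of u_i is used only along the other vector e_j, where kap_j = f / kap_i
    is bounded. *)

Section ElementarySymmetric.
Variables (R : comNzRingType) (T : finType).
Implicit Types (x : T -> R) (S : {set T}).

(** Relative to a subset [S], because [es x (S :\ i) k] is the partial derivative of [es x S k.+1]
    in [x i]: the calculus of these polynomials becomes deletion of indices. *)
Definition es x S (k : nat) : R :=
  \sum_(I : {set T} | (I \subset S) && (#|I| == k)) \prod_(i in I) x i.

Lemma es0 x S : es x S 0 = 1.
Proof.
rewrite /es (big_pred1 finset.set0) ?big_set0 // => I.
by rewrite cards_eq0 /=; case: eqP => [->|_]; rewrite ?finset.sub0set ?andbF.
Qed.

Lemma es_gt x S k : (#|S| < k)%N -> es x S k = 0.
Proof.
move=> hk; rewrite /es big_pred0 // => I; apply/negP => /andP[/subset_leq_card].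
by move=> h /eqP e; move: h; rewrite e leqNgt hk.
Qed.

Lemma es_mem x S i k : i \in S ->
  \sum_(I : {set T} | (I \subset S) && (#|I| == k.+1) && (i \in I))
     \prod_(j in I) x j = x i * es x (S :\ i) k.
Proof.
move=> iS; rewrite (reindex_onto (fun J => i |: J) (fun I => I :\ i)) /=; last first.
  by move=> I /andP[_ iI]; rewrite finset.setD1K.
rewrite mulr_sumr; apply: eq_big => [J|J].
  rewrite finset.setU11 andbT finset.subsetD1 finset.subUset finset.sub1set iS /=.
  case: (boolP (i \in J)) => iJ /=; last first.
    by rewrite finset.setU1K // eqxx andbT cardsU1 iJ /= eqSS andbT.
  by rewrite andbF; apply/negP=> /andP[_ /eqP e]; move: iJ; rewrite -e !inE eqxx.
case/andP=> _ /eqP e; rewrite big_setU1 // -e !inE eqxx //.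
Qed.

Lemma es_D1 x S i k : i \in S ->
  es x S k.+1 = es x (S :\ i) k.+1 + x i * es x (S :\ i) k.
Proof.
move=> iS; rewrite {1}/es (bigID (fun I : {set T} => i \in I)) /= addrC es_mem //.
congr (_ + _); apply: eq_bigl => I.
by rewrite finset.subsetD1 -!andbA; congr (_ && _); rewrite andbC.
Qed.

(** Double counting: a set of size [k.+1] arises once from each of its elements. *)
Lemma es_euler x S k :
  \sum_(i in S) x i * es x (S :\ i) k = k.+1%:R * es x S k.+1.
Proof.
under eq_bigr => i iS do rewrite -es_mem //.
rewrite (exchange_big_dep (fun I : {set T} => (I \subset S) && (#|I| == k.+1))) /=;
  last by move=> i I _ /andP[].
rewrite mulr_sumr; apply: eq_bigr => I /andP[IS /eqP cI].
rewrite sumr_const mulr_natl; congr (_ *+ _); rewrite -cI; apply: eq_card => i.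
rewrite unfold_in /= IS cI eqxx /= andb_idl // => iI.
by move/fintype.subsetP: IS => ->.
Qed.

Lemma es_sumD1 x S k :
  \sum_(i in S) es x (S :\ i) k = (#|S|%:R - k%:R) * es x S k.
Proof.
case: k => [|k].
  by under eq_bigr do rewrite es0; rewrite es0 sumr_const subr0 mulr1.
have := es_euler x S k.
have -> : \sum_(i in S) x i * es x (S :\ i) k =
   \sum_(i in S) (es x S k.+1 - es x (S :\ i) k.+1).
  by apply: eq_bigr => i iS; rewrite (es_D1 _ _ iS) addrC addKr.
by rewrite sumrB sumr_const => e; rewrite mulrBl -e mulr_natl opprB addrC subrK.
Qed.

Lemma coef_prod_XaddC x S j : (j <= #|S|)%N ->
  (\prod_(i in S) ('X + (x i)%:P))`_j = es x S (#|S| - j).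
Proof.
elim: {S}#|S| {-2}S (erefl #|S|) j => [|N IH] S cS j.
  rewrite cS leqn0 => /eqP ->; rewrite es0.
  by move/eqP: cS; rewrite cards_eq0 => /eqP ->; rewrite big_set0 coef1.
have [i iS] : exists i, i \in S by apply/finset.set0Pn; rewrite -cards_eq0 cS.
have cSi : #|S :\ i| = N by move: (cardsD1 i S); rewrite iS cS => -[].
rewrite (big_setD1 i iS) /= mulrDl coefD coefXM coefCM.
case: j => [|j] hj /=.
  rewrite add0r IH ?cSi // cS !subn0 (es_D1 _ _ iS) (@es_gt _ (S :\ i) N.+1) ?cSi //.
  by rewrite add0r.
rewrite cS in hj *; rewrite IH ?cSi // subSS; move: hj; rewrite ltnS leq_eqVlt => /orP[/eqP ->|hj].
  rewrite subnn !es0 nth_default ?mulr0 ?addr0 //.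
  rewrite -big_enum /= (eq_bigr (fun k => 'X - (- x k)%:P)) => [|k _].
    by rewrite size_prod_XsubC -cardE cSi.
  by rewrite polyCN opprK.
by rewrite IH ?cSi // -(subnSK hj) (es_D1 _ _ iS).
Qed.
End ElementarySymmetric.

(** * Real-rooted polynomials: Gauss-Lucas, Laguerre and Newton *)

Section RealRooted.
Variable R : rcfType.
Implicit Types (p : {poly R}) (s : seq R).

(** The constant [c] may be 0, so the zero polynomial qualifies and the class is closed under
    derivation without exception. *)
Definition real_rooted p :=
  exists c s, p = c *: \prod_(a <- s) ('X - a%:P).

(** The logarithmic derivative [L] is the sum of 1 / (z - a), and every summand has an imaginary
    part of sign opposite to [v]; hence the derivative has no zero off the real axis. Multiplying by
    [v] treats both half planes at once. *)
Lemma nonreal_log_deriv s (u v : R) : v != 0 ->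
  let p := \prod_(a <- s) ('X - (a%:C)%C%:P) in
  let z := (u +i* v)%C in
  p.[z] != 0 /\ exists L : R[i], p^`().[z] = p.[z] * L /\
    ((complex.Im L) * v <= 0 /\ (s != [::] -> (complex.Im L) * v < 0)).
Proof.
move=> v0; elim: s => [|a s /= [pz [L [dp [IL _]]]]] /=.
  rewrite big_nil; split; first by rewrite hornerC oner_eq0.
  exists 0; rewrite derivC horner0 mulr0 /= mul0r; split=> //; split=> //.
rewrite big_cons; set p := (\prod_(_ <- s) _) in pz dp *.
set z := (u +i* v)%C in pz dp *.
pose d := (u - a) ^+ 2 + v ^+ 2.
have d0 : 0 < d by rewrite /d ltr_wpDl ?sqr_ge0 // exprn_even_gt0.
pose w := (((u - a) / d) +i* (- v / d))%C.
have zw : (z - a%:C)%C * w = 1.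
  apply/eqP; rewrite eq_complex /= /w /z; simpc.
  by apply/andP; split; apply/eqP; rewrite /d; field; rewrite -/d gt_eqF.
have za : (z - a%:C)%C != 0.
  by apply/negP=> /eqP e; move: zw; rewrite e mul0r => /eqP; rewrite eq_sym oner_eq0.
rewrite hornerM hornerXsubC mulf_neq0 //; split=> //.
exists (w + L); split.
  rewrite derivM derivXsubC mul1r hornerD hornerM hornerXsubC dp mulrDr.
  by rewrite [in RHS](mulrC _ w) !mulrA (mulrC w) zw mul1r; ring.
have wv : complex.Im w * v < 0.
  rewrite /w /= mulrAC mulNr -expr2 mulNr oppr_lt0 divr_gt0 //.
  by rewrite exprn_even_gt0.
rewrite raddfD /= mulrDl; split; last by move=> _; rewrite ltr_wnDr.
by rewrite ltW // ltr_wnDr.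
Qed.

(** Over the complex numbers the derivative splits; its roots are real by [nonreal_log_deriv], so
    taking real parts turns that factorisation into one over [R]. *)
Lemma real_rooted_deriv p : real_rooted p -> real_rooted p^`().
Proof.
case=> c [s ->{p}]; rewrite derivZ.
have [->|c0] := eqVneq c 0; first by exists 0, [::]; rewrite !scale0r.
have [->|s0] := eqVneq s [::]; first by exists 0, [::]; rewrite big_nil derivC scaler0 scale0r.
set p := \prod_(_ <- _) _; pose f : {rmorphism R -> R[i]} := real_complex R.
have [r er] := closed_field_poly_normal (map_poly f p^`()).
have [lq0|lq0] := eqVneq (lead_coef p^`()) 0.
  by move/eqP: lq0; rewrite lead_coef_eq0 => /eqP ->; exists 0, [::]; rewrite scaler0 scale0r.
have rr z : z \in r -> complex.Im z = 0.
  case: z => u v /= zr; apply/eqP/negP => /negP v0.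
  have [pz [L [dp [_ /(_ s0) IL]]]] := nonreal_log_deriv s u v0.
  have : (map_poly f p^`()).[(u +i* v)%C] = 0.
    by apply/rootP; rewrite er rootZ ?root_prod_XsubC // lead_coef_map fmorph_eq0.
  rewrite -deriv_map rmorph_prod /=.
  under eq_bigr do rewrite rmorphB /= map_polyX map_polyC /=.
  rewrite dp => /eqP; rewrite mulf_eq0 (negPf pz) /= => /eqP L0.
  by move: IL; rewrite L0 mul0r ltxx.
exists (c * lead_coef p^`()), [seq complex.Re z | z <- r].
rewrite -scalerA; congr (_ *: _); apply: (map_poly_inj f).
rewrite er map_polyZ /= lead_coef_map; congr (_ *: _).
rewrite big_map rmorph_prod /= !big_seq; apply: eq_bigr => z zr.
rewrite rmorphB /= map_polyX map_polyC /=; congr (_ - _%:P).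
by case: z zr (rr z) => a b zr /(_ zr) /= ->.
Qed.

Lemma real_rooted_derivn p m : real_rooted p -> real_rooted p^`(m).
Proof. by move=> rp; elim: m => [|m IH]; rewrite ?derivn0 // derivnS; apply: real_rooted_deriv. Qed.

(** This is p'^2 - p p'' >= 0 at 0, written in coefficients. Induction on the roots avoids dividing
    by p, which may vanish there: a new root [a] turns the defect d into b0^2 + a^2 d. *)
Lemma real_rooted_laguerre p : real_rooted p -> 2 * p`_0 * p`_2 <= p`_1 ^+ 2.
Proof.
case=> c [s ->{p}]; rewrite !coefZ.
suff h : 2 * (\prod_(a <- s) ('X - a%:P))`_0 * (\prod_(a <- s) ('X - a%:P))`_2
     <= (\prod_(a <- s) ('X - a%:P))`_1 ^+ 2.
  have := ler_wpM2l (sqr_ge0 c) h; nra.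
elim: s => [|a s IH]; first by rewrite big_nil !coef1 /= mulr0 expr0n.
rewrite big_cons mulrBl !coefB !coefXM !coefCM /=.
move: IH; set p := \prod_(_ <- s) _; move: (p`_0) (p`_1) (p`_2) => b0 b1 b2 IH.
have := ler_wpM2l (sqr_ge0 a) IH; have := sqr_ge0 b0; nra.
Qed.

Variable T : finType.

(** Differentiating the product [m] times moves the three symmetric functions to the coefficients 0,
    1, 2, where Laguerre applies. This yields the constant (|S|-j-1)/(|S|-j), which is then weakened
    to one independent of [j], still below 1. *)
Lemma es_newton (x : T -> R) (S : {set T}) j :
  #|S|%:R * (es x S j * es x S j.+2) <= #|S|.-1%:R * es x S j.+1 ^+ 2.
Proof.
have [h|h] := ltnP #|S| j.+2.
  by rewrite (@es_gt _ _ _ _ j.+2) // !mulr0 mulr_ge0 ?ler0n ?sqr_ge0.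
pose p := \prod_(i in S) ('X + (x i)%:P); pose m := (#|S| - j.+2)%N.
have rp : real_rooted p.
  exists 1, [seq - x i | i <- enum S]; rewrite scale1r big_map big_enum /=.
  by apply: eq_bigr => i _; rewrite polyCN opprK.
have := real_rooted_laguerre (real_rooted_derivn m rp).
rewrite !coef_derivn.
have Sm : #|S| = (m + j.+2)%N by rewrite subnK.
have e0 : p`_(m + 0) = es x S j.+2.
  by rewrite coef_prod_XaddC addn0 /m ?leq_subr // subKn.
have e1 : p`_(m + 1) = es x S j.+1.
  by rewrite coef_prod_XaddC; rewrite Sm ?subnDl ?subSS ?subn0 // leq_add2l.
have e2 : p`_(m + 2) = es x S j.
  by rewrite coef_prod_XaddC; rewrite Sm ?subnDl ?subSS ?subn0 // leq_add2l.
rewrite e0 e1 e2 -!(mulr_natr (es _ _ _)).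
(* [coef_derivn] brings in falling factorials; the factor 2 of Laguerre clears the denominator of
   the last one. *)
have f0 : ((m + 0) ^_ m = m`!)%N by rewrite addn0 ffactnn.
have f1 : ((m + 1) ^_ m = m.+1 * m`!)%N.
  by have := @ffact_fact (m + 1) m; rewrite leq_addr addKn addn1 muln1 factS => ->.
have f2 : ((m + 2) ^_ m * 2 = m.+2 * (m.+1 * m`!))%N.
  by have := @ffact_fact (m + 2) m; rewrite leq_addr addKn addn2 !factS => ->.
move: f2 => /(congr1 (fun k => k%:R : R)); rewrite f0 f1 !natrM.
have a0 : 0 < (m`!)%:R :> R by rewrite ltr0n fact_gt0.
set a := (m`!)%:R; set b := ((m + 2) ^_ m)%:R => hb hl.
have {hl} hl : m.+2%:R * (es x S j * es x S j.+2) <= m.+1%:R * es x S j.+1 ^+ 2.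
  rewrite -(ler_pM2l (_ : 0 < m.+1%:R * a ^+ 2)); last first.
    by rewrite mulr_gt0 ?ltr0n // exprn_gt0.
  have -> : m.+1%:R * a ^+ 2 * (m.+2%:R * (es x S j * es x S j.+2)) =
     a * (es x S j * es x S j.+2) * (b * 2) by rewrite hb; ring.
  by apply: le_trans (_ : _ <= (es x S j.+1 * (m.+1%:R * a)) ^+ 2) _; nra.
rewrite Sm !addnS /= -[(m + j).+2%:R]natr1 -[(m + j).+1%:R]natr1 natrD.
move: hl; rewrite -[m.+2%:R]natr1 -[m.+1%:R]natr1.
have := ler0n R m; have := ler0n R j; have := sqr_ge0 (es x S j.+1).
move: (es x S j) (es x S j.+1) (es x S j.+2) m%:R j%:R => A B D M J; nra.
Qed.
End RealRooted.

(** * Garding cones and the Marcus-Lopes concavity *)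

Section GardingCone.
Variables (R : rcfType) (T : finType).
Implicit Types (x y e mu : T -> R) (S : {set T}).

Definition gam k x S := forall j, (j <= k)%N -> 0 < es x S j.

Lemma gamW k l x S : (l <= k)%N -> gam k x S -> gam l x S.
Proof. by move=> lk h j jl; apply: h; apply: leq_trans lk. Qed.

Lemma es_newton_weak x S j : es x S j * es x S j.+2 <= es x S j.+1 ^+ 2.
Proof.
have [h|h] := posnP #|S|.
  by rewrite (@es_gt _ _ _ _ j.+2) ?h // mulr0 sqr_ge0.
rewrite -(ler_pM2l (_ : 0 < #|S|%:R)) ?ltr0n //.
apply: le_trans (es_newton x S j) _.
by rewrite ler_wpM2r ?sqr_ge0 // ler_nat leq_pred.
Qed.

(** Let a, b, c be consecutive es of [S :\ i] and t = [x i]. If b <= 0, Newton's inequality gives a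
    (c + t b) <= b (b + t a), where the left side is positive and the right side is not. *)
Lemma gamD1 k x S i : i \in S -> gam k.+1 x S -> gam k x (S :\ i).
Proof.
move=> iS; elim: k => [|k IH] g j; first by rewrite leqn0 => /eqP ->; rewrite es0 ltr01.
have {}IH : gam k x (S :\ i) by apply: IH; apply: gamW g.
rewrite leq_eqVlt => /orP[/eqP ->{j}|]; last by rewrite ltnS; apply: IH.
have := g k.+1 (leqnSn _); have := g k.+2 (leqnn _).
rewrite !(es_D1 _ _ iS).
have := es_newton_weak x (S :\ i) k; have := IH k (leqnn k).
move: (es _ _ k) (es _ _ k.+1) (es _ _ k.+2) (x i) => a b c t a0 N h2 h1.
rewrite ltNge; apply/negP => b0.
have h3 : 0 < a * (c + t * b) by rewrite mulr_gt0.
have h4 : 0 <= (b + t * a) * (- b) by rewrite mulr_ge0 ?oppr_ge0 // ltW.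
nra.
Qed.

(** For positive [k] the two sides differ by x j - x i times an es of [S :\ i :\ j], positive by two
    applications of [gamD1]. *)
Lemma es_D1_anti k x S i j : i \in S -> j \in S -> gam k.+1 x S ->
  x i <= x j -> es x (S :\ j) k <= es x (S :\ i) k.
Proof.
move=> iS jS g xij; have [<-//|ij] := eqVneq i j.
case: k g => [|k] g; first by rewrite !es0.
have jSi : j \in S :\ i by rewrite !inE eq_sym ij.
have iSj : i \in S :\ j by rewrite !inE ij.
rewrite (es_D1 _ _ jSi) (es_D1 _ _ iSj).
have -> : S :\ j :\ i = S :\ i :\ j by apply/setP => l; rewrite !inE andbCA.
rewrite lerD2l ler_wpM2r // ltW //.
exact: (gamD1 jSi (gamD1 iS g)).
Qed.

Lemma es_ge0 x S k : (forall i, i \in S -> 0 <= x i) -> 0 <= es x S k.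
Proof.
move=> h; apply: sumr_ge0 => I /andP[/fintype.subsetP IS _]; apply: prodr_ge0 => i /IS; exact: h.
Qed.

(* Newton's inequality with its constant < 1 is what makes the two derivatives
   comparable; the case #|S| = k.+1 is excluded, and the conclusion fails there. *)
Lemma es_D1_comparable k x S i j :
  i \in S -> j \in S -> i != j -> (k.+1 < #|S|)%N -> gam k.+1 x S ->
  x i <= x j -> (forall l, l \in S :\ i :\ j -> x j <= x l) ->
  es x (S :\ i) k <= #|S|.+1%:R ^+ 3 * es x (S :\ j) k.
Proof.
move=> iS jS ij kS g xij xjl.
have S1 : 1 <= #|S|.+1%:R ^+ 3 :> R by rewrite exprn_ege1 // ler1n.
case: k kS g => [|k] kS g; first by rewrite !es0 mulr1.
have jSi : j \in S :\ i by rewrite !inE eq_sym ij.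
have iSj : i \in S :\ j by rewrite !inE ij.
have eS : S :\ j :\ i = S :\ i :\ j by apply/setP => l; rewrite !inE andbCA.
have h2 := g k.+2 (leqnn _).
have hj := gamD1 jS g (leqnn k.+1).
rewrite (es_D1 _ _ iS) !(es_D1 _ _ jSi) in h2.
rewrite (es_D1 _ _ iSj) eS in hj.
rewrite (es_D1 _ _ jSi) (es_D1 _ _ iSj) eS.
have s0 : 0 < es x (S :\ i :\ j) k := gamD1 jSi (gamD1 iS g) (leqnn k).
have N := es_newton x (S :\ i :\ j) k.
have cY : #|S :\ i :\ j| = #|S|.-2.
  by move: (cardsD1 i S) (cardsD1 j (S :\ i)); rewrite iS jSi => -> ->.
have m0 : (0 < #|S|.-2)%N by rewrite -subn2 subn_gt0 (leq_trans _ kS).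
have hk' : 1 <= (#|S|.-2)%:R - k%:R :> R.
  by rewrite lerBrDr addrC natr1 ler_nat; move: kS; clear; lia.
(* The remaining entries are at least [x j], so Euler's identity on them bounds [x j] times the
   lower es by a multiple of the next; the hypothesis on #|S| enters through [hk'], which keeps the
   factor from [es_sumD1] at least 1. *)
have hb : 0 < x j -> x j * es x (S :\ i :\ j) k <= k.+1%:R * es x (S :\ i :\ j) k.+1.
  move=> xj0; rewrite -es_euler.
  have pos l : l \in S :\ i :\ j -> 0 <= es x (S :\ i :\ j :\ l) k.
    move=> lY; apply: es_ge0 => l' l'Y; apply: le_trans (ltW xj0) (xjl _ _).
    by move: l'Y; rewrite inE => /andP[].
  apply: (@le_trans _ _ (\sum_(l in S :\ i :\ j) x j * es x (S :\ i :\ j :\ l) k)).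
    rewrite -mulr_sumr es_sumD1; apply: ler_wpM2l; first exact: ltW.
    by rewrite cY -[leLHS]mul1r; apply: ler_wpM2r => //; exact: ltW.
  by apply: ler_sum => l lY; rewrite ler_wpM2r ?pos ?xjl.
rewrite cY in N.
have -> : #|S|.+1%:R = (#|S|.-2)%:R + 3 :> R.
  by rewrite -natrD; congr _%:R; move: kS; clear; lia.
have hm : 1 <= (#|S|.-2)%:R :> R by rewrite ler1n.
have Em : (#|S|.-2.-1)%:R = (#|S|.-2)%:R - 1 :> R by rewrite -[in RHS](prednK m0) -natr1 addrK.
have hk : k.+1%:R <= (#|S|.-2)%:R :> R by rewrite ler_nat; move: kS; clear; lia.
rewrite Em in N.
have hk0 : 0 < k.+1%:R :> R by rewrite ltr0n.
move: s0 N hb h2 hj hm hk hk0 xij; clear.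
move: (es _ _ k) (es _ _ k.+1) (es _ _ k.+2) (x i) (x j) (#|S|.-2%:R) => s0 s1 s2 a b m.
move: k.+1%:R => K s00 N hb h2 hj m1 hK K0 ab.
have s10 : 0 < s1.
  by have [b0|b0] := ltP 0 b; [have := hb b0; have := mulr_gt0 b0 s00|]; nra.
have hbm : b * s0 <= m * s1.
  have [b0|b0] := ltP 0 b; last by apply: (@le_trans _ _ 0); nra.
  by apply: le_trans (hb b0) _; nra.
(* [A] and [B] are the es of the claim. Newton with the factor (m - 1)/m leaves s1^2 <= m A B;
   together with B <= (m + 1) s1 this gives B^2 <= (m + 1)^2 m A B, and one B cancels. *)
pose A := s1 + a * s0; pose B := s1 + b * s0.
rewrite -/A in hj *; rewrite -/B.
have AB : A <= B by rewrite /A /B; nra.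
have B0 : 0 < B by lra.
have Bs : B <= (m + 1) * s1 by rewrite /B; lra.
have h5 : s1 ^+ 2 <= m * (A * B).
  have : 0 < m * s0 * (s2 + b * s1 + a * (s1 + b * s0)) by rewrite mulr_gt0 // mulr_gt0 //; lra.
  by rewrite /A /B; nra.
have h6 : B * B <= (m + 1) ^+ 2 * s1 ^+ 2 by nra.
have h7 : B * B <= (m + 1) ^+ 2 * m * A * B.
  by apply: le_trans h6 _; apply: le_trans (ler_wpM2l (sqr_ge0 (m + 1)) h5) _; rewrite !mulrA.
rewrite ler_pM2r // in h7; apply: le_trans h7 _; rewrite ler_pM2r //.
nra.
Qed.

(** The derivative of [es _ S k] at [e] in the direction [mu]. *)
Definition des e mu S k : R :=
  if k is k'.+1 then \sum_(i in S) mu i * es e (S :\ i) k' else 0.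

Lemma des_D1 e mu S i k : i \in S ->
  des e mu S k.+1 = des e mu (S :\ i) k.+1 + e i * des e mu (S :\ i) k
    + mu i * es e (S :\ i) k.
Proof.
move=> iS; rewrite /des (big_setD1 i iS) /= addrC; congr (_ + _).
have sw j : S :\ j :\ i = S :\ i :\ j by apply/setP => l; rewrite !inE andbCA.
case: k => [|k]; first by rewrite mulr0 addr0; under eq_bigr do rewrite es0;
  under [RHS]eq_bigr do rewrite es0.
rewrite mulr_sumr -big_split; apply: eq_bigr => j /=.
rewrite !inE => /andP[ji jS]; rewrite (@es_D1 _ _ _ (S :\ j) i) ?sw; first by ring.
by rewrite !inE eq_sym ji.
Qed.

(** Euler's identity differentiated: of the [k.+2] copies, one comes from differentiating the factor
    [e i] and is moved across. *)
Lemma des_euler e mu S k : \sum_(i in S) e i * des e mu (S :\ i) k.+1 =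
  k.+1%:R * des e mu S k.+2.
Proof.
rewrite /des [RHS]mulr_sumr; under eq_bigr do rewrite mulr_sumr.
have sw j i : S :\ j :\ i = S :\ i :\ j by apply/setP => l; rewrite !inE andbCA.
rewrite (exchange_big_dep (mem S)) /=; last by move=> i j _; rewrite !inE => /andP[].
apply: eq_bigr => j jS; rewrite mulrCA -es_euler mulr_sumr.
apply: eq_big => [i|i _]; last by rewrite mulrCA sw.
by rewrite !inE jS andbT andbC eq_sym.
Qed.

(* The derivative of es_(k+1) / es_k at e in the direction mu dominates its value
   at mu: this is the concavity of the quotient (Marcus-Lopes). *)
Lemma es_quotient_concave k e mu S : gam k.+1 e S -> gam k.+1 mu S ->
  es mu S k.+1 / es mu S k <=
  (des e mu S k.+1 * es e S k - es e S k.+1 * des e mu S k) / es e S k ^+ 2.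
Proof.
elim: k S => [|k IH] S ge gm.
  rewrite !es0 invr1 mulr1 mulr0 subr0 mulr1 expr1n invr1 mulr1.
  by have := es_euler mu S 0; rewrite mul1r => <-; apply: ler_sum => i _; rewrite !es0.
have ea := ge k.+1 (leqnSn _); have ma := gm k.+1 (leqnSn _).
(* Euler's identities write both sides as sums over the deleted index, so that they can be compared
   term by term through [S :\ i]. *)
rewrite -(ler_pM2l (_ : 0 < k.+2%:R)) ?ltr0n //.
have -> : k.+2%:R * (es mu S k.+2 / es mu S k.+1) =
    \sum_(i in S) mu i * es mu (S :\ i) k.+1 / es mu S k.+1.
  by rewrite mulrA -es_euler mulr_suml.
have -> : k.+2%:R * ((des e mu S k.+2 * es e S k.+1 - es e S k.+2 * des e mu S k.+1) /
     es e S k.+1 ^+ 2) =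
   \sum_(i in S) ((mu i * es e (S :\ i) k.+1 + e i * des e mu (S :\ i) k.+1) * es e S k.+1
      - e i * es e (S :\ i) k.+1 * des e mu S k.+1) / es e S k.+1 ^+ 2.
  rewrite -mulr_suml sumrB -!mulr_suml big_split /= des_euler es_euler.
  by rewrite mulrA -!/(des e mu S k.+2) -[k.+2%:R]natr1 /=; ring.
apply: ler_sum => i iS.
have := IH (S :\ i) (gamD1 iS ge) (gamD1 iS gm).
have eb := gamD1 iS ge (leqnSn k); have mb := gamD1 iS gm (leqnSn k).
move: ea ma; rewrite !(es_D1 _ _ iS) (des_D1 _ _ _ iS).
move: eb mb; move: (es e _ k) (es e _ k.+1) (es mu _ k) (es mu _ k.+1) => b c mb mc.
move: (des _ _ _ k) (des _ _ _ k.+1) (e i) (mu i) => b' c' x m b0 mb0 a0 ma0.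
rewrite ler_pdivlMr ?exprn_gt0 // => h.
(* With q the quotient of the reduced set, the left side is the parallel sum m q / (q + m). Only q +
   m > 0 is available, as m may be negative; the final slack is the square of m c - q x b. *)
pose q := mc / mb; have emc : mc = q * mb by rewrite /q divfK // gt_eqF.
rewrite -/q in h; have r0 : 0 < q + m.
  by rewrite -(pmulr_lgt0 _ mb0) mulrDl -emc.
have -> : m * mc / (mc + m * mb) = m * q / (q + m).
  by rewrite emc; field; rewrite -mulrDl mulf_neq0 // gt_eqF.
rewrite ler_pdivlMr ?exprn_gt0 // mulrAC ler_pdivrMr //.
set a := c + x * b in a0 *.
have h1 : m * c ^+ 2 + x ^+ 2 * (q * b ^+ 2) <= (m * c + x * c') * a - x * c * (c' + x * b' + m * b).
  have := ler_wpM2l (sqr_ge0 x) h; rewrite /a; nra.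
apply: le_trans (_ : (m * c ^+ 2 + x ^+ 2 * (q * b ^+ 2)) * (q + m) <= _); last by rewrite ler_pM2r.
by rewrite /a; have := sqr_ge0 (m * c - q * x * b); nra.
Qed.

End GardingCone.

Section Garding.
Variables (R : realType) (T : finType).
Implicit Types (e mu : T -> R) (S : {set T}).

Lemma ln_le_sub1 (x : R) : 0 < x -> ln x <= x - 1.
Proof. by move=> x0; have := expR_ge1Dx (ln x); rewrite lnK // lerBrDl. Qed.

(** [es] is the telescoping product of the quotients es_(j+1) / es_j, each concave and homogeneous
    of degree 1; [ln v <= v - 1] adds up their supporting inequalities. *)
Lemma des_ge_ln k e mu S : gam k e S -> gam k mu S ->
  k%:R + ln (es mu S k / es e S k) <= des e mu S k / es e S k.
Proof.
elim: k => [|k IH] ge gm; first by rewrite !es0 divr1 ln1 addr0 mul0r.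
have {}IH := IH (gamW (leqnSn k) ge) (gamW (leqnSn k) gm).
have h := es_quotient_concave ge gm.
have [e0 e1] := (ge k (leqnSn _), ge k.+1 (leqnn _)).
have [m0 m1] := (gm k (leqnSn _), gm k.+1 (leqnn _)).
pose u := es mu S k / es e S k.
pose v := (es mu S k.+1 / es mu S k) / (es e S k.+1 / es e S k).
have u0 : 0 < u by rewrite divr_gt0.
have v0 : 0 < v by rewrite !divr_gt0.
have -> : es mu S k.+1 / es e S k.+1 = u * v.
  by rewrite /u /v; field; rewrite !gt_eqF.
rewrite lnM ?posrE // -natr1 addrACA.
have hv := ln_le_sub1 v0.
apply: (@le_trans _ _ (des e mu S k / es e S k + v)); first by rewrite lerD // addrC -lerBrDr.
rewrite addrC -lerBrDr /v ler_pdivrMr ?divr_gt0 //.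
apply: le_trans h _; rewrite le_eqVlt; apply/orP; left; apply/eqP.
by field; rewrite !gt_eqF.
Qed.

(** The logarithm is bounded below by 1 - 1/x, so that f will enter the maximum principle only
    through the quotient f(x0) / f(x). *)
Lemma des_ge k e mu S : gam k e S -> gam k mu S ->
  k%:R + 1 - es e S k / es mu S k <= des e mu S k / es e S k.
Proof.
move=> ge gm; apply: le_trans (des_ge_ln ge gm).
have [e0 m0] := (ge k (leqnn _), gm k (leqnn _)).
have := ln_le_sub1 (divr_gt0 e0 m0).
by rewrite -invf_div lnV ?posrE ?divr_gt0 // -addrA lerD2l; lra.
Qed.

End Garding.

(** * Symmetric matrices: eigenframes and the supporting functional of ln sigma_k *)

Lemma cvg_sum_fin (R : realType) (X : Type) (F : set_system X) {FF : Filter F}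
    (I : Type) (r : seq I) (P : pred I) (f : I -> X -> R) (l : I -> R) :
  (forall i, P i -> f i x @[x --> F] --> l i) ->
  (\sum_(i <- r | P i) f i x) @[x --> F] --> \sum_(i <- r | P i) l i.
Proof. exact: (cvg_big add_continuous). Qed.

Lemma continuous_sum_fin (R : realType) (X : topologicalType) (x : X)
    (I : Type) (r : seq I) (P : pred I) (f : I -> X -> R) :
  (forall i, P i -> {for x, continuous (f i)}) ->
  {for x, continuous (fun y => \sum_(i <- r | P i) f i y)}.
Proof. exact: (@cvg_sum_fin R X (nbhs x) _ I r P f (f ^~ x)). Qed.

Section Frames.
Variables (R : realType) (n : nat).
Implicit Types (A B O : 'M[R]_n) (u v : 'rV[R]_n) (w : 'I_n -> R).

Definition bf A u v : R := (u *m A *m v^T) 0 0.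
Definition orth O := O *m O^T = 1%:M.

Lemma bfE A u v : bf A u v = \sum_i \sum_j u 0 i * A i j * v 0 j.
Proof.
rewrite /bf mxE exchange_big /=; apply: eq_bigr => j _.
by rewrite !mxE mulr_suml.
Qed.

Lemma bfDl A u u' v : bf A (u + u') v = bf A u v + bf A u' v.
Proof. by rewrite /bf !mulmxDl mxE. Qed.
Lemma bfZl A c u v : bf A (c *: u) v = c * bf A u v.
Proof. by rewrite /bf -!scalemxAl mxE. Qed.
Lemma bfDr A u v v' : bf A u (v + v') = bf A u v + bf A u v'.
Proof. by rewrite /bf linearD /= mulmxDr mxE. Qed.
Lemma bfZr A c u v : bf A u (c *: v) = c * bf A u v.
Proof. by rewrite /bf linearZ /= -scalemxAr mxE. Qed.
Lemma bfC A u v : A^T = A -> bf A u v = bf A v u.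
Proof.
by move=> sA; rewrite /bf -[in LHS]sA -[LHS]trace_mx11 -mxtrace_tr !trmx_mul !trmxK mulmxA trace_mx11.
Qed.
Lemma conj_bf O A i j : (O *m A *m O^T) i j = bf A (row i O) (row j O).
Proof.
rewrite /bf -row_mul tr_row; rewrite !mxE; apply: eq_bigr => k _.
by rewrite [row i _ _ _]mxE [col _ _ _ _]mxE.
Qed.

Lemma orthP O : orth O <-> forall i j, bf 1%:M (row i O) (row j O) = (i == j)%:R.
Proof.
split=> [oO i j|h]; first by rewrite -conj_bf mulmx1 oO mxE.
by apply/matrixP => i j; rewrite [RHS]mxE -h -conj_bf mulmx1.
Qed.

Lemma orth_tr O : orth O -> O^T *m O = 1%:M.
Proof. exact: mulmx1C. Qed.

(** Plane rotations of two rows are the only variations of a frame needed to diagonalise. *)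
Definition rotate (p q : 'I_n) (c s : R) O : 'M[R]_n := \matrix_i
  if i == p then c *: row p O + s *: row q O
  else if i == q then (- s) *: row p O + c *: row q O else row i O.

Lemma rotate_orth p q c s O : p != q -> c ^+ 2 + s ^+ 2 = 1 -> orth O ->
  orth (rotate p q c s O).
Proof.
move=> pq cs /orthP oO; apply/orthP => i j.
have qp : (q == p) = false by rewrite eq_sym (negPf pq).
rewrite !rowK; have [?|ip] := eqVneq i p; [subst i|have [?|iq] := eqVneq i q; [subst i|]];
  (have [?|jp] := eqVneq j p; [subst j|have [?|jq] := eqVneq j q; [subst j|]]);
  rewrite ?(bfDl, bfDr, bfZl, bfZr) !oO ?eqxx ?(negPf pq) ?qp ?(negPf ip) ?(negPf jp)
    ?(negPf iq) ?(negPf jq) ?(eq_sym p) ?(eq_sym q) ?(negPf ip) ?(negPf jp)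
    ?(negPf iq) ?(negPf jq) /=; nra.
Qed.

Definition wdiag A w O : R := \sum_i w i * bf A (row i O) (row i O).

Lemma wdiag_rotate A w p q c s O : p != q -> c ^+ 2 + s ^+ 2 = 1 -> A^T = A ->
  wdiag A w (rotate p q c s O) - wdiag A w O =
  (w p - w q) * (2 * c * s * bf A (row p O) (row q O)
     - s ^+ 2 * (bf A (row p O) (row p O) - bf A (row q O) (row q O))).
Proof.
move=> pq cs sA; have qp : q != p by rewrite eq_sym.
rewrite /wdiag -sumrB (bigD1 p) //= (bigD1 q) //= big1 => [|i /andP[ip iq]]; last first.
  by rewrite !rowK (negPf ip) (negPf iq) subrr.
rewrite !rowK eqxx (negPf qp) eqxx !(bfDl, bfDr, bfZl, bfZr).
rewrite (bfC (row q O) (row p O) sA).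
have c2 : c * c = 1 - s ^+ 2 by rewrite -cs -expr2 addrK.
move: (bf _ _ _) (bf _ _ _) (bf _ _ _) => d b a.
transitivity (w p * ((c * c) * a + 2 * c * s * b + s * s * d) - w p * a +
  (w q * (s * s * a - 2 * c * s * b + (c * c) * d) - w q * d)); first by ring.
by rewrite c2; ring.
Qed.

Lemma quad_zero (a b : R) : (forall t, t ^+ 2 * a <= 2 * t * b) -> b = 0.
Proof.
move=> h; apply/eqP; rewrite -sqrf_eq0 eq_le sqr_ge0 andbT leNgt; apply/negP => b0.
pose d := `|a| + 1; have d0 : 0 < d by rewrite ltr_wpDl.
have := h (- b / d); rewrite !mulrA -(ler_pM2r (exprn_gt0 2 d0)).
have -> : (- b / d) ^+ 2 * a * d ^+ 2 = b ^+ 2 * a by field; rewrite gt_eqF.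
have -> : 2 * - b / d * b * d ^+ 2 = - (2 * b ^+ 2 * d) by field; rewrite gt_eqF.
have := ler_norm (- a); rewrite normrN -/d => h1 h2.
have : b ^+ 2 * (2 * d + a) <= 0 by lra.
rewrite pmulr_rle0 //; have := normr_ge0 a; rewrite /d in h2 *; lra.
Qed.

Lemma offdiag0 A w p q O : p != q -> A^T = A -> w p != w q ->
  (forall c s, c ^+ 2 + s ^+ 2 = 1 -> wdiag A w O <= wdiag A w (rotate p q c s O)) ->
  bf A (row p O) (row q O) = 0.
Proof.
move=> pq sA wpq min.
suff : (w p - w q) * bf A (row p O) (row q O) = 0.
  by move/eqP; rewrite mulf_eq0 subr_eq0 (negPf wpq) => /eqP.
apply: (@quad_zero ((w p - w q) * (bf A (row p O) (row p O) - bf A (row q O) (row q O)))) => t.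
(* The rotation of tangent [t]; multiplying by [d ^+ 2] makes minimality a quadratic inequality in
   [t]. *)
pose d := Num.sqrt (1 + t ^+ 2).
have d2 : d ^+ 2 = 1 + t ^+ 2 by rewrite sqr_sqrtr // addr_ge0 ?sqr_ge0.
have d0 : d != 0 by rewrite -sqrf_eq0 d2 gt_eqF // ltr_pwDl ?sqr_ge0.
have cs : (1 / d) ^+ 2 + (t / d) ^+ 2 = 1.
  by rewrite !exprMn -mulrDl expr1n exprVn d2 divff // -d2 sqrf_eq0.
have := min _ _ cs; rewrite -subr_ge0 (wdiag_rotate _ _ pq cs sA).
have dd : 0 < d ^+ 2 by rewrite d2 ltr_pwDl ?sqr_ge0.
rewrite -(pmulr_lge0 _ dd).
set x := bf _ _ _; set y := (bf _ _ _ - _).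
have -> : (w p - w q) * (2 * (1 / d) * (t / d) * x - (t / d) ^+ 2 * y) * d ^+ 2 =
  (w p - w q) * (2 * t * x - t ^+ 2 * y) by field.
by move: (w p - w q) => D; lra.
Qed.

(** Matrices are stored as row vectors, where closed bounded sets are known to be compact. *)
Definition frames : set 'rV[R]_(n * n) := [set v | orth (vec_mx v)].

Lemma continuous_bf_frame A i j :
  continuous (fun v : 'rV[R]_(n * n) => bf A (row i (vec_mx v)) (row j (vec_mx v))).
Proof.
move=> v; under eq_fun do rewrite bfE.
apply: continuous_sum_fin => k _; apply: continuous_sum_fin => l _.
have cc a b : (fun u : 'rV[R]_(n * n) => row a (vec_mx u) 0 b) @ v --> row a (vec_mx v) 0 b.
  under eq_fun do rewrite !mxE; rewrite !mxE; exact: coord_continuous.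
by apply: continuousM; [apply: continuousM; [exact: cc|exact: cst_continuous]|exact: cc].
Qed.

Lemma frames_compact : compact frames.
Proof.
apply: bounded_closed_compact.
  exists 1; split => // M M1 v /orthP oO; apply: le_trans (ltW M1).
  rewrite -[`|v|]/(mx_norm v) mx_normrE; apply/bigmax_leP; split => // -[a b] _ /=.
  rewrite ord1; case/mxvec_indexP: b => i j.
  have := oO i i; rewrite eqxx bfE (bigD1 j) //= (bigD1 j) //= [X in _ + X + _]big1 => [|k kj]; last first.
    by rewrite !mxE [j == k]eq_sym (negPf kj) mulr0 mul0r.
  rewrite !mxE eqxx mulr1 addr0 => e.
  suff h : v 0 (mxvec_index i j) * v 0 (mxvec_index i j) <= 1.
    by rewrite ler_norml; apply/andP; split; nra.
  rewrite -[leRHS]/(true%:R) -e lerDl; apply: sumr_ge0 => k _; rewrite (bigD1 k) //= big1 => [|l lk].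
    by rewrite !mxE eqxx mulr1 addr0 -expr2 sqr_ge0.
  by rewrite !mxE [k == l]eq_sym (negPf lk) mulr0 mul0r.
have -> : frames = \bigcap_(ij in [set: 'I_n * 'I_n])
   (fun v : 'rV[R]_(n * n) => bf 1%:M (row ij.1 (vec_mx v)) (row ij.2 (vec_mx v))) @^-1`
      [set (ij.1 == ij.2)%:R].
  apply/seteqP; split => [v /orthP h [i j] _|v h]; first exact: h.
  by apply/orthP => i j; exact: (h (i, j)).
apply: closed_bigI => -[i j] _; apply: preimage_closed; last exact: closed_eq.
by move=> v _; exact: continuous_bf_frame.
Qed.

Lemma continuous_wdiag A w : continuous (fun v : 'rV[R]_(n * n) => wdiag A w (vec_mx v)).
Proof.
move=> v; apply: continuous_sum_fin => i _.
by apply: continuousM; [exact: cst_continuous|exact: continuous_bf_frame].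
Qed.

(* Minimise the w-weighted diagonal first, and an auxiliary diagonal with distinct
   weights among the minimisers: rotations inside the blocks of constant w are then
   covered by the second minimisation. *)
Lemma diagonalizing_frame A w : A^T = A -> exists O, [/\ orth O,
  forall i j, i != j -> bf A (row i O) (row j O) = 0 &
  wdiag A w O <= \sum_i w i * A i i].
Proof.
move=> sA.
have wc B x (K : set 'rV[R]_(n * n)) :
    {within K, continuous (fun v : 'rV[R]_(n * n) => wdiag B x (vec_mx v))}.
  by apply: continuous_subspaceT; exact: continuous_wdiag.
have f0 : frames !=set0 by exists (mxvec 1%:M); rewrite /frames /= mxvecK /orth trmx1 mulmx1.
have [v1] := compact_EVT_min f0 frames_compact (wc A w frames).
rewrite inE => fv1 min1.
pose m := wdiag A w (vec_mx v1).
pose G := frames `&` (fun v : 'rV[R]_(n * n) => wdiag A w (vec_mx v)) @^-1` [set x | x <= m].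
have cG : compact G.
  apply: (subclosed_compact _ frames_compact); last by move=> x [].
  apply: closedI; first exact: compact_closed frames_compact.
  apply: preimage_closed; last exact: closed_le.
  by move=> v _; exact: continuous_wdiag.
have G0 : G !=set0 by exists v1; split => //=.
have [v2] := compact_EVT_min G0 cG (wc A (fun i => (val i)%:R) G).
rewrite inE => -[fv2 /= wv2] min2.
have mle O : orth O -> m <= wdiag A w O.
  by move=> oO; rewrite -(mxvecK O); apply: min1; rewrite inE /frames /= mxvecK.
exists (vec_mx v2); split => // [i j ij|].
  have [wij|wij] := eqVneq (w i) (w j); last first.
    apply: (offdiag0 ij sA wij) => c s cs; apply: le_trans wv2 (mle _ _).
    exact: rotate_orth.
  have vij : (val i)%:R != (val j)%:R :> R by rewrite eqr_nat.
  apply: (offdiag0 ij sA vij) => c s cs; have oR := rotate_orth ij cs fv2.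
  rewrite -(mxvecK (rotate _ _ _ _ _)); apply: min2; rewrite inE; split.
    by rewrite /frames /= mxvecK.
  rewrite /= mxvecK; apply: le_trans wv2; rewrite -subr_le0.
  by rewrite (wdiag_rotate _ _ ij cs sA) wij subrr mul0r.
(* Comparison with the identity frame is the Schur-type inequality. *)
have := mle 1%:M; rewrite /orth trmx1 mulmx1 => /(_ erefl) h.
apply: le_trans wv2 _; apply: le_trans h _; rewrite le_eqVlt; apply/orP; left; apply/eqP.
by apply: eq_bigr => i _; rewrite -conj_bf mul1mx trmx1 mulmx1.
Qed.
End Frames.

(** * Eigenvalues and their elementary symmetric functions *)

Section Eigenvalues.
Variables (R : realType) (n : nat).
Implicit Types (A E O : 'M[R]_n) (d e : 'I_n -> R).

Lemma char_poly_orth A O : orth O -> char_poly (O *m A *m O^T) = char_poly A.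
Proof.
move=> oO; rewrite /char_poly.
have mO : map_mx polyC O *m map_mx polyC O^T = 1%:M by rewrite -map_mxM oO map_mx1.
have -> : char_poly_mx (O *m A *m O^T) =
    map_mx polyC O *m char_poly_mx A *m map_mx polyC O^T.
  rewrite /char_poly_mx mulmxBr mulmxBl !map_mxM; congr (_ - _).
  by rewrite scalar_mxC -mulmxA mO mulmx1.
by rewrite !det_mulmx mulrAC -det_mulmx mO det1 mul1r.
Qed.

Lemma esN (T : finType) (x : T -> R) (S : {set T}) k :
  es (fun i => - x i) S k = (-1) ^+ k * es x S k.
Proof.
by rewrite /es mulr_sumr; apply: eq_bigr => I /andP[_ /eqP <-]; rewrite prodrN.
Qed.

Lemma es_roots (x y : 'I_n -> R) k :
  \prod_i ('X - (x i)%:P) = \prod_i ('X - (y i)%:P) ->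
  es x [set: 'I_n]%SET k = es y [set: 'I_n]%SET k.
Proof.
move=> h; have cT : #|[set: 'I_n]%SET| = n by rewrite cardsT card_ord.
have [kn|kn] := leqP k n; last by rewrite !es_gt ?cT.
have c (z : 'I_n -> R) :
    (\prod_i ('X - (z i)%:P))`_(n - k) = (-1) ^+ k * es z [set: 'I_n]%SET k.
  rewrite -esN -[in RHS](subKn kn) -[X in (X - (n - k))%N]cT.
  rewrite -coef_prod_XaddC ?cT ?leq_subr //.
  rewrite (_ : \prod_i _ = \prod_(i in [set: 'I_n]%SET) ('X + (- z i)%:P)) //.
  by apply: eq_big => [i|i _]; rewrite ?finset.in_setT // polyCN.
apply: (@mulfI _ ((-1) ^+ k)); first by rewrite signr_eq0.
by rewrite -!c h.
Qed.

Lemma sigma_es k (lam : 'rV[R]_n) : sigma k lam = es (lam 0) [set: 'I_n]%SET k.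
Proof. by apply: eq_bigl => I; rewrite finset.subsetT. Qed.

Lemma sigma_eigenvalues A O k : orth O ->
  (forall i j, i != j -> bf A (row i O) (row j O) = 0) ->
  sigma k (eigenvalues A) =
    es (fun i => bf A (row i O) (row i O)) [set: 'I_n]%SET k.
Proof.
move=> oO off; pose d : 'rV[R]_n := \row_i bf A (row i O) (row i O).
have cd : char_poly A = \prod_(i < n) ('X - (d 0 i)%:P).
  rewrite -(char_poly_orth A oO) char_poly_trig.
    by apply: eq_bigr => i _; rewrite conj_bf mxE.
  by apply/is_trig_mxP => i j ij; rewrite conj_bf off // -val_eqE ltn_eqF.
(* The diagonal [d] is an admissible list of roots, so [xget] does not return its default. *)
have := @xgetPex _ 0 [set lam : 'rV[R]_n |
    char_poly A = \prod_(i < n) ('X - (lam 0 i)%:P)] (ex_intro _ d cd).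
rewrite -/(eigenvalues A) /= cd => /es_roots h.
by rewrite sigma_es -h; apply: eq_bigr => I _; apply: eq_bigr => i _; rewrite mxE.
Qed.

Lemma Gamma_gam k A O : orth O ->
  (forall i j, i != j -> bf A (row i O) (row j O) = 0) ->
  Gamma k (eigenvalues A) ->
  gam k (fun i => bf A (row i O) (row i O)) [set: 'I_n]%SET.
Proof.
move=> oO off G j jk; have [->|j0] := posnP j; first by rewrite es0.
by rewrite -sigma_eigenvalues //; apply: G; rewrite j0.
Qed.

Lemma eigenvalues_orth A O : orth O -> eigenvalues (O *m A *m O^T) = eigenvalues A.
Proof. by move=> oO; rewrite /eigenvalues char_poly_orth. Qed.

(* At e, the gradient of ln sigma_k is a supporting functional for symmetric
   matrices: the weighted diagonal of E only decreases when E is diagonalised. *)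
Lemma matrix_garding k E e : E^T = E -> gam k.+1 e [set: 'I_n]%SET ->
  Gamma k.+1 (eigenvalues E) ->
  k.+1%:R + 1 - es e [set: 'I_n]%SET k.+1 / sigma k.+1 (eigenvalues E) <=
  \sum_i es e ([set: 'I_n] :\ i)%SET k / es e [set: 'I_n]%SET k.+1 * E i i.
Proof.
move=> sE ge GE.
have [Q [oO off wO]] := diagonalizing_frame
   (fun i => es e ([set: 'I_n] :\ i)%SET k / es e [set: 'I_n]%SET k.+1) sE.
apply: le_trans wO; rewrite (sigma_eigenvalues _ oO off).
apply: le_trans (des_ge ge (Gamma_gam oO off GE)) _.
rewrite /wdiag /des mulr_suml le_eqVlt; apply/orP; left; apply/eqP.
by apply: eq_big => [i|i _]; [rewrite finset.in_setT|ring].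
Qed.

End Eigenvalues.

(** * The algebraic bound on the largest Hessian eigenvalue *)

Section FinalBound.
Variables (R : realType) (n : nat).
Implicit Types (kap : 'I_n -> R).

Local Notation full := [set: 'I_n]%SET.

(** The eigenvalues of eta when [kap] are those of the Hessian. [sigma_grad] is the gradient of ln
    sigma_(k+1) in the former, and [hess_coef] its pullback to [kap] by the chain rule. *)
Definition eta_of kap i : R := \sum_j kap j - kap i.
Definition sigma_grad k (e : 'I_n -> R) i : R := es e (full :\ i)%SET k / es e full k.+1.
Definition hess_coef k (e : 'I_n -> R) i : R := \sum_(j | j != i) sigma_grad k e j.

Lemma sigma_grad_gt0 k e i : gam k.+1 e full -> 0 < sigma_grad k e i.
Proof.
by move=> ge; rewrite divr_gt0 ?ge //; apply: (gamD1 _ ge); rewrite ?finset.in_setT.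
Qed.

Lemma hess_coef_ge k e i j : gam k.+1 e full -> j != i ->
  sigma_grad k e j <= hess_coef k e i.
Proof.
move=> ge ji; rewrite /hess_coef (bigD1 j) //= lerDl; apply: sumr_ge0 => l _.
exact/ltW/sigma_grad_gt0.
Qed.

Lemma hess_coef_ge0 k e i : gam k.+1 e full -> 0 <= hess_coef k e i.
Proof. by move=> ge; apply: sumr_ge0 => l _; exact/ltW/sigma_grad_gt0. Qed.

Lemma es_const (T : finType) (S : {set T}) (t : R) k :
  es (fun=> t) S k = 'C(#|S|, k)%:R * t ^+ k.
Proof.
rewrite /es (eq_bigr (fun=> t ^+ k)) => [|I /andP[_ /eqP <-]]; last by rewrite prodr_const.
rewrite -cards_draws mulr_natl -sumr_const.
by apply: eq_bigl => I; rewrite inE.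
Qed.

(* Test the supporting functional at a large multiple of the identity. *)
Lemma sigma_grad_sum k e (t : R) : gam k.+1 e full -> 1 <= t ->
  es e full k.+1 <= t -> (k.+1 <= n)%N -> 1 <= t * \sum_i sigma_grad k e i.
Proof.
move=> ge t1 et kn.
have cT : #|full| = n by rewrite cardsT card_ord.
have t0 : 0 < t by apply: lt_le_trans t1.
have gt : gam k.+1 (fun=> t) full.
  move=> j jk; rewrite es_const mulr_gt0 ?exprn_gt0 // ltr0n bin_gt0 cT.
  exact: leq_trans jk kn.
have := des_ge ge gt.
(* As t >= 1, the value at t times the identity is at least t^(k+1) >= t. *)
have tt : t <= es (fun=> t) full k.+1.
  rewrite es_const cT; apply: (@le_trans _ _ (t ^+ k.+1)).
    by rewrite exprS ler_peMr ?exprn_ege1 // ltW.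
  by rewrite ler_peMl ?exprn_ge0 ?(ltW t0) // ler1n bin_gt0.
have h : es e full k.+1 / es (fun=> t) full k.+1 <= 1.
  by rewrite ler_pdivrMr ?mul1r ?(le_trans et) // gt.
move=> /(le_trans _) h2; apply: (@le_trans _ _ (des e (fun=> t) full k.+1 / es e full k.+1)).
  by apply: h2; have := ler0n R k; rewrite -natr1; lra.
rewrite /des mulr_suml mulr_sumr le_eqVlt; apply/orP; left; apply/eqP.
by apply: eq_big => [i|i _]; rewrite ?finset.in_setT // mulrA.
Qed.

End FinalBound.

Lemma es_card (R : comNzRingType) (T : finType) (x : T -> R) (S : {set T}) :
  es x S #|S| = \prod_(i in S) x i.
Proof.
rewrite /es (big_pred1 S) // => I.
by rewrite /= [RHS]eqEcard; apply: andb_id2l => IS; rewrite eqn_leq subset_leq_card.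
Qed.

Section KappaBound.
Variables (R : realType) (n : nat).
Local Notation full := [set: 'I_n]%SET.

Lemma sigma_grad_anti k (e : 'I_n -> R) i j : gam k.+1 e full -> e i <= e j ->
  sigma_grad k e j <= sigma_grad k e i.
Proof.
move=> ge eij; rewrite ler_wpM2r ?invr_ge0 ?(ltW (ge _ _)) //.
by apply: es_D1_anti ge eij; rewrite finset.in_setT.
Qed.

(** [hess_coef] at [i] omits [sigma_grad] at [i], the largest derivative; the second largest has to
    bound it below. *)
Lemma sigma_grad_second k (e : 'I_n -> R) i : (k.+1 < n)%N -> gam k.+1 e full ->
  (forall j, e i <= e j) ->
  exists2 j, j != i & sigma_grad k e i <= n.+1%:R ^+ 3 * sigma_grad k e j.
Proof.
move=> kn ge emin; have cT : #|full| = n by rewrite cardsT card_ord.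
have [j0 j0i] : exists j, j != i.
  have /card_gt0P[j] : (0 < #|full :\ i|%SET)%N.
    by have := cardsD1 i full; rewrite finset.in_setT cT; case: #|_|; lia.
  by rewrite !inE andbT => ji; exists j.
have [j ji jmin] := @arg_minP _ _ _ j0 (fun j => j != i) e j0i.
exists j => //; rewrite /sigma_grad mulrA ler_wpM2r ?invr_ge0 ?(ltW (ge _ _)) //.
rewrite -[in n.+1]cT; apply: es_D1_comparable ge (emin j) _; rewrite ?finset.in_setT ?cT //.
  by rewrite eq_sym.
by move=> l; rewrite !inE andbT => /andP[_]; exact: jmin.
Qed.

Lemma kappa_bound k (C t : R) : (2 <= n)%N -> (k < n)%N -> ~ (n = 2 /\ k = 1)%N ->
  0 <= C -> 1 <= t -> exists B, forall (kap : 'I_n -> R) i1,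
  gam k.+1 (eta_of kap) full -> es (eta_of kap) full k.+1 <= t ->
  (forall i, kap i <= kap i1) ->
  \sum_a hess_coef k (eta_of kap) a * kap a ^+ 2 + \sum_a hess_coef k (eta_of kap) a
    <= C * (1 + kap i1) ->
  kap i1 <= B.
Proof.
move=> n2 kn nk C0 t1; pose N : R := n%:R; pose D := 2 * C * t * N.
have N2 : 2 <= N by rewrite (ler_nat R 2).
have N0 : N != 0 by rewrite gt_eqF // (lt_le_trans _ N2).
have D0 : 0 <= D by rewrite !mulr_ge0 //; lra.
have N3 : 0 <= n.+1%:R ^+ 3 :> R by rewrite exprn_ge0.
(* One summand for each way out: K < 2; k + 1 < n; K small against D when k + 1 = n; the final
   comparison. *)
exists (2 + D * n.+1%:R ^+ 3 + 4 * N ^+ 2 * D + 8 * C * t) => kap i1 ge et kmax hC.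
have ND : 0 <= 4 * N ^+ 2 * D by rewrite !mulr_ge0 // ?sqr_ge0 //; lra.
have DN3 : 0 <= D * n.+1%:R ^+ 3 by rewrite mulr_ge0.
have Ct : 0 <= 8 * C * t by rewrite !mulr_ge0 //; lra.
set e := eta_of kap in ge et hC *; set K := kap i1 in hC kmax *.
have [K2|K2] := ltP K 2; first by lra.
have K0 : 0 < K by lra.
have emin j : e i1 <= e j by rewrite lerD2l lerN2.
pose g1 := sigma_grad k e i1; have g10 : 0 < g1 := sigma_grad_gt0 i1 ge.
have F0 a := hess_coef_ge0 a ge.
have FK0 a : 0 <= hess_coef k e a * kap a ^+ 2 by rewrite mulr_ge0 ?sqr_ge0.
have hC' : C * (1 + K) <= 2 * C * K by have := mulr_ge0 C0 (_ : 0 <= K - 1); lra.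
have sF0 : 0 <= \sum_a hess_coef k e a by apply: sumr_ge0.
have sFK0 : 0 <= \sum_a hess_coef k e a * kap a ^+ 2 by apply: sumr_ge0.
have Fa a : hess_coef k e a * kap a ^+ 2 <= 2 * C * K.
  apply: le_trans hC'; apply: le_trans hC; apply: (@le_trans _ _ (\sum_a hess_coef k e a * kap a ^+ 2)).
    by rewrite (bigD1 a) //= lerDl sumr_ge0.
  by rewrite lerDl.
have Fs a : hess_coef k e a <= 2 * C * K.
  apply: le_trans hC'; apply: le_trans hC; apply: (@le_trans _ _ (\sum_a hess_coef k e a)).
    by rewrite (bigD1 a) //= lerDl sumr_ge0.
  by rewrite lerDr.
(* The smallest eta-eigenvalue carries the largest derivative, hence [g1] is at least a share 1/n of
   the sum. *)
have tg : 1 <= t * N * g1.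
  apply: le_trans (sigma_grad_sum ge t1 et kn) _; rewrite -mulrA ler_wpM2l ?(le_trans ler01) //.
  apply: (@le_trans _ _ (\sum_(i < n) g1)).
    by apply: ler_sum => i _; exact: sigma_grad_anti.
  by rewrite sumr_const card_ord -mulr_natl.
have tN0 : 0 <= t * N by rewrite mulr_ge0 //; lra.
have [kn'|kn'] := ltnP k.+1 n.
  have [j ji hj] := sigma_grad_second kn' ge emin.
  have hF : sigma_grad k e j <= hess_coef k e i1 by apply: hess_coef_ge.
  have h1 : 1 <= t * N * n.+1%:R ^+ 3 * hess_coef k e i1.
    have hgF : g1 <= n.+1%:R ^+ 3 * hess_coef k e i1.
      by apply: le_trans hj _; rewrite ler_wpM2l.
    by apply: le_trans tg _; rewrite -(mulrA (t * N)) ler_wpM2l.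
  have h2 : K ^+ 2 <= D * n.+1%:R ^+ 3 * K.
    apply: (@le_trans _ _ (t * N * n.+1%:R ^+ 3 * (hess_coef k e i1 * K ^+ 2))).
      by rewrite mulrA ler_peMl ?sqr_ge0.
    have -> : D * n.+1%:R ^+ 3 * K = t * N * n.+1%:R ^+ 3 * (2 * C * K) by rewrite /D; ring.
    by rewrite ler_wpM2l ?Fa // mulr_ge0.
  have : K <= D * n.+1%:R ^+ 3 by rewrite -(@ler_pM2r _ K) -?expr2 //; lra.
  by lra.
(* Excluding n = 2, k = 1 ensures that the product of eta-eigenvalues below has at least two
   factors. *)
have k2 : (2 <= k)%N by move: n2 kn nk kn'; clear; lia.
have kE : k.+1 = n by apply/eqP; rewrite eqn_leq kn.
have [KD|KD] := leP K (4 * N ^+ 2 * D); first by lra.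
(* For [a] other than [i1], [hess_coef] at [a] contains [g1]; hence [kap a] is of order sqrt K,
   small compared with K. *)
have small a : a != i1 -> `|kap a| <= K / (2 * N).
  move=> ai; have h1 : kap a ^+ 2 <= D * K.
    apply: (@le_trans _ _ (t * N * (hess_coef k e a * kap a ^+ 2))).
      rewrite mulrA ler_peMl ?sqr_ge0 // (le_trans tg) // ler_wpM2l //.
      by apply: hess_coef_ge => //; rewrite eq_sym.
    have -> : D * K = t * N * (2 * C * K) by rewrite /D; ring.
    by rewrite ler_wpM2l ?Fa.
  rewrite -ler_sqr ?nnegrE ?divr_ge0 //; [|lra|lra]; rewrite real_normK ?num_real //.
  apply: le_trans h1 _; rewrite exprMn exprVn ler_pdivlMr ?exprn_gt0 ?mulr_gt0 //; [|lra].
  have -> : D * K * (2 * N) ^+ 2 = (4 * N ^+ 2 * D) * K by ring.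
  by rewrite [leRHS]expr2 ler_wpM2r ?(ltW KD) //; lra.
have ebig j : j \in (full :\ i1)%SET -> K / 2 <= e j.
  rewrite !inE andbT => ji; have eE : e j = K + \sum_(l | (l != j) && (l != i1)) kap l.
    by rewrite /e /eta_of (bigD1 j) //= addrAC subrr add0r (bigD1 i1) //= eq_sym.
  have : - (\sum_(l | (l != j) && (l != i1)) kap l) <= K / 2.
    apply: le_trans (ler_norm _) _; rewrite normrN; apply: le_trans (ler_norm_sum _ _ _) _.
    apply: (@le_trans _ _ (\sum_(l < n) K / (2 * N))).
      rewrite [leRHS](bigID (fun l => (l != j) && (l != i1))) /=.
      rewrite -[leLHS]addr0 lerD //; last by apply: sumr_ge0 => l _; rewrite divr_ge0 //; lra.
      by apply: ler_sum => l /andP[_]; exact: small.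
    rewrite sumr_const card_ord -mulr_natl -/N le_eqVlt; apply/orP; left; apply/eqP.
    by field.
  by rewrite eE; lra.
have cT : #|(full :\ i1)%SET| = k.
  have := cardsD1 i1 full; rewrite finset.in_setT cardsT card_ord.
  by move: #|_| => c h; apply/eqP; rewrite -eqSS kE h.
have h1 : (K / 2) ^+ 2 <= es e (full :\ i1)%SET k.
  rewrite -[in leRHS]cT es_card; apply: (@le_trans _ _ (\prod_(j in (full :\ i1)%SET) (K / 2))).
    by rewrite prodr_const cT; apply: ler_weXn2l => //; lra.
  by apply: ler_prod => j /ebig ->; rewrite andbT; lra.
have es_gt0 : 0 < es e full k.+1 by apply: ge.
have [a ai] : exists a, a != i1.
  have /card_gt0P[a] : (0 < #|full :\ i1|%SET)%N by rewrite cT (leq_trans _ k2).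
  by rewrite !inE andbT => ?; exists a.
(* [sigma_grad] at [i1] is bounded by some [hess_coef], hence linearly in K, although its numerator
   is at least quadratic. *)
have h2 : es e (full :\ i1)%SET k <= es e full k.+1 * (2 * C * K).
  rewrite mulrC -ler_pdivrMr //; apply: le_trans (Fs a).
  by apply: hess_coef_ge => //; rewrite eq_sym.
have h3 : es e full k.+1 * (2 * C * K) <= t * (2 * C * K).
  by rewrite ler_wpM2r // !mulr_ge0 // ltW.
have h4 : K * K <= 8 * C * t * K.
  have := le_trans h1 (le_trans h2 h3).
  have -> : K * K = 4 * (K / 2) ^+ 2 by field.
  by move: ((K / 2) ^+ 2) => X; clear; lra.
have h5 : K <= 8 * C * t by rewrite -(@ler_pM2r _ K).
by move: h5 ND DN3; clear; lra.
Qed.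

End KappaBound.

(** * Second-order jets along lines *)

Section Calculus.
Variables (R : realType) (m : nat).
Local Notation V := 'rV[R]_m.
Implicit Types (A : set V) (u : V -> R) (x v h : V).

Lemma Ck_le k l A u : (l <= k)%N -> Ck k A u -> Ck l A u.
Proof.
move=> lk H s sl; have [H1 H2] := H s (leq_trans sl lk); split=> // sl' i x Ax.
by apply: H2 => //; apply: leq_trans lk.
Qed.

Lemma Ck_partial k A u i : Ck k.+1 A u -> Ck k A (partial i u).
Proof.
move=> H s sk; have E : pderivs s (partial i u) = pderivs (rcons s i) u.
  by rewrite /pderivs foldr_rcons.
by rewrite E; have := H (rcons s i); rewrite size_rcons ltnS => /(_ sk).
Qed.

Lemma Ck_continuous k A u x : Ck k A u -> A x -> {for x, continuous u}.
Proof. by move=> H Ax; have [h _] := H [::] isT; exact: h. Qed.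

Lemma Ck_derivable k A u x i : Ck k.+1 A u -> A x -> derivable u x (delta_mx 0 i).
Proof. by move=> H Ax; have [_ h] := H [::] isT; exact: h. Qed.

Lemma norm_rV_le h (a : R) : 0 <= a -> (forall i, `|h 0 i| <= a) -> `|h| <= a.
Proof.
move=> a0 ha; rewrite -[`|h|]/(mx_norm h) mx_normrE; apply/bigmax_leP; split => // -[i j] _ /=.
by rewrite ord1.
Qed.

Lemma coord_le_norm h i : `|h 0 i| <= `|h|.
Proof.
rewrite -[`|h|]/(mx_norm h) mx_normrE.
by apply/bigmax_geP; right; exists (0, i).
Qed.

Lemma derive_line u x v (t : R) : derivable u (x + t *: v) v ->
  is_derive t 1 (fun s : R => u (x + s *: v)) ('D_v u (x + t *: v)).
Proof.
move=> du.
have E : (fun h : R => h^-1 *: (u (x + (h *: (1 : R) + t) *: v) - u (x + t *: v))) =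
   (fun h : R => h^-1 *: (u (h *: v + (x + t *: v)) - u (x + t *: v))).
  apply/funext => h; congr (_ *: (u _ - _)).
  by rewrite scalerDl addrCA [h *: 1]mulr1.
apply: DeriveDef; first by rewrite /derivable E.
by rewrite /derive E.
Qed.

Lemma mvt_abs (g dg : R -> R) (a : R) :
  (forall s : R, `|s| <= `|a| -> is_derive s 1 g (dg s)) ->
  exists2 s, `|s| <= `|a| & g a - g 0 = dg s * a.
Proof.
move=> dgP; have cont s : `|s| <= `|a| -> {for s, continuous g}.
  by move=> /dgP d; apply: differentiable_continuous; apply/derivable1_diffP; exact: ex_derive.
have [a0|a0] := leP 0 a.
  have [s||s] := @MVT_segment _ g dg _ _ a0.
  - by rewrite in_itv /= => /andP[s0 sa]; apply: dgP; rewrite !ger0_norm // ltW.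
  - apply: continuous_in_subspaceT => s; rewrite inE /= in_itv /= => /andP[s0 sa].
    by apply: cont; rewrite !ger0_norm.
  - rewrite in_itv /= subr0 => /andP[s0 sa] e; exists s => //.
    by rewrite !ger0_norm.
have [s||s] := @MVT_segment _ g dg _ _ (ltW a0).
- by rewrite in_itv /= => /andP[s0 sa]; apply: dgP; rewrite !ler0_norm ?lerN2 // ltW.
- apply: continuous_in_subspaceT => s; rewrite inE /= in_itv /= => /andP[s0 sa].
  by apply: cont; rewrite !ler0_norm ?lerN2 // ltW.
- rewrite in_itv /= sub0r => /andP[s0 sa] e; exists s.
    by rewrite !ler0_norm ?lerN2 // ltW.
  by rewrite -opprB e mulrN opprK.
Qed.

Lemma near_ball A u x (e : R) : open A -> A x -> {for x, continuous u} -> 0 < e ->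
  exists2 r, 0 < r & forall h, `|h| <= r -> A (x + h) /\ `|u (x + h) - u x| <= e.
Proof.
move=> oA Ax cu e0.
have nA : nbhs x A by apply: open_nbhs_nbhs.
have nu : \forall y \near x, `|u x - u y| < e by apply: (@cvgr_dist_lt _ _ _ _ _ u (u x) cu).
have [r /= r0 hr] := (@nbhs_ballP _ _ x _).1 (filterI nA nu).
exists (r / 2); first by rewrite divr_gt0.
move=> h hh; have [] : (A `&` (fun y => `|u x - u y| < e)) (x + h).
  apply: hr; rewrite -ball_normE /= opprD addrA subrr add0r normrN.
  by apply: le_lt_trans hh _; rewrite ltr_pdivrMr // ltr_pMr // ltr1n.
by move=> ? /ltW; rewrite distrC.
Qed.

Lemma near_ball_fin (I : finType) A (u : I -> V -> R) x (e : R) : open A -> A x ->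
  (forall i, {for x, continuous (u i)}) -> 0 < e ->
  exists2 r, 0 < r & forall h, `|h| <= r -> A (x + h) /\ forall i, `|u i (x + h) - u i x| <= e.
Proof.
move=> oA Ax cu e0.
have [rA rA0 hA] := near_ball oA Ax (@cst_continuous _ _ (0 : R) x) e0.
have /choice[r hr] : forall i, exists r, 0 < r /\
    forall h, `|h| <= r -> A (x + h) /\ `|u i (x + h) - u i x| <= e.
  by move=> i; have [r r0 h] := near_ball oA Ax (cu i) e0; exists r.
exists (\big[Num.min/rA]_i r i).
  by apply: lt_bigmin => // i _; have [] := hr i.
move=> h hh; split; first by have [] := hA h (le_trans hh (bigmin_le_id _ _ _ _)).
by move=> i; have [_ /(_ h (le_trans hh (bigmin_le _ _ _)))[]] := hr i.
Qed.

(** The vertices of the staircase path from 0 to [h], one coordinate at a time. *)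
Definition trunc h (k : nat) : V := \row_i (if (i < k)%N then h 0 i else 0).

Lemma truncS h (k : 'I_m) : trunc h k.+1 = trunc h k + h 0 k *: delta_mx 0 k.
Proof.
apply/rowP => i; rewrite !mxE eqxx /= ltnS leq_eqVlt -val_eqE /=.
by have [/val_inj ->|ik] := eqVneq (val i) (val k);
  rewrite ?ltnn ?eqxx ?add0r ?mulr1 ?mulr0 ?addr0.
Qed.

(* Telescoping along the coordinate directions. *)
Lemma C1_taylor A u x (e : R) : open A -> Ck 1 A u -> A x -> 0 < e ->
  exists2 r, 0 < r & forall h, `|h| <= r ->
   `|u (x + h) - u x - \sum_i h 0 i * partial i u x| <= e * `|h|.
Proof.
move=> oA cu Ax e0; pose e' := e / m.+1%:R.
have e'0 : 0 < e' by rewrite divr_gt0 // ltr0n.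
have [|r r0 hr] := @near_ball_fin _ A (fun i => partial i u) x e' oA Ax _ e'0.
  by move=> i; exact: (Ck_continuous (Ck_partial i cu) Ax).
exists r => // h hh.
have -> : u (x + h) - u x = \sum_(i < m) (u (x + trunc h i.+1) - u (x + trunc h i)).
  rewrite -(big_mkord xpredT (fun i => u (x + trunc h i.+1) - u (x + trunc h i))).
  rewrite telescope_sumr //; congr (u _ - u _).
    by congr (_ + _); apply/rowP => i; rewrite !mxE ltn_ord.
  by rewrite (_ : trunc h 0 = 0) ?addr0 //; apply/rowP => i; rewrite !mxE.
rewrite -sumrB; apply: le_trans (ler_norm_sum _ _ _) _.
apply: (@le_trans _ _ (\sum_(i < m) e' * `|h|)); last first.
  rewrite sumr_const card_ord -mulr_natl mulrA ler_wpM2r // /e' mulrCA ler_piMr ?(ltW e0) //.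
  by rewrite ler_pdivrMr ?ltr0n // mul1r ler_nat.
apply: ler_sum => i _.
pose g s := u (x + trunc h i + s *: delta_mx 0 i).
have inb s : `|s| <= `|h 0 i| -> `|trunc h i + s *: delta_mx 0 i| <= `|h|.
  move=> sh; apply: norm_rV_le => // j; rewrite !mxE eqxx /=.
  have [->|ji] := eqVneq j i; first by rewrite ltnn add0r mulr1 (le_trans sh) ?coord_le_norm.
  by rewrite mulr0 addr0; case: ifP => _; rewrite ?normr0 ?coord_le_norm.
have [s sh|s sh] := @mvt_abs g (fun s => partial i u (x + trunc h i + s *: delta_mx 0 i)) (h 0 i).
  apply: derive_line.
  apply: (@Ck_derivable 0 A u _ i cu).
  by rewrite -addrA; have [] := hr _ (le_trans (inb _ sh) hh).
rewrite /g scale0r addr0 -addrA -truncS => ->.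
rewrite mulrC -mulrBr normrM mulrC; apply: ler_pM => //; last exact: coord_le_norm.
by rewrite -addrA; have [_] := hr _ (le_trans (inb _ sh) hh).
Qed.

(** [Ck] speaks of coordinate derivatives only; the derivative along an arbitrary vector comes from
    the expansion [C1_taylor]. *)
Lemma C1_derive_line A u x v (t : R) : open A -> Ck 1 A u -> A (x + t *: v) ->
  is_derive t 1 (fun s : R => u (x + s *: v)) (\sum_i v 0 i * partial i u (x + t *: v)).
Proof.
move=> oA cu Ax; set L := \sum_i _.
have cv : (fun h : R => h^-1 *: (u (x + (h *: (1 : R) + t) *: v) - u (x + t *: v))) @ 0^' --> L.
  apply/cvgrPdist_le => e e0.
  have e'0 : 0 < e / (`|v| + 1) by rewrite divr_gt0 // ltr_wpDl.
  have [r r0 hr] := C1_taylor oA cu Ax e'0.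
  have r'0 : 0 < r / (`|v| + 1) by rewrite divr_gt0 // ltr_wpDl.
  apply/nbhs_ballP; exists (r / (`|v| + 1)) => //= h /=.
  rewrite -ball_normE /= sub0r normrN => hh h0.
  have v1 : `|v| <= `|v| + 1 by rewrite lerDl.
  have v10 : 0 < `|v| + 1 by rewrite ltr_wpDl.
  have hv : `|h *: v| <= r.
    rewrite normrZ; apply: le_trans (_ : `|h| * (`|v| + 1) <= _); first by rewrite ler_wpM2l.
    by rewrite -ler_pdivlMr // ltW.
  have := hr _ hv; rewrite normrZ => H.
  have hn : 0 < `|h| by rewrite normr_gt0.
  rewrite -(ler_pM2l hn) -normrM mulrBr.
  have -> : h * (h^-1 *: (u (x + (h *: (1 : R) + t) *: v) - u (x + t *: v))) =
      u (x + t *: v + h *: v) - u (x + t *: v).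
    by rewrite mulrA divff // mul1r [h *: 1]mulr1 scalerDl addrA addrAC.
  have -> : h * L = \sum_i (h *: v) 0 i * partial i u (x + t *: v).
    by rewrite mulr_sumr; apply: eq_bigr => i _; rewrite mxE mulrA.
  rewrite distrC; apply: le_trans H _.
  rewrite mulrCA ler_wpM2l // mulrAC ler_pdivrMr // ler_wpM2l // ltW //.
have cL := cvg_lim (@Rhausdorff R) cv.
apply: DeriveDef; last by rewrite /derive cL.
by apply/cvg_ex; exists L.
Qed.

End Calculus.

(** * Second-order Taylor expansion and symmetry of second derivatives *)

Section Taylor.
Variables (R : realType).

Lemma taylor1D (F dF ddF : R -> R) (q e : R) :
  (forall s : R, `|s| <= 1 -> is_derive s 1 F (dF s)) ->
  (forall s : R, `|s| <= 1 -> is_derive s 1 dF (ddF s)) ->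
  (forall s, `|s| <= 1 -> `|ddF s - q| <= e) ->
  `|F 1 - F 0 - dF 0 - q / 2| <= e.
Proof.
move=> hF hdF hq.
pose G := F - (dF 0 *: (id : R -> R)) - ((q / 2) *: (fun s : R => s ^+ 2)).
pose dG := dF - cst (dF 0) - (q *: (id : R -> R)).
have GP (s : R) : `|s| <= `|1 : R| -> is_derive s 1 G (dG s).
  rewrite normr1 => /hF h; apply: is_derive_eq.
  by rewrite /dG !fctE /GRing.scale /=; field.
have [s] := mvt_abs GP; rewrite normr1 => s1.
have dGP (r : R) : `|r| <= `|s| -> is_derive r 1 dG (ddF r - q).
  move=> rs; have h := hdF r (le_trans rs s1); apply: is_derive_eq.
  by rewrite /GRing.scale /=; ring.
have [r rs] := mvt_abs dGP.
rewrite /G /dG !fctE /GRing.scale /= => e1 e2.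
have -> : F 1 - F 0 - dF 0 - q / 2 = (ddF r - q) * s by lra.
rewrite normrM -[leRHS]mulr1; apply: ler_pM => //; apply: hq.
exact: le_trans s1.
Qed.

Variable m : nat.
Local Notation V := 'rV[R]_m.
Implicit Types (A : set V) (u : V -> R) (x v h : V).

Definition sqn h : R := \sum_i h 0 i ^+ 2.

Lemma sqn_ge0 h : 0 <= sqn h.
Proof. by apply: sumr_ge0 => i _; exact: sqr_ge0. Qed.

Lemma coord_sqn h i : `|h 0 i| ^+ 2 <= sqn h.
Proof.
rewrite real_normK ?num_real // /sqn (bigD1 i) //= lerDl.
by apply: sumr_ge0 => j _; exact: sqr_ge0.
Qed.

Lemma norm_sqn h r : 0 <= r -> sqn h <= r ^+ 2 -> `|h| <= r.
Proof.
move=> r0 hr; apply: norm_rV_le => // i.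
by rewrite -ler_sqr ?nnegrE // (le_trans (coord_sqn h i)).
Qed.

(** The remainder is measured by [sqn h], a polynomial, which can itself be expanded along a curve
    in [jet2_comp]. *)
Lemma C2_taylor A u x (e : R) : open A -> Ck 2 A u -> A x -> 0 < e ->
  exists2 r, 0 < r & forall h, sqn h < r ->
   `|u (x + h) - u x - \sum_i h 0 i * partial i u x
      - (\sum_i \sum_j h 0 i * h 0 j * partial i (partial j u) x) / 2| <= e * sqn h.
Proof.
move=> oA cu Ax e0.
have c1 : Ck 1 A u := Ck_le (isT : (1 <= 2)%N) cu.
pose e' := e / (m.+1%:R ^+ 2).
have M0 : 0 < m.+1%:R ^+ 2 :> R by rewrite exprn_gt0 // ltr0n.
have e'0 : 0 < e' by rewrite divr_gt0.
have [|r r0 hr] := @near_ball_fin _ _ _ A (fun ij => partial ij.1 (partial ij.2 u)) x e' oA Ax _ e'0.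
  by move=> [i j]; exact: (Ck_continuous (Ck_partial i (Ck_partial j cu)) Ax).
exists (r ^+ 2); first by rewrite exprn_gt0.
move=> h /ltW hh; have {}hh := norm_sqn (ltW r0) hh.
have inb (s : R) : `|s| <= 1 -> `|s *: h| <= r.
  by move=> s1; rewrite normrZ (le_trans _ hh) // ler_piMl.
have Ash (s : R) : `|s| <= 1 -> A (x + s *: h) by move=> /inb /hr[].
pose F s := u (x + s *: h).
pose dF s := \sum_i h 0 i * partial i u (x + s *: h).
pose ddF s := \sum_i h 0 i * \sum_j h 0 j * partial j (partial i u) (x + s *: h).
have := @taylor1D F dF ddF (\sum_i \sum_j h 0 i * h 0 j * partial i (partial j u) x) (e * sqn h).
rewrite /F /dF scale0r addr0 scale1r; apply.
- by move=> s /Ash As; exact: C1_derive_line oA c1 As.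
- move=> s /Ash As.
  have -> : (fun s => \sum_i h 0 i * partial i u (x + s *: h)) =
     \sum_i (h 0 i *: (fun s => partial i u (x + s *: h))).
    by apply/funext => t; rewrite fct_sumE.
  apply: is_derive_sum => i; apply: is_deriveZ.
  exact: C1_derive_line oA (Ck_partial i cu) As.
- move=> s /inb /hr[_ hs].
  rewrite /ddF exchange_big -sumrB; apply: le_trans (ler_norm_sum _ _ _) _.
  apply: (@le_trans _ _ (\sum_(i < m) \sum_(j < m) e' * sqn h)); last first.
    rewrite !sumr_const card_ord -mulrnA -mulr_natl mulrA ler_wpM2r ?sqn_ge0 //.
    rewrite /e' mulrCA ler_piMr ?(ltW e0) // ler_pdivrMr // mul1r -natrX ler_nat.
    by rewrite -mulnn leq_mul.
  apply: ler_sum => i _; rewrite mulr_sumr -sumrB; apply: le_trans (ler_norm_sum _ _ _) _.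
  apply: ler_sum => j _; rewrite mulrA (mulrC (h 0 j)) -mulrBr normrM mulrC.
  apply: ler_pM => //; first exact: (hs (j, i)).
  rewrite normrM; apply: (@le_trans _ _ ((`|h 0 i| ^+ 2 + `|h 0 j| ^+ 2) / 2)).
    by have := sqr_ge0 (`|h 0 i| - `|h 0 j|); lra.
  by have := coord_sqn h i; have := coord_sqn h j; lra.
Qed.

Lemma schwarz A u x i j : open A -> Ck 2 A u -> A x ->
  partial i (partial j u) x = partial j (partial i u) x.
Proof.
move=> oA cu Ax; have c1 : Ck 1 A u := Ck_le (isT : (1 <= 2)%N) cu.
apply/eqP; rewrite -subr_eq0 -normr_le0; apply/ler_addgt0Pl => e e0; rewrite addr0.
have e2 : 0 < e / 2 by rewrite divr_gt0.
have [|r r0 hr] := @near_ball_fin _ _ _ A (fun ij => partial ij.1 (partial ij.2 u)) x (e / 2) oA Ax _ e2.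
  by move=> [a b]; exact: (Ck_continuous (Ck_partial a (Ck_partial b cu)) Ax).
pose d := r / 2; have d0 : 0 < d by rewrite divr_gt0.
have dir (a b : 'I_m) (s t : R) : `|s| <= d -> `|t| <= d ->
    `|s *: delta_mx 0 a + t *: delta_mx 0 b : V| <= r.
  have dn (c : 'I_m) : `|delta_mx 0 c : V| <= 1.
    by apply: norm_rV_le => // l; rewrite mxE; case: (_ && _); rewrite ?normr1 ?normr0.
  move=> sd td; apply: le_trans (ler_normD _ _) _; rewrite !normrZ.
  rewrite (_ : r = d * 1 + d * 1); last by rewrite /d; field.
  by rewrite lerD // ler_pM.
(* both mixed derivatives are close to the same second difference quotient *)
have step a b : exists2 P, `|P - partial b (partial a u) x| <= e / 2 &
    u (x + d *: delta_mx 0 a + d *: delta_mx 0 b) - u (x + d *: delta_mx 0 a)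
    - u (x + d *: delta_mx 0 b) + u x = P * d * d.
  pose g s := u (x + d *: delta_mx 0 b + s *: delta_mx 0 a) - u (x + s *: delta_mx 0 a).
  have [s|s sd] := @mvt_abs _ g (fun s => partial a u (x + d *: delta_mx 0 b + s *: delta_mx 0 a)
     - partial a u (x + s *: delta_mx 0 a)) d.
    move=> sd; rewrite (gtr0_norm d0) in sd.
    apply: is_deriveB; apply: derive_line; apply: (@Ck_derivable _ _ 0 A u _ a c1).
      by rewrite -addrA; have [] := hr _ (dir b a d s _ sd); rewrite ?(gtr0_norm d0).
    by have := dir a b s 0; rewrite scale0r addr0 normr0 => /(_ sd (ltW d0)) /hr[].
  rewrite (gtr0_norm d0) in sd; rewrite /g scale0r !addr0.
  pose k t := partial a u (x + s *: delta_mx 0 a + t *: delta_mx 0 b).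
  have [t|t td] := @mvt_abs _ k (fun t => partial b (partial a u)
      (x + s *: delta_mx 0 a + t *: delta_mx 0 b)) d.
    move=> td; rewrite (gtr0_norm d0) in td.
    apply: derive_line; apply: (@Ck_derivable _ _ 0 A (partial a u) _ b (Ck_partial a cu)).
    by rewrite -addrA; have [] := hr _ (dir a b s t sd td).
  rewrite (gtr0_norm d0) in td; rewrite /k scale0r addr0.
  move=> et es; exists (partial b (partial a u) (x + (s *: delta_mx 0 a + t *: delta_mx 0 b))).
    by have [_ h] := hr _ (dir a b s t sd td); exact: (h (b, a)).
  rewrite addrA -et (addrAC x (s *: _) (d *: _)) -es (addrAC x (d *: delta_mx 0 a)).
  by ring.
have [P1 h1 e1] := step i j; have [P2 h2 e2'] := step j i.
move: (partial j (partial i u) x) (partial i (partial j u) x) h1 h2 => p1 p2 h1 h2.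
have E : P1 = P2.
  apply: (mulIf (lt0r_neq0 d0)); apply: (mulIf (lt0r_neq0 d0)); rewrite -e1 -e2'.
  by rewrite (addrAC x (d *: delta_mx 0 i)); ring.
by move: h1 h2; rewrite E !ler_norml; clear; lra.
Qed.

End Taylor.

(** * Calculus of second-order jets *)

Section Jets2.
Variables (R : realType).
Implicit Types (g : R -> R) (c b q : R).

Lemma continuous0_near (w : R -> R) e : {for 0, continuous w} -> 0 < e ->
  exists2 d, 0 < d & forall t, `|t| < d -> `|w t - w 0| < e.
Proof.
move=> kw e0; have n : \forall t \near (0 : R), `|w 0 - w t| < e.
  by apply: (@cvgr_dist_lt _ _ _ _ _ w (w 0) kw).
have [d /= d0 hd] := (@nbhs_ballP _ _ (0 : R) _).1 n.
exists d => // t td; rewrite distrC; apply: hd.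
by rewrite -ball_normE /= sub0r normrN.
Qed.

(* g t = c + b t + q t^2 / 2 + o(t^2) as t -> 0, with a remainder w t * t^2 *)
Definition jet2 g c b q := exists w : R -> R, [/\ {for 0, continuous w}, w 0 = 0 &
  forall t, g t = c + b * t + (q / 2 + w t) * t ^+ 2].

Lemma jet2_eq g g' c b q c' b' q' : jet2 g c b q -> g =1 g' -> c = c' -> b = b' -> q = q' ->
  jet2 g' c' b' q'.
Proof. by move=> h /funext <- <- <- <-. Qed.

Lemma jet2_affine c b : jet2 (fun t => c + b * t) c b 0.
Proof.
exists (cst 0); split=> //; first exact: cst_continuous.
by move=> t; rewrite /cst mul0r addr0 mul0r addr0.
Qed.

Lemma jet2_cst c : jet2 (fun=> c) c 0 0.
Proof. by apply: (jet2_eq (jet2_affine c 0)) => // t; rewrite mul0r addr0. Qed.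

Lemma jet2D g1 g2 c1 b1 q1 c2 b2 q2 : jet2 g1 c1 b1 q1 -> jet2 g2 c2 b2 q2 ->
  jet2 (fun t => g1 t + g2 t) (c1 + c2) (b1 + b2) (q1 + q2).
Proof.
move=> [w1 [k1 z1 e1]] [w2 [k2 z2 e2]]; exists (fun t => w1 t + w2 t); split.
- exact: continuousD.
- by rewrite z1 z2 addr0.
- by move=> t; rewrite e1 e2; field.
Qed.

Lemma jet2M g1 g2 c1 b1 q1 c2 b2 q2 : jet2 g1 c1 b1 q1 -> jet2 g2 c2 b2 q2 ->
  jet2 (fun t => g1 t * g2 t) (c1 * c2) (b1 * c2 + c1 * b2)
    (q1 * c2 + 2 * (b1 * b2) + c1 * q2).
Proof.
move=> [w1 [k1 z1 e1]] [w2 [k2 z2 e2]].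
have kc (a : R) : {for 0, continuous (fun _ : R => a)} by exact: cst_continuous.
have kt : {for (0 : R), continuous (fun t : R => t)} by exact: cvg_id.
have kp1 : {for 0, continuous (fun t => q1 / 2 + w1 t)} by apply: continuousD.
have kp2 : {for 0, continuous (fun t => q2 / 2 + w2 t)} by apply: continuousD.
exists (fun t => c1 * w2 t + c2 * w1 t +
   (t * (b1 * (q2 / 2 + w2 t) + b2 * (q1 / 2 + w1 t)) +
    t * t * ((q1 / 2 + w1 t) * (q2 / 2 + w2 t)))); split.
- apply: continuousD; first by apply: continuousD; apply: continuousM.
  apply: continuousD; last by apply: continuousM; apply: continuousM.
  by apply: continuousM => //; apply: continuousD; apply: continuousM.
- by rewrite z1 z2; ring.
- by move=> t; rewrite e1 e2; field.
Qed.

Lemma jet2Z a g c b q : jet2 g c b q -> jet2 (fun t => a * g t) (a * c) (a * b) (a * q).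
Proof.
by move=> h; apply: (jet2_eq (jet2M (jet2_cst a) h)) => //; ring.
Qed.

Lemma jet2_sum (I : Type) (r : seq I) (g : I -> R -> R) (c b q : I -> R) :
  (forall i, jet2 (g i) (c i) (b i) (q i)) ->
  jet2 (fun t => \sum_(i <- r) g i t) (\sum_(i <- r) c i) (\sum_(i <- r) b i)
    (\sum_(i <- r) q i).
Proof.
move=> h; elim: r => [|i r IH].
  by rewrite !big_nil; apply: (jet2_eq (jet2_cst 0)) => // t; rewrite big_nil.
rewrite !big_cons; apply: (jet2_eq (jet2D (h i) IH)) => // t.
by rewrite big_cons.
Qed.

Lemma jet2_perturb g g' c b q : jet2 g c b q ->
  (forall e, 0 < e -> exists2 r, 0 < r & forall t, `|t| < r -> `|g' t - g t| <= e * t ^+ 2) ->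
  jet2 g' c b q.
Proof.
move=> [w [kw zw ew]] h.
have h0 : g' 0 = g 0.
  have [r r0 /(_ 0)] := h 1 ltr01; rewrite normr0 expr0n mulr0 => /(_ r0).
  by rewrite normr_le0 subr_eq0 => /eqP.
exists (fun t => w t + (g' t - g t) / t ^+ 2); split.
- apply: continuousD => //; apply/cvgrPdist_le => e e0 /=.
  rewrite h0 subrr mul0r; have [r r0 hr] := h e e0.
  apply/nbhs_ballP; exists r => //= t. rewrite /= sub0r normrN => tr.
  rewrite sub0r normrN; have [->|t0] := eqVneq t 0.
    by rewrite h0 subrr mul0r normr0 ltW.
  have t2 : 0 < t ^+ 2 by rewrite exprn_even_gt0.
  by rewrite normrM normfV (gtr0_norm t2) ler_pdivrMr // hr.
- by rewrite zw h0 subrr mul0r addr0.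
- move=> t; have [->|t0] := eqVneq t 0; first by rewrite h0 ew expr0n /= !mulr0.
  have -> : g' t = g t + (g' t - g t) by rewrite addrC subrK.
  by rewrite ew; field.
Qed.

Lemma jet2_max g c b q (r : R) : 0 < r -> jet2 g c b q ->
  (forall t, `|t| < r -> g t <= c) -> b = 0 /\ q <= 0.
Proof.
move=> r0 [w [kw zw ew]] gmax.
have kc (a : R) : {for 0, continuous (fun _ : R => a)} by exact: cst_continuous.
have kt : {for (0 : R), continuous (fun t : R => t)} by exact: cvg_id.
pose k t := b + (q / 2 + w t) * t.
have kk : {for 0, continuous k}.
  by apply: continuousD => //; apply: continuousM => //; apply: continuousD.
have k0 : k 0 = b by rewrite /k mulr0 addr0.
have gk t : `|t| < r -> t * k t <= 0.
  move=> /gmax; rewrite ew /k; have -> : t * (b + (q / 2 + w t) * t) =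
    c + b * t + (q / 2 + w t) * t ^+ 2 - c by ring.
  by rewrite subr_le0.
have b0 : b = 0.
  apply/eqP/negP => /negP bn; have nb : 0 < `|b| by rewrite normr_gt0.
  have [d d0 hd] := continuous0_near kk nb.
  pose t := Num.sg b * (Num.min d r / 2).
  have m0 : 0 < Num.min d r by rewrite lt_min d0.
  have ta : `|t| < Num.min d r.
    rewrite normrM normr_sg bn mul1r gtr0_norm ?divr_gt0 //; lra.
  move: ta; rewrite lt_min => /andP[td tr].
  have := hd t td; rewrite k0 => hk.
  have := gk t tr; move: (k t) hk => z hk; rewrite /t -mulrA mulrCA pmulr_rle0 ?divr_gt0 //.
  move: bn hk; clear; rewrite neq_lt => /orP[bl|bg].
    by rewrite ltr0_sg // mulN1r oppr_le0 (ltr0_norm bl) ltr_norml; lra.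
  by rewrite gtr0_sg // mul1r (gtr0_norm bg) ltr_norml; lra.
split=> //; rewrite leNgt; apply/negP => q0.
have q2 : 0 < q / 2 by rewrite divr_gt0.
have [d d0 hd] := continuous0_near kw q2.
pose t := (Num.min d r / 2).
have m0 : 0 < Num.min d r by rewrite lt_min d0.
have t0 : 0 < t by rewrite divr_gt0.
have ta : `|t| < Num.min d r by rewrite gtr0_norm // /t; lra.
move: ta; rewrite lt_min => /andP[td tr].
have := hd t td; rewrite zw subr0.
rewrite ltr_norml => /andP[wl _].
have := gk t tr; rewrite /k b0 add0r mulrCA -expr2 pmulr_lle0 ?exprn_gt0 //; lra.
Qed.

Lemma jet2_near g c b q (e : R) : jet2 g c b q -> 0 < e ->
  exists2 r, 0 < r & forall t, `|t| < r -> `|g t - c - b * t| <= (`|q| / 2 + e) * t ^+ 2.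
Proof.
move=> [w [kw zw ew]] e0.
have [d d0 hd] := continuous0_near kw e0.
exists d => // t td; have := hd t td; rewrite zw subr0 => /ltW wt.
have -> : g t - c - b * t = (q / 2 + w t) * t ^+ 2 by rewrite ew; ring.
rewrite normrM (ger0_norm (sqr_ge0 t)) ler_wpM2r ?sqr_ge0 //.
apply: le_trans (ler_normD _ _) _; by rewrite lerD // normrM (@ger0_norm _ 2^-1) ?invr_ge0.
Qed.

Variable m : nat.
Implicit Types (A : set 'rV[R]_m) (u : 'rV[R]_m -> R).

(** Substituting the jets of the coordinates into the Taylor polynomial gives the coefficients; the
    Taylor remainder is small against [sqn] of the increment, which is O(t^2), so [jet2_perturb]
    absorbs it. *)
Lemma jet2_comp A u y (gam : R -> 'rV[R]_m) (B C : 'I_m -> R) :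
  open A -> Ck 2 A u -> A y ->
  (forall j, jet2 (fun t => gam t 0 j) (y 0 j) (B j) (C j)) ->
  jet2 (u \o gam) (u y) (\sum_j B j * partial j u y)
    (\sum_j C j * partial j u y + \sum_i \sum_j B i * B j * partial i (partial j u) y).
Proof.
move=> oA cu Ay jg; pose h t := gam t - y.
have jh j : jet2 (fun t => h t 0 j) 0 (B j) (C j).
  apply: (jet2_eq (jet2D (jg j) (jet2_cst (- y 0 j)))); rewrite ?subrr ?addr0 //.
  by move=> t; rewrite !mxE.
have jT : jet2 (fun t => u y + (\sum_j h t 0 j * partial j u y +
    2^-1 * \sum_i \sum_j h t 0 i * h t 0 j * partial i (partial j u) y))
    (u y) (\sum_j B j * partial j u y)
    (\sum_j C j * partial j u y + \sum_i \sum_j B i * B j * partial i (partial j u) y).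
  have j1 : jet2 (fun t => \sum_j h t 0 j * partial j u y) 0
      (\sum_j B j * partial j u y) (\sum_j C j * partial j u y).
    apply: (jet2_eq (jet2_sum _ (fun j => jet2M (jh j) (jet2_cst (partial j u y))))) => //.
    - by rewrite big1 // => j _; rewrite mul0r.
    - by apply: eq_bigr => j _; ring.
    - by apply: eq_bigr => j _; ring.
  have j2 : jet2 (fun t => 2^-1 * \sum_i \sum_j h t 0 i * h t 0 j * partial i (partial j u) y)
      0 0 (\sum_i \sum_j B i * B j * partial i (partial j u) y).
    apply: (jet2_eq (jet2Z 2^-1 (jet2_sum _ (fun i => jet2_sum _ (fun j =>
      jet2M (jet2M (jh i) (jh j)) (jet2_cst (partial i (partial j u) y))))))) => //.
    - by rewrite big1 ?mulr0 // => i _; rewrite big1 // => j _; ring.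
    - by rewrite big1 ?mulr0 // => i _; rewrite big1 // => j _; ring.
    - rewrite mulr_sumr; apply: eq_bigr => i _; rewrite mulr_sumr; apply: eq_bigr => j _.
      by field.
  by apply: (jet2_eq (jet2D (jet2_cst (u y)) (jet2D j1 j2))); rewrite ?add0r ?addr0.
apply: (jet2_perturb jT) => e e0.
have jS : jet2 (fun t => sqn (h t)) 0 0 (\sum_j 2 * B j ^+ 2).
  apply: (jet2_eq (jet2_sum _ (fun j => jet2M (jh j) (jh j)))) => //.
  - by rewrite big1 // => j _; rewrite mul0r.
  - by rewrite big1 // => j _; ring.
  - by apply: eq_bigr => j _; ring.
pose L := `|\sum_j 2 * B j ^+ 2| / 2 + 1.
have L0 : 0 < L by rewrite ltr_wpDl // divr_ge0.
have eL : 0 < e / L by rewrite divr_gt0.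
have [r r0 hr] := C2_taylor oA cu Ay eL.
have [d d0 hd] := jet2_near jS ltr01.
have hS t : `|t| < d -> sqn (h t) <= L * t ^+ 2.
  by move=> /hd; rewrite mul0r !subr0 => /(le_trans (ler_norm _)).
exists (Num.min d (Num.min 1 (r / L))).
  by rewrite !lt_min d0 ltr01 divr_gt0.
move=> t; rewrite !lt_min => /andP[td /andP[t1 tr]].
have hs : sqn (h t) < r.
  apply: le_lt_trans (hS t td) _; rewrite mulrC -ltr_pdivlMr //.
  by apply: le_lt_trans tr; rewrite -[_ ^+ 2]ger0_norm ?sqr_ge0 // normrX expr2 ler_piMr // ltW.
have := hr _ hs; have -> : y + h t = gam t by rewrite /h addrC subrK.
move=> H; apply: le_trans (_ : _ <= e / L * sqn (h t)) _; last first.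
  by rewrite -mulrA ler_wpM2l ?(ltW e0) // mulrC ler_pdivrMr // mulrC hS.
apply: le_trans H; rewrite /=; set S2 := \sum_(i < m) \sum_(j < m) _.
move: (\sum_i h t 0 i * partial i u y) S2 (u (gam t)) (u y) => S1 S2 a b.
by rewrite (_ : a - (b + (S1 + 2^-1 * S2)) = a - b - S1 - S2 / 2) //; field.
Qed.

End Jets2.

(* Unfolding partial makes unification diverge. *)
#[local] Opaque partial.

(** * Expansions of the Hessian, the gradient and f along frame vectors *)

Section LocalJets.
Variables (R : realType) (n : nat).
Local Notation V := 'rV[R]_n.
Implicit Types (O : 'M[R]_n) (u phi : V -> R) (Omega : set V).

Lemma sum_orth O (a b : 'I_n -> R) : orth O ->
  \sum_l (\sum_j O l j * a j) * (\sum_j O l j * b j) = \sum_j a j * b j.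
Proof.
move=> /orth_tr oO.
under eq_bigr do rewrite mulr_suml; rewrite exchange_big /=; apply: eq_bigr => i _.
under eq_bigr do rewrite mulr_sumr; rewrite exchange_big /=.
transitivity (\sum_j a i * b j * (O^T *m O) i j).
  apply: eq_bigr => j _; rewrite mxE mulr_sumr; apply: eq_bigr => l _.
  by rewrite !mxE; ring.
rewrite oO (bigD1 i) //= big1 => [|j ji]; last by rewrite mxE eq_sym (negPf ji) mulr0.
by rewrite mxE eqxx mulr1 addr0.
Qed.

Lemma partial_congr Omega u u' i x : open Omega -> Omega x ->
  (forall y, Omega y -> u y = u' y) -> partial i u x = partial i u' x.
Proof.
move=> oO Ox e; apply: near_eq_derive.
have : nbhs x Omega by apply: open_nbhs_nbhs.
by apply: filterS => y /e.
Qed.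

(** The symmetry of two derivatives holds on an open set and may therefore be differentiated, by
    [partial_congr]. *)
Lemma partial3_sym Omega phi x i j k : open Omega -> Ck 3 Omega phi -> Omega x ->
  partial i (partial j (partial k phi)) x = partial k (partial i (partial j phi)) x.
Proof.
move=> oO c3 Ox; apply: (@etrans _ _ (partial i (partial k (partial j phi)) x)).
  by apply: (partial_congr i oO Ox) => y Oy; exact: (schwarz j k oO (Ck_le _ c3) Oy).
exact: (schwarz i k oO (Ck_partial j c3) Ox).
Qed.

Lemma partial4_sym Omega phi x i j k l : open Omega -> Ck 4 Omega phi -> Omega x ->
  partial i (partial j (partial k (partial l phi))) x =
  partial k (partial l (partial i (partial j phi))) x.
Proof.
move=> oO c4 Ox; have c3 := Ck_le (isT : (3 <= 4)%N) c4.
apply: (@etrans _ _ (partial i (partial k (partial j (partial l phi))) x)).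
  apply: (partial_congr i oO Ox) => y Oy.
  exact: (schwarz j k oO (Ck_le (isT : (2 <= 3)%N) (Ck_partial l c4)) Oy).
apply: (@etrans _ _ (partial k (partial i (partial j (partial l phi))) x)).
  exact: (schwarz i k oO (Ck_partial j (Ck_partial l c4)) Ox).
apply: (partial_congr k oO Ox) => y Oy.
exact: (partial3_sym i j l oO c3 Oy).
Qed.

Lemma sum4_swap (X : 'I_n -> 'I_n -> 'I_n -> 'I_n -> R) :
  \sum_i \sum_j \sum_k \sum_l X i j k l = \sum_k \sum_l \sum_i \sum_j X i j k l.
Proof.
rewrite (eq_bigr (fun i => \sum_k \sum_j \sum_l X i j k l)) => [|i _]; last exact: exchange_big.
rewrite exchange_big; apply: eq_bigr => k _ /=.
rewrite (eq_bigr (fun i => \sum_l \sum_j X i j k l)) => [|i _]; last exact: exchange_big.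
exact: exchange_big.
Qed.

Variables (Omega : set V) (phi : V -> R) (O : 'M[R]_n) (x0 : V).
Hypotheses (oOm : open Omega) (c4 : Ck 4 Omega phi) (Ox0 : Omega x0) (oO : orth O).

Definition d3 (l a : 'I_n) : R :=
  \sum_k O l k * \sum_i \sum_j O a i * O a j * partial k (partial i (partial j phi)) x0.
Definition d4 (a b : 'I_n) : R :=
  \sum_i \sum_j \sum_k \sum_l O a i * O a j * (O b k * O b l) *
     partial i (partial j (partial k (partial l phi))) x0.

Lemma jet2_line u a : Ck 2 Omega u ->
  jet2 (fun t => u (x0 + t *: row a O)) (u x0) (\sum_i O a i * partial i u x0)
   (\sum_i \sum_j O a i * O a j * partial i (partial j u) x0).
Proof.
move=> cu; have j j0 : jet2 (fun t => (x0 + t *: row a O) 0 j0) (x0 0 j0) (O a j0) 0.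
  by apply: (jet2_eq (jet2_affine _ _)) => // t; rewrite !mxE mulrC.
apply: (jet2_eq (jet2_comp oOm cu Ox0 j)) => //.
by rewrite [X in X + _]big1 ?add0r // => i _; rewrite mul0r.
Qed.

Lemma jet2_hess a b :
  jet2 (fun t => bf (hess phi (x0 + t *: row a O)) (row b O) (row b O))
    (bf (hess phi x0) (row b O) (row b O)) (d3 a b) (d4 a b).
Proof.
have c2 i j : Ck 2 Omega (partial i (partial j phi)) := Ck_partial i (Ck_partial j c4).
have J := jet2_sum (index_enum 'I_n) (fun i => jet2_sum (index_enum 'I_n) (fun j =>
  jet2Z (O b i * O b j) (jet2_line a (c2 i j)))).
apply: (jet2_eq J).
- by move=> t; rewrite bfE; apply: eq_bigr => i _; apply: eq_bigr => j _; rewrite !mxE mulrAC.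
- by rewrite bfE; apply: eq_bigr => i _; apply: eq_bigr => j _; rewrite !mxE mulrAC.
- rewrite /d3; under [RHS]eq_bigr do rewrite mulr_sumr.
  rewrite [RHS]exchange_big; apply: eq_bigr => i _ /=.
  under [RHS]eq_bigr do rewrite mulr_sumr.
  rewrite [RHS]exchange_big; apply: eq_bigr => j _ /=.
  by rewrite mulr_sumr; apply: eq_bigr => k _; rewrite mulrCA.
- rewrite /d4.
  transitivity (\sum_i \sum_j \sum_k \sum_l O a k * O a l * (O b i * O b j) *
     partial k (partial l (partial i (partial j phi))) x0).
    apply: eq_bigr => i _; apply: eq_bigr => j _; rewrite mulr_sumr; apply: eq_bigr => k _.
    by rewrite mulr_sumr; apply: eq_bigr => l _; rewrite mulrCA mulrA.
  exact: sum4_swap.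
Qed.

(** Exchanges the direction of the line with that of the quadratic form; this cancels the fourth
    derivatives at the maximum. *)
Lemma d4C a b : d4 a b = d4 b a.
Proof.
rewrite /d4.
rewrite sum4_swap; apply: eq_bigr => i _; apply: eq_bigr => j _.
apply: eq_bigr => k _; apply: eq_bigr => l _.
exact: (f_equal2 *%R (mulrC _ _) (partial4_sym _ _ _ _ oOm c4 Ox0)).
Qed.
End LocalJets.

Section Enorm.
Variable R : realType.

Lemma enorm_ge0 m n (M : 'M[R]_(m, n)) : 0 <= enorm M.
Proof. exact: sqrtr_ge0. Qed.

Lemma enorm_sqr m n (M : 'M[R]_(m, n)) : enorm M ^+ 2 = \sum_i \sum_j M i j ^+ 2.
Proof.
by rewrite sqr_sqrtr //; apply: sumr_ge0 => i _; apply: sumr_ge0 => j _; exact: sqr_ge0.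
Qed.

Lemma enorm_row_sqr n (M : 'rV[R]_n) : enorm M ^+ 2 = \sum_j M 0 j ^+ 2.
Proof. by rewrite enorm_sqr big_ord1. Qed.

Lemma enorm_coord m n (M : 'M[R]_(m, n)) i j : `|M i j| <= enorm M.
Proof.
rewrite -ler_sqr ?nnegrE ?enorm_ge0 // enorm_sqr real_normK ?num_real //.
rewrite (bigD1 i) //= (bigD1 j) //= -addrA lerDl addr_ge0 //.
  by apply: sumr_ge0 => l _; exact: sqr_ge0.
by apply: sumr_ge0 => k _; apply: sumr_ge0 => l _; exact: sqr_ge0.
Qed.

Lemma quad_form_le n (M : 'M[R]_n) (B : 'I_n -> R) :
  `|\sum_i \sum_j B i * B j * M i j| <= n%:R * enorm M * \sum_i B i ^+ 2.
Proof.
apply: le_trans (ler_norm_sum _ _ _) _.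
apply: (@le_trans _ _ (\sum_i \sum_j ((B i ^+ 2 + B j ^+ 2) / 2) * enorm M)).
  apply: ler_sum => i _; apply: le_trans (ler_norm_sum _ _ _) _; apply: ler_sum => j _.
  rewrite normrM ler_pM ?enorm_coord // normrM.
  rewrite -(real_normK (num_real (B i))) -(real_normK (num_real (B j))).
  by have := sqr_ge0 (`|B i| - `|B j|); lra.
under eq_bigr do rewrite -mulr_suml -mulr_suml big_split /= sumr_const card_ord.
rewrite -!mulr_suml big_split /= sumrMnl sumr_const card_ord -mulr_natl.
set s := \sum_i _; rewrite le_eqVlt; apply/orP; left; apply/eqP.
by rewrite -[s *+ n]mulr_natl; field.
Qed.
End Enorm.

Section LocalJets2.
Variables (R : realType) (n : nat).
Local Notation V := 'rV[R]_n.
Variables (Omega : set V) (phi : V -> R) (O : 'M[R]_n) (x0 : V).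
Hypotheses (oOm : open Omega) (c4 : Ck 4 Omega phi) (Ox0 : Omega x0) (oO : orth O).
Let H := hess phi x0.
Hypothesis off : forall a b, a != b -> bf H (row a O) (row b O) = 0.
Let kap a := bf H (row a O) (row a O).
Let p a := \sum_j O a j * partial j phi x0.
Let y a := \sum_j O a j * x0 0 j.
Local Notation T3 := (d3 phi O x0).

Lemma hess_sym : H^T = H.
Proof.
apply/matrixP => i j; rewrite !mxE.
exact: (schwarz j i oOm (Ck_le (isT : (2 <= 4)%N) c4) Ox0).
Qed.

Lemma row_hess a j : \sum_i O a i * H i j = kap a * O a j.
Proof.
transitivity ((O *m H *m O^T *m O) a j).
  by rewrite -mulmxA orth_tr // mulmx1 mxE.
rewrite mxE (bigD1 a) //= big1 => [|b ba]; last by rewrite conj_bf off ?mul0r // eq_sym.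
by rewrite conj_bf addr0.
Qed.

Definition d2row (a j : 'I_n) : R :=
  \sum_i \sum_l O a i * O a l * partial i (partial l (partial j phi)) x0.

Lemma jet2_partial a j : jet2 (fun t => partial j phi (x0 + t *: row a O))
  (partial j phi x0) (kap a * O a j) (d2row a j).
Proof.
apply: (jet2_eq (jet2_line O oOm Ox0 a (Ck_le (isT : (2 <= 3)%N) (Ck_partial j c4)))) => //.
by rewrite -row_hess; apply: eq_bigr => i _; rewrite mxE.
Qed.

Lemma d2row_d3 l a : \sum_j O l j * d2row a j = T3 l a.
Proof.
rewrite /d3 /d2row; apply: eq_bigr => k _; apply: (f_equal2 *%R (erefl _)).
apply: eq_bigr => i _; apply: eq_bigr => j _; apply: (f_equal2 *%R (erefl _)).
exact: (partial3_sym i j k oOm (Ck_le (isT : (3 <= 4)%N) c4) Ox0).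
Qed.

Lemma orth_row_sqr a : \sum_j O a j ^+ 2 = 1.
Proof.
transitivity ((O *m O^T) a a); last by rewrite oO mxE eqxx.
by rewrite mxE; apply: eq_bigr => j _; rewrite mxE expr2.
Qed.

Definition half_grad (x : V) : R := 2^-1 * \sum_j partial j phi x ^+ 2.
Definition half_sqr (x : V) : R := 2^-1 * \sum_j x 0 j ^+ 2.

Lemma jet2_half_grad a : jet2 (fun t => half_grad (x0 + t *: row a O)) (half_grad x0)
  (kap a * p a) (kap a ^+ 2 + \sum_l p l * T3 l a).
Proof.
have J := jet2Z 2^-1 (jet2_sum (index_enum 'I_n) (fun j =>
  jet2M (jet2_partial a j) (jet2_partial a j))).
apply: (jet2_eq J) => //.
- rewrite /p !mulr_sumr; apply: eq_bigr => j _.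
  by move: (partial j phi x0) => g; field.
- under [in RHS]eq_bigr => l _ do rewrite -d2row_d3.
  have -> : kap a ^+ 2 = \sum_j kap a ^+ 2 * O a j ^+ 2.
    by rewrite -mulr_sumr orth_row_sqr mulr1.
  rewrite /p (sum_orth _ _ oO) mulr_sumr -big_split /=.
  apply: eq_bigr => j _; move: (partial j phi x0) (d2row a j) => g d.
  by field.
Qed.

Lemma jet2_half_sqr a : jet2 (fun t => half_sqr (x0 + t *: row a O)) (half_sqr x0) (y a) 1.
Proof.
have jl j : jet2 (fun t => (x0 + t *: row a O) 0 j) (x0 0 j) (O a j) 0.
  by apply: (jet2_eq (jet2_affine _ _)) => // t; rewrite !mxE mulrC.
have J := jet2Z 2^-1 (jet2_sum (index_enum 'I_n) (fun j => jet2M (jl j) (jl j))).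
apply: (jet2_eq J) => //.
- by rewrite /y !mulr_sumr; apply: eq_bigr => j _; field.
- by rewrite -[RHS](orth_row_sqr a) !mulr_sumr; apply: eq_bigr => j _; field.
Qed.

Lemma half_gradE : \sum_a p a ^+ 2 = 2 * half_grad x0.
Proof.
rewrite /half_grad mulrA divff ?mul1r //.
under eq_bigr do rewrite expr2; rewrite sum_orth //.
Qed.

Lemma half_sqrE : \sum_a y a ^+ 2 = 2 * half_sqr x0.
Proof.
rewrite /half_sqr mulrA divff ?mul1r //.
under eq_bigr do rewrite expr2; rewrite sum_orth //.
Qed.

Variables (f : V -> R -> V -> R).
Hypothesis cf : Ck 2 (jet_dom Omega) (jfun f).

Definition jet_at (x : V) : 'rV[R]_(n + (1 + n)) :=
  row_mx x (row_mx (phi x)%:M (grad phi x)).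

Lemma jfun_jet_at x : jfun f (jet_at x) = f x (phi x) (grad phi x).
Proof. by rewrite /jfun /jx /jz /jp /jet_at row_mxKl !row_mxKr row_mxKl mxE eqxx. Qed.

Lemma jet_dom_open : open (jet_dom Omega).
Proof.
rewrite openE => v Ov; have nO : nbhs (jx v) Omega by apply: open_nbhs_nbhs.
have [e /= e0 he] := (@nbhs_ballP _ _ (jx v) _).1 nO.
apply/(@nbhs_ballP _ _ v); exists e => //= z vz; apply: he; move: vz.
rewrite -!ball_normE /=; apply: le_lt_trans; apply: norm_rV_le => // i.
by have := coord_le_norm (v - z) (lshift (1 + n) i); rewrite /jx !mxE.
Qed.

Let F := jfun f.
Let z0 := jet_at x0.
Let fx a := \sum_i O a i * partial (lshift (1 + n) i) F z0.
Let fz := partial (rshift n (lshift n ord0)) F z0.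
Let fp a := \sum_i O a i * partial (rshift n (rshift 1 i)) F z0.
(** The velocity of [jet_at] along a frame vector: in an eigenframe the gradient slot moves by
    [kap a] times the same vector. *)
Let jvel a : 'rV[R]_(n + (1 + n)) := row_mx (row a O) (row_mx (p a)%:M (kap a *: row a O)).
Let fquad a := \sum_s \sum_t jvel a 0 s * jvel a 0 t * partial s (partial t F) z0.

Lemma jet2_f a : jet2 (fun t => F (jet_at (x0 + t *: row a O))) (F z0)
  (fx a + p a * fz + kap a * fp a)
  (kap a * fz + \sum_l T3 l a * fp l + fquad a).
Proof.
(* The acceleration of the jet: the x slot moves linearly, and the gradient slot brings in third
   derivatives. *)
pose jacc : 'rV[R]_(n + (1 + n)) := row_mx 0 (row_mx (kap a)%:M (\row_j d2row a j)).
have jg s : jet2 (fun t => jet_at (x0 + t *: row a O) 0 s) (z0 0 s) (jvel a 0 s) (jacc 0 s).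
  rewrite /z0 /jvel /jacc; case: (split_ordP s) => [i|s'] ->.
    rewrite !row_mxEl; apply: (jet2_eq (jet2_affine (x0 0 i) (O a i))); rewrite ?mxE //.
    by move=> t; rewrite row_mxEl !mxE mulrC.
  rewrite !row_mxEr; case: (split_ordP s') => [i|i] ->.
    rewrite !row_mxEl ord1; have c2 := Ck_le (isT : (2 <= 4)%N) c4.
    apply: (jet2_eq (jet2_line O oOm Ox0 a c2)); rewrite ?mxE ?eqxx ?mulr1n //.
    - by move=> t; rewrite row_mxEr row_mxEl mxE eqxx.
    - rewrite /kap bfE; apply: eq_bigr => i' _; apply: eq_bigr => j' _.
      by rewrite [row a O 0 i']mxE [row a O 0 j']mxE mxE; exact: mulrAC.
  rewrite !row_mxEr; apply: (jet2_eq (jet2_partial a i)); rewrite ?mxE //.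
  by move=> t; rewrite !row_mxEr mxE.
have z0d : jet_dom Omega z0 by rewrite /jet_dom /= /jx row_mxKl.
apply: (jet2_eq (jet2_comp jet_dom_open cf z0d jg)) => //.
- rewrite big_split_ord big_split_ord /= big_ord1 -addrA; congr (_ + (_ + _)).
  + by apply: eq_bigr => i _; rewrite row_mxEl mxE.
  + by rewrite row_mxEr row_mxEl mxE eqxx.
  + by rewrite /fp mulr_sumr; apply: eq_bigr => i _; rewrite !row_mxEr !mxE -mulrA.
- congr (_ + _); rewrite big_split_ord big_split_ord /= big_ord1.
  rewrite [X in X + _]big1 => [|i _]; last by rewrite row_mxEl mxE mul0r.
  rewrite add0r; congr (_ + _).
    by rewrite row_mxEr row_mxEl mxE eqxx.
  under [RHS]eq_bigr => l _ do rewrite -d2row_d3.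
  rewrite (sum_orth _ _ oO); apply: eq_bigr => i _.
  by rewrite !row_mxEr !mxE.
Qed.

Lemma fquad_le a : `|fquad a| <=
  (n + (1 + n))%:R * enorm (hess F z0) * (1 + p a ^+ 2 + kap a ^+ 2).
Proof.
have := quad_form_le (hess F z0) (jvel a 0).
have -> : \sum_i jvel a 0 i ^+ 2 = 1 + p a ^+ 2 + kap a ^+ 2.
  rewrite big_split_ord big_split_ord /= big_ord1 -addrA; congr (_ + (_ + _)).
  - by rewrite -[RHS](orth_row_sqr a); apply: eq_bigr => i _; rewrite row_mxEl mxE.
  - by rewrite row_mxEr row_mxEl mxE eqxx.
  - rewrite -[RHS]mulr1 -(orth_row_sqr a) mulr_sumr; apply: eq_bigr => i _.
    by rewrite !row_mxEr !mxE exprMn.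
apply: le_trans; rewrite le_eqVlt; apply/orP; left; apply/eqP; congr `|_|.
by apply: eq_bigr => s _; apply: eq_bigr => t _; apply: (f_equal2 *%R (erefl _)); rewrite mxE.
Qed.

Lemma fgradE : \sum_a fx a ^+ 2 + fz ^+ 2 + \sum_a fp a ^+ 2 = enorm (grad F z0) ^+ 2.
Proof.
rewrite enorm_row_sqr big_split_ord big_split_ord /= big_ord1 -!addrA; congr (_ + (_ + _)).
- by under eq_bigr do rewrite expr2; rewrite sum_orth //; apply: eq_bigr => i _; rewrite mxE.
- by rewrite mxE.
- by under eq_bigr do rewrite expr2; rewrite sum_orth //; apply: eq_bigr => i _; rewrite mxE.
Qed.
End LocalJets2.

(** * The second-order comparison at an interior maximum *)

Section InteriorMaximum.
Variables (R : realType) (n : nat).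
Local Notation V := 'rV[R]_n.

(* U b is the second derivative of phi along the frame vector e b, W and S are the
   halved squares of the gradient and of x, and G is x |-> f (x, phi, grad phi);
   T l a and Q a b stand for the third and fourth derivatives of phi along
   (e l, e a, e a) and (e a, e a, e b, e b) at x0. *)
Record local_jets (U : 'I_n -> V -> R) (W S G : V -> R) (e : 'I_n -> V) (x0 : V)
    (kap p y : 'I_n -> R) := LocalJets {
  T : 'I_n -> 'I_n -> R;
  Q : 'I_n -> 'I_n -> R;
  fx : 'I_n -> R;
  fp : 'I_n -> R;
  fq : 'I_n -> R;
  fz : R;
  QC : forall a b, Q a b = Q b a;
  jetU : forall a b, jet2 (fun t => U b (x0 + t *: e a)) (kap b) (T a b) (Q a b);
  jetW : forall a, jet2 (fun t => W (x0 + t *: e a)) (W x0) (kap a * p a)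
    (kap a ^+ 2 + \sum_l p l * T l a);
  jetS : forall a, jet2 (fun t => S (x0 + t *: e a)) (S x0) (y a) 1;
  jetG : forall a, jet2 (fun t => G (x0 + t *: e a)) (G x0)
    (fx a + p a * fz + kap a * fp a)
    (kap a * fz + \sum_l T l a * fp l + fq a) }.

Lemma jet2_small (g : R -> R) b q (e : R) : jet2 g 0 b q -> 0 < e ->
  exists2 r, 0 < r & forall t, `|t| < r -> `|g t| <= e.
Proof.
move=> jg e0; have [d d0 hd] := jet2_near jg ltr01.
pose L := `|b| + (`|q| / 2 + 1).
have L0 : 0 < L by rewrite ltr_wpDl // ltr_wpDl // divr_ge0.
exists (Num.min d (Num.min 1 (e / L))); first by rewrite !lt_min d0 ltr01 divr_gt0.
move=> t; rewrite !lt_min => /andP[td /andP[t1 te]].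
have := hd t td; rewrite subr0 => h.
have -> : g t = b * t + (g t - b * t) by rewrite addrC subrK.
apply: le_trans (ler_normD _ _) _; rewrite normrM.
apply: (@le_trans _ _ (L * `|t|)); last by rewrite mulrC -ler_pdivlMr // ltW.
rewrite mulrDl lerD //; apply: le_trans h _; rewrite ler_wpM2l ?addr_ge0 ?divr_ge0 //.
by rewrite -[t ^+ 2]ger0_norm ?sqr_ge0 // normrX expr2 ler_piMr // ltW.
Qed.

(** A quadratic polynomial replaces the reciprocal, so that jets of sums and products suffice. *)
Lemma sub_inv_ge (z : R) : - (1 / 2) <= z -> z - 2 * z ^+ 2 <= 1 - (1 + z)^-1.
Proof.
move=> hz; have z1 : 0 < 1 + z by lra.
have -> : 1 - (1 + z)^-1 = z / (1 + z) by field; rewrite gt_eqF.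
rewrite ler_pdivlMr //; nra.
Qed.

Section Jets.
Variables (U : 'I_n -> V -> R) (W S G : V -> R) (e : 'I_n -> V) (x0 : V)
  (kap p y : 'I_n -> R).
Variable J : local_jets U W S G e x0 kap p y.
Local Notation T := (T J).
Local Notation Q := (Q J).
Local Notation fx := (fx J).
Local Notation fp := (fp J).
Local Notation fq := (fq J).
Local Notation fz := (fz J).

(** [rho1] and [rho2] are the jet coefficients of the lower bound of 1 - G x0 / G given by
    [sub_inv_ge]; its quadratic term produces the - 4 rho1^2. *)
Definition rho1 a : R := (fx a + p a * fz + kap a * fp a) / G x0.
Definition rho2 a : R :=
  (kap a * fz + \sum_l T l a * fp l + fq a) / G x0 - 4 * rho1 a ^+ 2.

Definition relG x : R := (G x - G x0) / G x0.

Lemma jet2_relG a : G x0 != 0 -> jet2 (fun t => relG (x0 + t *: e a)) 0 (rho1 a)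
  ((kap a * fz + \sum_l T l a * fp l + fq a) / G x0).
Proof.
move=> g0; apply: (jet2_eq (jet2Z (G x0)^-1 (jet2D (jetG J a) (jet2_cst (- G x0))))).
- by move=> t; rewrite /relG mulrC.
- by rewrite subrr mulr0.
- by rewrite addr0 mulrC.
- by rewrite addr0 mulrC.
Qed.

Lemma jet2_rho a : G x0 != 0 ->
  jet2 (fun t => relG (x0 + t *: e a) - 2 * relG (x0 + t *: e a) ^+ 2) 0 (rho1 a) (rho2 a).
Proof.
move=> g0; have j := jet2_relG a g0.
by apply: (jet2_eq (jet2D j (jet2Z (- 2) (jet2M j j)))) => [t|||]; rewrite /rho2; ring.
Qed.

Lemma relG_ge a : G x0 != 0 -> exists2 r, 0 < r & forall t, `|t| < r ->
  - (1 / 2) <= relG (x0 + t *: e a).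
Proof.
move=> g0; have [|r r0 hr] := jet2_small (jet2_relG a g0) (e := 1 / 2); first by [].
by exists r => // t /hr; rewrite ler_norml => /andP[].
Qed.

(* Summed against F, the maximality of U i + mu (W + S) and the minimality of
   sum_b F b U b - (1 - G x0 / G) leave only terms at most linear in kap i and the
   square of rho1 i: the fourth derivatives cancel because Q a i = Q i a, and the
   sums of kap l * p l * fp l produced by the third derivatives cancel each other. *)
Lemma interior_ineq (F : 'I_n -> R) (mu r : R) i : 0 < r -> 0 < G x0 -> 0 <= mu ->
  (forall a, 0 <= F a) ->
  (forall a t, `|t| < r -> 0 < G (x0 + t *: e a) /\
     \sum_b F b * kap b + 1 - G x0 / G (x0 + t *: e a) <=
       \sum_b F b * U b (x0 + t *: e a)) ->
  (forall a t, `|t| < r ->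
     U i (x0 + t *: e a) + mu * (W (x0 + t *: e a) + S (x0 + t *: e a)) <=
     kap i + mu * (W x0 + S x0)) ->
  mu * (\sum_a F a * kap a ^+ 2 + \sum_a F a) <=
   - (kap i * fz + fq i) / G x0 + mu * (\sum_l y l * fp l) / G x0 + 4 * rho1 i ^+ 2
   - mu * (\sum_l p l * fx l + fz * \sum_l p l ^+ 2) / G x0.
Proof.
move=> r0 g0 mu0 F0 supp maxU; have gn0 : G x0 != 0 by rewrite gt_eqF.
have H1 a : T a i + mu * (kap a * p a + y a) = 0 /\
    Q a i + mu * (kap a ^+ 2 + \sum_l p l * T l a + 1) <= 0.
  have j := jet2D (jetU J a i) (jet2Z mu (jet2D (jetW J a) (jetS J a))).
  exact: jet2_max r0 j (maxU a).
have H2 a : \sum_b F b * T a b = rho1 a /\ rho2 a <= \sum_b F b * Q a b.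
  have [s s0 hs] := relG_ge a gn0.
  have j := jet2Z (- 1) (jet2D (jet2_sum (index_enum 'I_n) (fun b => jet2Z (F b) (jetU J a b)))
    (jet2Z (- 1) (jet2_rho a gn0))).
  have [|t|h1 h2] := jet2_max (r := Num.min r s) _ j; first by rewrite lt_min r0.
    rewrite lt_min => /andP[tr ts]; have [gt0 h] := supp a t tr.
    have := sub_inv_ge (hs t ts).
    have -> : 1 + relG (x0 + t *: e a) = G (x0 + t *: e a) / G x0.
      by rewrite /relG; field.
    rewrite invf_div; move: h; lra.
  by split; lra.
have E1 l : T l i = - mu * (kap l * p l + y l) by have [h _] := H1 l; lra.
(* The second-order conditions on [U i] in all directions, weighted by F; the third derivatives
   collapse into [rho1] by the first-order part of [H2]. *)
have S1 : \sum_a F a * Q a i + mu * (\sum_a F a * kap a ^+ 2 +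
    \sum_l p l * rho1 l + \sum_a F a) <= 0.
  have -> : \sum_l p l * rho1 l = \sum_a F a * \sum_l p l * T l a.
    under [RHS]eq_bigr do rewrite mulr_sumr; rewrite exchange_big /=.
    apply: eq_bigr => l _; have [<- _] := H2 l; rewrite mulr_sumr.
    by apply: eq_bigr => a _; rewrite mulrCA.
  rewrite -!big_split /= mulr_sumr -big_split /=; apply: sumr_le0 => a _.
  have [_ h] := H1 a; have := mulr_ge0_le0 (F0 a) h; lra.
have S2 : \sum_a F a * Q a i = \sum_b F b * Q i b.
  by apply: eq_bigr => a _; rewrite QC.
have [_ h2] := H2 i.
have E2 : \sum_l T l i * fp l = - mu * (\sum_l kap l * p l * fp l + \sum_l y l * fp l).
  rewrite -big_split mulr_sumr; apply: eq_bigr => l _ /=; rewrite E1; ring.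
have E3 : \sum_l p l * rho1 l = (\sum_l p l * fx l + fz * \sum_l p l ^+ 2 +
     \sum_l kap l * p l * fp l) / G x0.
  rewrite mulr_sumr -!big_split mulr_suml; apply: eq_bigr => l _ /=.
  by rewrite /rho1; ring.
move: S1 h2; rewrite /rho2 S2 E2 E3.
move: (\sum_a F a * kap a ^+ 2) (\sum_b F b * Q i b) (\sum_l kap l * p l * fp l)
  (\sum_l p l * fx l) (\sum_l y l * fp l) (\sum_l p l ^+ 2) (\sum_a F a) => s1 s2 s3 s4 s5 s6 s7.
move: (fz) (rho1 i) (fq i) (kap i) (G x0)^-1 => z q1 q2 k g; lra.
Qed.

End Jets.
End InteriorMaximum.

(** * The two-dimensional comparison *)

Section InteriorMaximum2.
Variables (R : realType) (n : nat).
Local Notation V := 'rV[R]_n.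
Variables (U : 'I_n -> V -> R) (W S G : V -> R) (e : 'I_n -> V) (x0 : V)
  (kap p y : 'I_n -> R).
Variable J : local_jets U W S G e x0 kap p y.

Lemma sum_pair (i j : 'I_n) (X : 'I_n -> R) : i != j -> (forall l, l = i \/ l = j) ->
  \sum_l X l = X i + X j.
Proof.
move=> ij all; rewrite (bigD1 i) //= (bigD1 j) 1?eq_sym //= big1 ?addr0 // => l /andP[li lj].
by case: (all l) li lj => ->; rewrite eqxx.
Qed.

(** Second-order conditions are used only for [U i] along [e j] and for [U j] along [e i], which
    share one fourth derivative. Along [e i] the beta^2 error of [U i] would be of order kap_i^3,
    whereas along [e j] it is kap_i (kap_j p_j)^2 = G kap_j p_j^2. *)
Lemma interior_ineq2 (beta r : R) i j : 0 < r -> 0 < G x0 -> i != j ->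
  (forall l, l = i \/ l = j) -> kap i * kap j = G x0 -> 0 < kap i -> 0 < kap j ->
  (forall a t, `|t| < r -> 0 < G (x0 + t *: e a) /\
     kap j * (2 - G x0 / G (x0 + t *: e a) + beta * (W (x0 + t *: e a) - W x0)) <=
     U j (x0 + t *: e a)) ->
  (forall a t, `|t| < r ->
     U i (x0 + t *: e a) <= kap i * (1 - beta * (W (x0 + t *: e a) - W x0) +
       2 * beta ^+ 2 * (W (x0 + t *: e a) - W x0) ^+ 2)) ->
  kap j * (kap i * fz J + fq J i) / G x0 - 4 * kap j * rho1 J i ^+ 2
  + beta * (G x0 * (kap i + kap j)) + beta * (\sum_l p l * fx J l + fz J * \sum_l p l ^+ 2)
  <= 4 * G x0 * beta ^+ 2 * kap j * p j ^+ 2.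
Proof.
move=> r0 g0 ij all kk ki0 kj0 minU maxU; have gn0 : G x0 != 0 by rewrite gt_eqF.
have jW a : jet2 (fun t => W (x0 + t *: e a) - W x0) 0 (kap a * p a)
    (kap a ^+ 2 + \sum_l p l * T J l a).
  by apply: (jet2_eq (jet2D (jetW J a) (jet2_cst (- W x0)))); rewrite ?subrr ?addr0.
have H1 a : T J a i = - kap i * beta * (kap a * p a) /\
    Q J a i <= kap i * (- beta * (kap a ^+ 2 + \sum_l p l * T J l a)
       + 4 * beta ^+ 2 * (kap a * p a) ^+ 2).
  have jj := jet2D (jetU J a i) (jet2Z (- kap i) (jet2D (jet2Z (- beta) (jW a))
     (jet2Z (2 * beta ^+ 2) (jet2M (jW a) (jW a))))).
  have [t tr|h1 h2] := jet2_max r0 jj; first by have := maxU a t tr; lra.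
  by split; [lra|rewrite expr2; lra].
have H2 a : T J a j = kap j * (rho1 J a + beta * (kap a * p a)) /\
    kap j * (rho2 J a + beta * (kap a ^+ 2 + \sum_l p l * T J l a)) <= Q J a j.
  have [s s0 hs] := relG_ge J a gn0.
  have jj := jet2D (jet2Z (- 1) (jetU J a j)) (jet2Z (kap j)
    (jet2D (jet2_rho J a gn0) (jet2Z beta (jW a)))).
  have [|t|h1 h2] := jet2_max (r := Num.min r s) _ jj; first by rewrite lt_min r0.
    rewrite lt_min => /andP[tr ts]; have [gt0 h] := minU a t tr.
    have := sub_inv_ge (hs t ts).
    have -> : 1 + relG G x0 (x0 + t *: e a) = G (x0 + t *: e a) / G x0.
      by rewrite /relG; field.
    rewrite invf_div -(ler_pM2l kj0); move: h; lra.
  by split; lra.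
have [_ q1] := H1 j; have [_ q2] := H2 i; rewrite QC in q1.
(* The first-order conditions combine to the derivative of U i * U j = G along [e l]. *)
have E1 l : p l * (kap j * T J l i + kap i * T J l j) = G x0 * (p l * rho1 J l).
  by have [-> _] := H1 l; have [-> _] := H2 l; rewrite -kk; ring.
have E2 : kap j * (\sum_l p l * T J l i) + kap i * (\sum_l p l * T J l j) =
    \sum_l p l * fx J l + fz J * (\sum_l p l ^+ 2) + \sum_l kap l * p l * fp J l.
  rewrite !mulr_sumr -!big_split /=; apply: eq_bigr => l _.
  rewrite mulrCA (mulrCA (kap i)) -mulrDr E1 /rho1.
  by field.
have E3 : \sum_l T J l i * fp J l = - kap i * beta * (\sum_l kap l * p l * fp J l).
  by rewrite mulr_sumr; apply: eq_bigr => l _; have [-> _] := H1 l; ring.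
move: q1 q2 E2; rewrite /rho2 E3 => {H1 H2 E1 E3}.
move: (\sum_l p l * T J l i) (\sum_l p l * T J l j) (\sum_l kap l * p l * fp J l)
  (\sum_l p l * fx J l) (\sum_l p l ^+ 2) => s1 s2 s3 s4 s5.
move: (fz J) (rho1 J i) (fq J i) (Q J i j) => z q1 q2 k h1 h2 h3.
have kjE : kap j * (kap i * z + - kap i * beta * s3 + q2) / G x0 =
   kap j * (kap i * z + q2) / G x0 - beta * s3.
  have kg : kap i * kap j / G x0 = 1 by rewrite kk divff.
  by rewrite -[in RHS](mul1r s3) -kg; ring.
have h4 : kap j * ((kap i * z + - kap i * beta * s3 + q2) / G x0 - 4 * q1 ^+ 2 + beta * (kap i ^+ 2 + s1)) <=
   kap i * (- beta * (kap j ^+ 2 + s2) + 4 * beta ^+ 2 * (kap j * p j) ^+ 2).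
  exact: le_trans h2 h1.
rewrite (_ : kap j * _ = kap j * (kap i * z + - kap i * beta * s3 + q2) / G x0
  - 4 * kap j * q1 ^+ 2 + kap j * (beta * (kap i ^+ 2 + s1))) in h4; last by ring.
rewrite kjE in h4.
have E4 : 4 * G x0 * beta ^+ 2 * kap j * p j ^+ 2 =
   kap i * (4 * beta ^+ 2 * (kap j * p j) ^+ 2) by rewrite -kk; ring.
have E5 : beta * (G x0 * (kap i + kap j)) = beta * (kap j * kap i ^+ 2 + kap i * kap j ^+ 2).
  by rewrite -kk; ring.
have E6 : beta * (s4 + z * s5) = beta * (kap j * s1 + kap i * s2) - beta * s3 by rewrite h3; ring.
rewrite E4 E5 E6; move: h4; clear; lra.
Qed.

End InteriorMaximum2.

(** * Explicit constants *)

Section Numeric.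
Variables (R : realType) (n : nat).

Lemma rho_sqr_le (M c0 F a b z p k g : R) : 0 <= M -> 0 < c0 -> c0 <= g -> 0 <= F -> 1 <= k ->
  `|a| <= F -> `|b| <= F -> `|z| <= F -> `|p| <= M ->
  ((a + p * z + k * b) / g) ^+ 2 <= (F / c0 * (1 + M)) ^+ 2 * (1 + k) ^+ 2.
Proof.
move=> M0 c00 cg F0 k1 ha hb hz hp; have g0 : 0 < g := lt_le_trans c00 cg.
rewrite -exprMn -[leLHS]real_normK ?num_real // ler_sqr ?nnegrE //; last first.
  by rewrite !mulr_ge0 ?invr_ge0 ?addr_ge0 //; lra.
rewrite normrM normfV (gtr0_norm g0) ler_pdivrMr //.
apply: (@le_trans _ _ (F * ((1 + M) * (1 + k)))).
  apply: le_trans (ler_normD _ _) _; apply: le_trans (lerD (ler_normD _ _) (lexx _)) _.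
  rewrite !normrM (ger0_norm (_ : 0 <= k)); last by lra.
  have h1 : `|p| * `|z| <= M * F by apply: ler_pM.
  have h2 : k * `|b| <= k * F by rewrite ler_wpM2l //; lra.
  have h3 : 0 <= F * M * k by rewrite !mulr_ge0 //; lra.
  by move: h1 h2 h3 ha; clear; lra.
have -> : F / c0 * (1 + M) * (1 + k) * g = F * ((1 + M) * (1 + k)) * (g / c0) by ring.
rewrite ler_peMr //; last by rewrite ler_pdivlMr // mul1r.
by rewrite !mulr_ge0 ?addr_ge0 //; lra.
Qed.

Lemma young_sum (a b : 'I_n -> R) :
  `|\sum_l a l * b l| <= (\sum_l a l ^+ 2 + \sum_l b l ^+ 2) / 2.
Proof.
apply: le_trans (ler_norm_sum _ _ _) _; rewrite -big_split /= mulr_suml.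
apply: ler_sum => l _; rewrite normrM -(real_normK (num_real (a l))) -(real_normK (num_real (b l))).
by have := sqr_ge0 (`|a l| - `|b l|); lra.
Qed.

Lemma inv_le_mul (c0 g x B : R) : 0 < c0 -> c0 <= g -> `|x| <= B -> x / g <= B / c0.
Proof.
move=> c00 cg xB; have g0 : 0 < g := lt_le_trans c00 cg.
apply: le_trans (_ : B / g <= _).
  by rewrite ler_pM2r ?invr_gt0 // (le_trans (ler_norm _)).
by rewrite ler_wpM2l ?(le_trans _ xB) // lef_pV2.
Qed.

(** [quad_const] collects what grows like (1 + k)^2, [lin_const] what comes multiplied by mu or
    beta. *)
Definition quad_const (M c0 F N : R) : R :=
  F / c0 * (1 + N * (1 + M ^+ 2)) + 4 * (F / c0 * (1 + M)) ^+ 2.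
Definition lin_const (M c0 F D : R) : R :=
  ((D + F ^+ 2) / 2 + ((M ^+ 2 + F ^+ 2) / 2 + F * M ^+ 2)) / c0.

Lemma quad_const_ge0 M c0 F N : 0 < c0 -> 0 <= F -> 0 <= N -> 0 <= quad_const M c0 F N.
Proof.
move=> c00 F0 N0; apply: addr_ge0; last by rewrite mulr_ge0 ?sqr_ge0.
apply: mulr_ge0; first by rewrite divr_ge0 // ltW.
by rewrite addr_ge0 // mulr_ge0 // addr_ge0 // sqr_ge0.
Qed.

Lemma lin_const_ge0 M c0 F D : 0 < c0 -> 0 <= F -> 0 <= D -> 0 <= lin_const M c0 F D.
Proof.
move=> c00 F0 D0; apply: divr_ge0; last exact: ltW.
apply: addr_ge0; first by rewrite divr_ge0 // addr_ge0 // sqr_ge0.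
apply: addr_ge0; first by rewrite divr_ge0 // addr_ge0 // sqr_ge0.
by rewrite mulr_ge0 // sqr_ge0.
Qed.

Lemma quad_terms_le (M c0 F N k g z q p a b : R) : 0 <= M -> 0 < c0 -> 0 <= F -> 0 <= N ->
  1 <= k -> c0 <= g -> `|z| <= F -> `|p| <= M ->
  `|a| <= F -> `|b| <= F ->
  `|q| <= N * F * (1 + p ^+ 2 + k ^+ 2) ->
  - (k * z + q) / g + 4 * ((a + p * z + k * b) / g) ^+ 2 <= quad_const M c0 F N * (1 + k) ^+ 2.
Proof.
move=> M0 c00 F0 N0 k1 cg hz hp ha hb hq.
have h1 := rho_sqr_le M0 c00 cg F0 k1 ha hb hz hp.
have h2 : - (k * z + q) / g <= F / c0 * (1 + N * (1 + M ^+ 2)) * (1 + k) ^+ 2.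
  have -> : F / c0 * (1 + N * (1 + M ^+ 2)) * (1 + k) ^+ 2 =
    (F * (1 + N * (1 + M ^+ 2)) * (1 + k) ^+ 2) / c0 by ring.
  apply: inv_le_mul => //; rewrite normrN; apply: le_trans (ler_normD _ _) _.
  rewrite normrM (ger0_norm (_ : 0 <= k)); last by lra.
  have p2 : p ^+ 2 <= M ^+ 2 by rewrite -(real_normK (num_real p)) ler_sqr ?nnegrE.
  have h3 : k * `|z| <= F * (1 + k) ^+ 2.
    apply: (@le_trans _ _ (k * F)); first by rewrite ler_wpM2l //; lra.
    by rewrite mulrC ler_wpM2l //; nra.
  have h4 : 1 + p ^+ 2 + k ^+ 2 <= (1 + M ^+ 2) * (1 + k) ^+ 2.
    have := sqr_ge0 M; have : 0 <= M ^+ 2 * k by rewrite mulr_ge0 ?sqr_ge0 //; lra.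
    have : 0 <= M ^+ 2 * k ^+ 2 by rewrite mulr_ge0 ?sqr_ge0.
    by move: p2 k1; clear; lra.
  have h5 : `|q| <= N * F * ((1 + M ^+ 2) * (1 + k) ^+ 2).
    by apply: le_trans hq _; rewrite ler_wpM2l // mulr_ge0.
  by move: h3 h5; clear; lra.
by rewrite /quad_const [leRHS]mulrDl lerD // -mulrA ler_wpM2l.
Qed.

Lemma lin_terms_le (M c0 F D g z : R) (p y fx fp : 'I_n -> R) : 0 < c0 -> 0 <= F ->
  c0 <= g -> `|z| <= F -> \sum_l p l ^+ 2 <= M ^+ 2 -> \sum_l y l ^+ 2 <= D -> \sum_l fx l ^+ 2 <= F ^+ 2 ->
  \sum_l fp l ^+ 2 <= F ^+ 2 ->
  (\sum_l y l * fp l) / g - (\sum_l p l * fx l + z * \sum_l p l ^+ 2) / g <= lin_const M c0 F D.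
Proof.
move=> c00 F0 cg hz hp hy hfx hfp; rewrite -mulrBl; apply: inv_le_mul => //.
have h1 := young_sum y fp; have h2 := young_sum p fx.
have p0 : 0 <= \sum_l p l ^+ 2 by apply: sumr_ge0 => l _; exact: sqr_ge0.
have h3 : `|z * \sum_l p l ^+ 2| <= F * M ^+ 2.
  by rewrite normrM (ger0_norm p0) ler_pM.
apply: le_trans (ler_normB _ _) _; apply: lerD.
  by apply: le_trans h1 _; move: hy hfp; clear; lra.
apply: le_trans (ler_normD _ _) _; apply: lerD => //.
by apply: le_trans h2 _; move: hp hfx; clear; lra.
Qed.

End Numeric.

Section Numeric2.
Variables (R : realType) (n : nat).

(** Dividing by mu = k / v costs at most the factor K / k, which lowers quadratic terms to linear
    ones; the 2 comes from 1 + k <= 2 k. *)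
Lemma case1_bound (M c0 F D N K g k q z X mu v : R) (p y fx fp : 'I_n -> R) i :
  0 <= M -> 0 < c0 -> 0 <= F -> 0 <= D -> 0 <= N -> 1 <= k -> c0 <= g -> `|z| <= F ->
  \sum_l p l ^+ 2 <= M ^+ 2 -> \sum_l y l ^+ 2 <= D ->
  \sum_l fx l ^+ 2 <= F ^+ 2 -> \sum_l fp l ^+ 2 <= F ^+ 2 ->
  `|p i| <= M -> `|fx i| <= F -> `|fp i| <= F ->
  `|q| <= N * F * (1 + p i ^+ 2 + k ^+ 2) ->
  mu = k / v -> 0 < v -> v <= K ->
  mu * X <= - (k * z + q) / g + mu * (\sum_l y l * fp l) / g +
    4 * ((fx i + p i * z + k * fp i) / g) ^+ 2
    - mu * (\sum_l p l * fx l + z * \sum_l p l ^+ 2) / g ->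
  X <= (2 * quad_const M c0 F N * K + lin_const M c0 F D) * (1 + k).
Proof.
move=> M0 c00 F0 D0 N0 k1 cg hz hp hy hfx hfp hpi hfxi hfpi hq muE v0 vK h.
have hQ := quad_terms_le M0 c00 F0 N0 k1 cg hz hpi hfxi hfpi hq.
have hL := lin_terms_le c00 F0 cg hz hp hy hfx hfp.
have A0 := quad_const_ge0 M c00 F0 N0; have B0 := lin_const_ge0 M c00 F0 D0.
move: (quad_const _ _ _ _) (lin_const _ _ _ _) hQ hL A0 B0 => A B hQ hL A0 B0.
have k0 : 0 < k by lra.
have mu0 : 0 < mu by rewrite muE divr_gt0.
have h1 : mu * X <= A * (1 + k) ^+ 2 + mu * B.
  have := ler_wpM2l (ltW mu0) hL; move: h hQ; clear.
  rewrite mulrBr !mulrA; lra.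
have h2 : A * (1 + k) ^+ 2 <= mu * (2 * A * K * (1 + k)).
  have -> : mu * (2 * A * K * (1 + k)) = A * (1 + k) * (2 * k * (K / v)).
    by rewrite muE; ring.
  rewrite expr2 mulrA ler_wpM2l ?mulr_ge0 //; first by lra.
  have Kv : 1 <= K / v by rewrite ler_pdivlMr // mul1r.
  apply: (@le_trans _ _ (2 * k)); first by lra.
  by rewrite ler_peMr //; lra.
have h3 : X <= 2 * A * K * (1 + k) + B.
  by rewrite -(ler_pM2l mu0) mulrDr; move: h1 h2; clear; lra.
by apply: le_trans h3 _; rewrite [leRHS]mulrDl lerD // ler_peMr //; lra.
Qed.

(** Multiplied by kj, the quadratic terms are at most 4 A g k because k kj = g; beta = 4 A + 1 beats
    them and leaves exactly g k. The beta^2 term stays bounded as kj <= g <= F. *)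
Lemma case2_bound (M c0 F N g k kj q z : R) (p fx fp : 'I_n -> R) i j :
  let A := quad_const M c0 F N in let beta := 4 * A + 1 in
  0 <= M -> 0 < c0 -> 0 <= F -> 0 <= N -> 1 <= k -> c0 <= g -> g <= F -> `|z| <= F ->
  \sum_l p l ^+ 2 <= M ^+ 2 ->
  \sum_l fx l ^+ 2 <= F ^+ 2 -> \sum_l fp l ^+ 2 <= F ^+ 2 ->
  `|p i| <= M -> `|p j| <= M -> `|fx i| <= F -> `|fp i| <= F ->
  `|q| <= N * F * (1 + p i ^+ 2 + k ^+ 2) -> k * kj = g ->
  kj * (k * z + q) / g - 4 * kj * ((fx i + p i * z + k * fp i) / g) ^+ 2
    + beta * (g * (k + kj)) + beta * (\sum_l p l * fx l + z * \sum_l p l ^+ 2)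
    <= 4 * g * beta ^+ 2 * kj * p j ^+ 2 ->
  k <= beta * lin_const M c0 F 0 + 4 * beta ^+ 2 * (F * M ^+ 2).
Proof.
move=> A beta M0 c00 F0 N0 k1 cg gF hz hp hfx hfp hpi hpj hfxi hfpi hq kk h.
have g0 : 0 < g := lt_le_trans c00 cg.
have hQ := quad_terms_le M0 c00 F0 N0 k1 cg hz hpi hfxi hfpi hq.
have hL : - ((\sum_l p l * fx l + z * \sum_l p l ^+ 2) / g) <= lin_const M c0 F 0.
  have hy : \sum_(l < n) (0 : R) ^+ 2 <= 0 by rewrite big1 // => l _; rewrite expr0n.
  have := @lin_terms_le R n M c0 F 0 g z p (fun=> 0) fx fp c00 F0 cg hz hp hy hfx hfp.
  by rewrite big1 ?mul0r ?sub0r // => l _; rewrite mul0r.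
have A0 := quad_const_ge0 M c00 F0 N0.
have B0 := lin_const_ge0 M c00 F0 (lexx 0).
rewrite -/A in hQ A0.
have b0 : 0 < beta by rewrite /beta; lra.
move: (lin_const _ _ _ _) hL B0 => B hL B0.
have k0 : 0 < k by lra.
have kj0 : 0 < kj by rewrite -(pmulr_rgt0 _ k0) kk.
have kjF : kj <= F by apply: le_trans gF; rewrite -kk ler_peMl // ltW.
have p2 : p j ^+ 2 <= M ^+ 2 by rewrite -(real_normK (num_real (p j))) ler_sqr ?nnegrE.
have h1 : kj * (A * (1 + k) ^+ 2) <= g * (4 * A * k).
  rewrite -kk; have -> : k * kj * (4 * A * k) = kj * (A * (2 * k) ^+ 2) by ring.
  apply: ler_wpM2l; first exact: ltW.
  apply: ler_wpM2l => //; rewrite ler_sqr ?nnegrE; lra.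
have h2 : - (beta * (\sum_l p l * fx l + z * \sum_l p l ^+ 2)) <= g * (beta * B).
  rewrite -mulrN mulrCA; apply: ler_wpM2l; first exact: ltW.
  by rewrite (mulrC g) -ler_pdivrMr // mulNr.
have h3 : 4 * g * beta ^+ 2 * kj * p j ^+ 2 <= g * (4 * beta ^+ 2 * (F * M ^+ 2)).
  have -> : 4 * g * beta ^+ 2 * kj * p j ^+ 2 = g * (4 * beta ^+ 2 * (kj * p j ^+ 2)) by ring.
  apply: ler_wpM2l; first exact: ltW.
  apply: ler_wpM2l; first by rewrite mulr_ge0 // sqr_ge0.
  by apply: ler_pM => //; [exact: ltW|exact: sqr_ge0].
have h4 := ler_wpM2l (ltW kj0) hQ.
have h5 : 0 <= beta * (g * kj) by rewrite !mulr_ge0 // ltW.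
rewrite -(ler_pM2l g0).
set X := (_ / g) ^+ 2 in h h4; set Y := (\sum_l p l * fx l + _) in h h2.
have h6 : g * (beta * k) <= g * (4 * A * k) + g * (beta * B) + g * (4 * beta ^+ 2 * (F * M ^+ 2)).
  have e1 : kj * (k * z + q) / g = kj * ((k * z + q) / g) by rewrite mulrA.
  have e2 : - (k * z + q) / g = - ((k * z + q) / g) by rewrite mulNr.
  rewrite e1 in h; rewrite e2 in h4.
  move: ((k * z + q) / g) h h4 h1 h2 h3 h5 => Z; clear; lra.
by move: h6; rewrite [in X in X <= _]/beta; lra.
Qed.

End Numeric2.

(** * Norms, extensions to the closure and the maximum principle *)

Section Closure.
Variables (R : realType) (m : nat).
Local Notation V := 'rV[R]_m.
Implicit Types (A K : set V) (u g : V -> R).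

Lemma extendE A u g x : {within closure A, continuous g} ->
  (forall y, A y -> g y = u y) -> closure A x -> extend A u x = g x.
Proof.
move=> cg gu Ax; rewrite /extend.
have P : ProperFilter (within A (nbhs x)).
  apply: within_nbhs_proper; exact: Ax.
apply: cvg_lim; first exact: Rhausdorff.
have h1 : g @ within (closure A) (nbhs x) --> g x.
  by move/subspace_continuousP : cg; apply.
have h2 : g @ within A (nbhs x) --> g x.
  apply: cvg_trans h1; apply: cvg_app; apply: within_subset; exact: subset_closure.
apply: cvg_trans h2; apply: near_eq_cvg.
by rewrite near_withinE; near=> y => Ay; rewrite gu.
Unshelve. all: by end_near. Qed.

Lemma compact_abs_bounded (T : topologicalType) (K : set T) (h : T -> R) : compact K ->
  {within K, continuous h} -> exists2 b, 0 <= b & forall x, K x -> `|h x| <= b.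
Proof.
move=> cK ch; have [->|/set0P K0] := eqVneq K set0; first by exists 0.
have [c _ hc] := compact_EVT_max K0 cK ch; have [d _ hd] := compact_EVT_min K0 cK ch.
exists (`|h c| + `|h d|); first by rewrite addr_ge0.
move=> x Kx; have xK : x \in K by rewrite inE.
rewrite ler_norml; apply/andP; split.
  apply: le_trans (hd x xK); have := ler_norm (- h d); rewrite normrN; have := normr_ge0 (h c); lra.
by apply: le_trans (hc x xK) _; have := ler_norm (h c); have := normr_ge0 (h d); lra.
Qed.

Lemma le_sup_image (T : Type) (K : set T) (h : T -> R) (b : R) x :
  (forall y, K y -> h y <= b) -> K x -> h x <= sup [set h y | y in K].
Proof.
move=> hb Kx; apply: sup_upper_bound; last by exists x.
by split; [exists (h x); exists x|exists b => _ [y Ky <-]; exact: hb].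
Qed.

Lemma sup_image_le (T : Type) (K : set T) (h : T -> R) (b : R) :
  K !=set0 -> (forall y, K y -> h y <= b) -> sup [set h y | y in K] <= b.
Proof.
move=> [x Kx] hb; apply: sup_le_ub; first by exists (h x); exists x.
by move=> _ [y Ky <-]; exact: hb.
Qed.

(** [sup] is 0 on sets without a supremum, so no upper bound is required. *)
Lemma sup_image_ge0 (T : Type) (K : set T) (h : T -> R) :
  (forall y, 0 <= h y) -> 0 <= sup [set h y | y in K].
Proof.
move=> h0; have [hs|hs] := pselect (has_sup [set h y | y in K]); last by rewrite sup_out.
have [[_ [y Ky _]] _] := hs; apply: le_trans (h0 y) _.
by apply: sup_upper_bound => //; exists y.
Qed.

Lemma enorm_bound p q (M : 'M[R]_(p, q)) (b : R) : 0 <= b ->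
  (forall i j, `|M i j| <= b) -> enorm M <= (p * q)%:R * b.
Proof.
move=> b0 hM; have [e0|pq] := posnP (p * q).
  rewrite e0 mul0r /enorm big1 ?sqrtr0 // => i _; rewrite big1 // => j _.
  have hp : (0 < p)%N := leq_ltn_trans (leq0n i) (ltn_ord i).
  have hq : (0 < q)%N := leq_ltn_trans (leq0n j) (ltn_ord j).
  by have := muln_gt0 p q; rewrite e0 hp hq.
rewrite -ler_sqr ?nnegrE ?enorm_ge0 ?mulr_ge0 // enorm_sqr.
apply: (@le_trans _ _ (\sum_(i < p) \sum_(j < q) b ^+ 2)).
  by apply: ler_sum => i _; apply: ler_sum => j _; rewrite -(real_normK (num_real (M i j))) ler_sqr ?nnegrE.
rewrite !sumr_const !card_ord -mulrnA -(mulr_natl (b ^+ 2)) exprMn (mulnC q).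
by rewrite ler_wpM2r ?sqr_ge0 // expr2 ler_peMr // ler1n.
Qed.

Lemma closure_bounded A : bounded_set A -> exists2 b, 0 <= b & forall x, closure A x -> `|x| <= b.
Proof.
case=> B [_ hB]; exists (`|B| + 1); first by rewrite addr_ge0.
have c : closed [set x : V | `|x| <= `|B| + 1].
  apply: (@preimage_closed _ _ (fun x : V => `|x|) [set y | y <= `|B| + 1]); last exact: closed_le.
  by move=> x _; exact: norm_continuous.
have s : A `<=` [set x : V | `|x| <= `|B| + 1].
  by move=> x Ax; apply: hB => //; apply: le_lt_trans (ler_norm B) _; rewrite ltrDl.
by move=> x /(closureS s); move/closure_id: c => <-.
Qed.

Lemma closure_compact A : bounded_set A -> compact (closure A).
Proof.
move=> /closure_bounded[b b0 hb]; apply: bounded_closed_compact; last exact: closed_closure.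
by exists b; split => [|M bM x /hb h]; [exact: num_real|exact: le_trans h (ltW bM)].
Qed.

(** On the closure the limits [extend] agree with continuous functions, to which compactness
    arguments apply. *)
Lemma Ck_closure_ext A u : Ck_closure 2 A u ->
  exists (g1 : 'I_m -> V -> R) (g2 : 'I_m -> 'I_m -> V -> R),
  [/\ (forall i, {within closure A, continuous (g1 i)}),
      (forall i j, {within closure A, continuous (g2 i j)}) &
      (forall x, closure A x -> grad_ext A u x = \row_i g1 i x /\
         hess_ext A u x = \matrix_(i, j) g2 i j x) /\
      (forall x, A x -> grad_ext A u x = grad u x /\ hess_ext A u x = hess u x)].
Proof.
move=> [_ _ ext].
have /choice[g1 h1] : forall i, exists g, {within closure A, continuous g} /\
    forall x, A x -> g x = partial i u x.
  by move=> i; have [g cg hg] := ext [:: i] isT; exists g.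
have /choice[g2 h2] : forall ij : 'I_m * 'I_m, exists g, {within closure A, continuous g} /\
    forall x, A x -> g x = partial ij.1 (partial ij.2 u) x.
  by move=> [i j]; have [g cg hg] := ext [:: i; j] isT; exists g.
exists g1, (fun i j => g2 (i, j)).
have e1 i x : closure A x -> extend A (partial i u) x = g1 i x.
  by have [c e] := h1 i; exact: extendE.
have e2 i j x : closure A x -> extend A (partial i (partial j u)) x = g2 (i, j) x.
  by have [c e] := h2 (i, j); exact: extendE.
split; [by move=> i; have [] := h1 i|by move=> i j; have [] := h2 (i, j)|].
split=> x Ax.
  split; first by apply/rowP => i; rewrite !mxE e1.
  by apply/matrixP => i j; rewrite !mxE e2.
have cAx : closure A x by apply: subset_closure.
split; first by apply/rowP => i; rewrite !mxE e1 // (h1 i).2.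
by apply/matrixP => i j; rewrite !mxE e2 // (h2 (i, j)).2.
Qed.

Lemma norm_ext_bounds A u K : Ck_closure 2 A u -> compact K -> K `<=` closure A ->
  [/\ (forall x, K x -> `|u x| <= sup [set `|u y| | y in K]),
      (forall x, K x -> enorm (grad_ext A u x) <= sup [set enorm (grad_ext A u y) | y in K]) &
      (forall x, K x -> enorm (hess_ext A u x) <= sup [set enorm (hess_ext A u y) | y in K])].
Proof.
move=> cu cK KA; have [_ cu0 _] := cu.
have [g1 [g2 [c1 c2 [e _]]]] := Ck_closure_ext cu.
have wK g : {within closure A, continuous g} -> {within K, continuous g}.
  exact: continuous_subspaceW.
split.
- have [b b0 hb] := compact_abs_bounded cK (wK _ cu0).
  by move=> x Kx; apply: le_sup_image Kx => y; exact: hb.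
- have /choice[b hb] : forall i, exists b, 0 <= b /\ forall x, K x -> `|g1 i x| <= b.
    by move=> i; have [b b0 hb] := compact_abs_bounded cK (wK _ (c1 i)); exists b.
  move=> x Kx; apply: (le_sup_image (b := (1 * m)%:R * \sum_i b i)) Kx => y Ky.
  have [-> _] := e y (KA y Ky); apply: enorm_bound.
    by apply: sumr_ge0 => i _; have [] := hb i.
  move=> i0 i; rewrite mxE (bigD1 i) //=; apply: le_trans ((hb i).2 y Ky) _.
  by rewrite lerDl; apply: sumr_ge0 => j _; have [] := hb j.
- have /choice[b hb] : forall ij : 'I_m * 'I_m, exists b, 0 <= b /\ forall x, K x -> `|g2 ij.1 ij.2 x| <= b.
    by move=> [i j]; have [b b0 hb] := compact_abs_bounded cK (wK _ (c2 i j)); exists b.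
  move=> x Kx; apply: (le_sup_image (b := (m * m)%:R * \sum_ij b ij)) Kx => y Ky.
  have [_ ->] := e y (KA y Ky); apply: enorm_bound.
    by apply: sumr_ge0 => i _; have [] := hb i.
  move=> i j; rewrite mxE (bigD1 (i, j)) //=; apply: le_trans ((hb (i, j)).2 y Ky) _.
  by rewrite lerDl; apply: sumr_ge0 => ij _; have [] := hb ij.
Qed.

End Closure.

(** * Maximisation over points and directions *)

Section WeightedMaximum.
Variables (R : realType) (n : nat).
Local Notation V := 'rV[R]_n.
Implicit Types (A O : 'M[R]_n) (xi : V).

Lemma bf_diag A O xi : orth O -> (forall i j, i != j -> bf A (row i O) (row j O) = 0) ->
  bf A xi xi = \sum_a bf A (row a O) (row a O) * (\sum_j O a j * xi 0 j) ^+ 2.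
Proof.
move=> oO off; pose w := xi *m O^T.
have -> : bf A xi xi = bf (O *m A *m O^T) w w.
  have -> : bf (O *m A *m O^T) w w =
      (xi *m (O^T *m O) *m A *m (O^T *m O) *m xi^T) 0 0.
    by rewrite /bf /w trmx_mul trmxK !mulmxA.
  by rewrite orth_tr // !mulmx1.
have wE a : w 0 a = \sum_j O a j * xi 0 j.
  by rewrite mxE; apply: eq_bigr => j _; rewrite mxE mulrC.
rewrite bfE; apply: eq_bigr => a _; rewrite (bigD1 a) //= big1 => [|b ba].
  by rewrite conj_bf wE addr0; ring.
by rewrite conj_bf off 1?eq_sym // mulr0 mul0r.
Qed.

Lemma sqn_row O a : orth O -> sqn (row a O) = 1.
Proof.
move=> oO; rewrite /sqn -[RHS](orth_row_sqr oO a).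
by apply: eq_bigr => j _; rewrite mxE.
Qed.

Lemma sqn_frame O xi : orth O -> \sum_a (\sum_j O a j * xi 0 j) ^+ 2 = sqn xi.
Proof.
move=> oO; transitivity (\sum_j xi 0 j * xi 0 j).
  by rewrite -(sum_orth _ _ oO); apply: eq_bigr => a _; exact: expr2.
by apply: eq_bigr => j _; rewrite expr2.
Qed.

(** The quadratic form at a unit vector is a convex combination of the eigenvalues, so a maximising
    vector can be exchanged for a frame vector. *)
Lemma maximal_direction A xi0 : (0 < n)%N -> A^T = A -> sqn xi0 = 1 ->
  exists O i, [/\ orth O, forall a b, a != b -> bf A (row a O) (row b O) = 0,
    forall a, bf A (row a O) (row a O) <= bf A (row i O) (row i O) &
    bf A xi0 xi0 <= bf A (row i O) (row i O)].
Proof.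
move=> n0 sA xi1; have [Q [oQ off _]] := diagonalizing_frame (fun=> 0) sA.
pose i0 : 'I_n := Ordinal n0.
pose k a := bf A (row a Q) (row a Q).
have [i _ imax] := @arg_maxP _ _ _ i0 xpredT k isT.
exists Q, i; split => // [a|]; first exact: imax.
rewrite (bf_diag xi0 oQ off).
apply: (@le_trans _ _ (\sum_a k i * (\sum_j Q a j * xi0 0 j) ^+ 2)).
  by apply: ler_sum => a _; rewrite ler_wpM2r ?sqr_ge0 //; exact: imax.
by rewrite -mulr_sumr sqn_frame // xi1 mulr1.
Qed.

(** A nonnegative trace turns the upper bound into a lower one: each eigenvalue is at least minus
    the sum of the others. *)
Lemma enorm_le_of_upper A (L : R) : (0 < n)%N -> A^T = A -> (forall xi, sqn xi = 1 -> bf A xi xi <= L) ->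
  0 <= \tr A -> enorm A <= (n * n)%:R * (n%:R * (n%:R * L)).
Proof.
move=> n0 sA hL trA; have [Q [oQ off _]] := diagonalizing_frame (fun=> 0) sA.
pose k a := bf A (row a Q) (row a Q).
have kL a : k a <= L by apply: hL; exact: sqn_row.
have sk : 0 <= \sum_a k a.
  have -> : \sum_a k a = \tr (Q *m A *m Q^T) by apply: eq_bigr => a _; rewrite conj_bf.
  by rewrite mxtrace_mulC mulmxA orth_tr // mul1mx.
have L0 : 0 <= L.
  have : 0 <= \sum_(a < n) L by apply: le_trans sk _; exact: ler_sum.
  by rewrite sumr_const card_ord -mulr_natl pmulr_rge0 // ltr0n.
have kabs a : `|k a| <= n%:R * L.
  rewrite ler_norml; apply/andP; split; last by apply: le_trans (kL a) _; rewrite ler_peMl // ler1n.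
  have : \sum_(b | b != a) k b <= n%:R * L.
    apply: (@le_trans _ _ (\sum_(b | b != a) L)); first by apply: ler_sum.
    rewrite mulr_natl -[in leRHS](card_ord n) -sumr_const [leRHS](bigD1 a) //=.
    by rewrite lerDr.
  by move: sk; rewrite (bigD1 a) //=; lra.
have O1 a j : `|Q a j| <= 1.
  rewrite -ler_sqr ?nnegrE // expr1n real_normK ?num_real // -(orth_row_sqr oQ a).
  by rewrite (bigD1 j) //= lerDl; apply: sumr_ge0 => l _; exact: sqr_ge0.
apply: enorm_bound; first by rewrite !mulr_ge0.
move=> i j; have -> : A i j = \sum_a Q a i * k a * Q a j.
  have -> : A = Q^T *m (Q *m A *m Q^T) *m Q.
    by rewrite !mulmxA orth_tr // mul1mx -mulmxA orth_tr // mulmx1.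
  rewrite mxE; apply: eq_bigr => a _; congr (_ * _).
  rewrite mxE (bigD1 a) //= big1 => [|b ba]; last by rewrite conj_bf off ?mulr0.
  by rewrite conj_bf mxE addr0.
apply: le_trans (ler_norm_sum _ _ _) _.
apply: (@le_trans _ _ (\sum_(a < n) n%:R * L)); last by rewrite sumr_const card_ord -[leLHS]mulr_natl.
apply: ler_sum => a _; rewrite !normrM -[leRHS]mulr1.
apply: ler_pM => //; rewrite ?mulr_ge0 // -[leRHS]mul1r.
exact: ler_pM.
Qed.

Definition sphere : set V := [set xi | sqn xi = 1].

Lemma sphere_compact : compact sphere.
Proof.
apply: bounded_closed_compact.
  exists 1; split => // M M1 xi xi1; apply: le_trans (ltW M1).
  by apply: norm_sqn => //; rewrite expr1n xi1.
apply: (@preimage_closed _ _ (@sqn R n) [set 1]); last exact: closed_eq.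
move=> v _; apply: continuous_sum_fin => i _.
have c := @coord_continuous R 1 n 0 i v.
exact: (continuousM c c).
Qed.

(** A maximum over the compact product of closure and sphere lies either over the boundary, where
    the boundary supremum controls it, or inside. Multiplying out by the weights keeps the second
    alternative free of quotients. *)
Lemma weighted_max (Omega : set V) (phi v : V -> R) (m K : R) :
  (0 < n)%N -> Omega !=set0 -> bounded_set Omega -> Ck_closure 2 Omega phi ->
  {within closure Omega, continuous v} -> 0 < m ->
  (forall x, closure Omega x -> m <= v x <= K) ->
  let Bd := sup [set enorm (hess_ext Omega phi x) | x in closure Omega `\` Omega] in
  (forall x xi, Omega x -> sqn xi = 1 -> bf (hess phi x) xi xi <= K / m * (n%:R * Bd)) \/
  (exists x0 xi0, [/\ Omega x0, sqn xi0 = 1 & forall x xi, Omega x -> sqn xi = 1 ->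
    bf (hess phi x) xi xi * v x0 <= bf (hess phi x0) xi0 xi0 * v x]).
Proof.
move=> n0 [x1 Ox1] bO cphi cv m0 mv Bd.
have [g1 [g2 [_ c2 [ge gO]]]] := Ck_closure_ext cphi.
pose H x : 'M[R]_n := \matrix_(i, j) g2 i j x.
have HO x : Omega x -> H x = hess phi x.
  by move=> Ox; have [_ <-] := gO x Ox; have [_ ->] := ge x (subset_closure Ox).
have v0 x : closure Omega x -> 0 < v x.
  by move=> Ox; have /andP[h _] := mv x Ox; exact: lt_le_trans h.
pose P := closure Omega `*` sphere.
pose Phi (q : V * V) := bf (H q.1) q.2 q.2 / v q.1.
have cP : compact P by apply: compact_setX (closure_compact bO) sphere_compact.
have P0 : P !=set0.
  exists (x1, delta_mx 0 (Ordinal n0)); split; first exact: subset_closure.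
  rewrite /sphere /= /sqn (bigD1 (Ordinal n0)) //= big1 => [|j ji].
    by rewrite mxE !eqxx expr1n addr0.
  by rewrite mxE (negPf ji) andbF expr0n.
have cPhi : {within P, continuous Phi}.
  apply/subspace_continuousP => -[x xi] [/= cx sx].
  have fst_cvg : fst @ within P (nbhs (x, xi)) --> within (closure Omega) (nbhs x).
    move=> B hB; rewrite /within /= nbhs_simpl /=.
    have : \forall q \near (x, xi), closure Omega q.1 -> B q.1.
      by apply: (@cvg_fst _ _ (nbhs x) (nbhs xi) _ _ hB).
    by apply: filterS => q hq [hq1 _]; exact: hq.
  have cg (g : V -> R) : {within closure Omega, continuous g} ->
      (fun q : V * V => g q.1) @ within P (nbhs (x, xi)) --> g x.
    move=> cg0; have h : g @ within (closure Omega) (nbhs x) --> g x.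
      by move/subspace_continuousP : cg0; apply.
    exact: (cvg_comp _ _ fst_cvg h).
  have cc j : (fun q : V * V => q.2 0 j) @ within P (nbhs (x, xi)) --> xi 0 j.
    have h : (fun q : V * V => q.2 0 j) @ nbhs (x, xi) --> xi 0 j.
      apply: (@cvg_comp _ _ _ snd (fun w : V => w 0 j) _ (nbhs xi)); first exact: cvg_snd.
      exact: coord_continuous.
    by apply: cvg_trans h; apply: cvg_app; exact: cvg_within.
  rewrite /Phi /=; apply: cvgM; last first.
    by apply: cvgV; [rewrite gt_eqF // v0|exact: cg].
  under eq_fun do rewrite bfE; rewrite bfE.
  apply: cvg_sum_fin => i _; apply: cvg_sum_fin => j _.
  apply: cvgM; last exact: cc.
  apply: cvgM; first exact: cc.
  by under eq_fun do rewrite mxE; rewrite mxE; exact: cg.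
have [[x0 xi0]] := compact_EVT_max P0 cP cPhi.
rewrite inE => -[/= cx0 sx0] hmax.
have hm x xi : Omega x -> sqn xi = 1 -> bf (hess phi x) xi xi * v x0 <= bf (H x0) xi0 xi0 * v x.
  move=> Ox sxi; have cx : closure Omega x by apply: subset_closure.
  have := hmax (x, xi); rewrite inE => /(_ (conj cx sxi)).
  by rewrite /Phi /= HO // ler_pdivrMr ?v0 // mulrAC ler_pdivlMr ?v0.
have [Ox0|Ox0] := pselect (Omega x0).
  by right; exists x0, xi0; split => //; rewrite -(HO _ Ox0).
left=> x xi Ox sxi; have cx : closure Omega x by apply: subset_closure.
have h := hm x xi Ox sxi.
have Bx : enorm (hess_ext Omega phi x0) <= Bd.
  have [_ _ hb] := norm_ext_bounds cphi (closure_compact bO) (@subset_refl _ _).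
  apply: (@le_sup_image R V (closure Omega `\` Omega) (fun y => enorm (hess_ext Omega phi y)) _ x0).
    by move=> y [cy _]; exact: hb cy.
  by split.
have [_ hE] := ge x0 cx0; rewrite hE -/(H x0) in Bx.
have Bd0 : 0 <= Bd by apply: sup_image_ge0 => y; exact: enorm_ge0.
have q : bf (H x0) xi0 xi0 <= n%:R * Bd.
  have := quad_form_le (H x0) (xi0 0); rewrite -/(sqn xi0) sx0 mulr1 => hq.
  apply: le_trans (_ : n%:R * enorm (H x0) <= _); last by rewrite ler_wpM2l.
  apply: le_trans hq; apply: le_trans (ler_norm _).
  rewrite bfE le_eqVlt; apply/orP; left; apply/eqP.
  by apply: eq_bigr => i _; apply: eq_bigr => j _; rewrite mulrAC.
have /andP[m1 k1] := mv x0 cx0; have /andP[m2 k2] := mv x cx.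
have nB : 0 <= n%:R * Bd by rewrite mulr_ge0.
rewrite -(ler_pM2r (v0 _ cx0)); apply: le_trans h _.
apply: (@le_trans _ _ (n%:R * Bd * K)).
  apply: (@le_trans _ _ (n%:R * Bd * v x)); first by rewrite ler_wpM2r // ltW // v0.
  by rewrite ler_wpM2l.
have -> : K / m * (n%:R * Bd) * v x0 = n%:R * Bd * K * (v x0 / m) by ring.
rewrite ler_peMr //; last by rewrite ler_pdivlMr // mul1r.
by rewrite mulr_ge0 // (le_trans (ltW m0)) // (le_trans m2).
Qed.

End WeightedMaximum.

(** * Compactness of the set of jets and positivity of the infimum of f *)

Section JetCompact.
Variables (R : realType) (n : nat).
Local Notation V := 'rV[R]_n.
Variables (Omega : set V) (f : V -> R -> V -> R) (M : R).
Hypotheses (bO : bounded_set Omega) (M0 : 0 <= M).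
Local Notation K := (jet_cpt Omega M).

Lemma enorm_leE (v : V) (b : R) : 0 <= b -> (enorm v <= b) = (sqn v <= b ^+ 2).
Proof. by move=> b0; rewrite -ler_sqr ?nnegrE ?enorm_ge0 // enorm_row_sqr. Qed.

Lemma jet_cpt_compact : compact K.
Proof.
have [b b0 hb] := closure_bounded bO.
apply: bounded_closed_compact.
  exists (b + M); split; first exact: num_real.
  move=> B hB y [/= hx hz hp]; apply: le_trans (ltW hB).
  apply: norm_rV_le; first by rewrite addr_ge0.
  move=> s; case: (split_ordP s) => [i|s'] ->.
    have -> : y 0 (lshift (1 + n) i) = jx y 0 i by rewrite mxE.
    by apply: le_trans (coord_le_norm _ _) _; apply: le_trans (hb _ hx) _; rewrite lerDl.
  case: (split_ordP s') => [i|i] ->.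
    have -> : y 0 (rshift n (lshift n i)) = jz y by rewrite /jz !mxE ord1.
    by apply: le_trans hz _; rewrite lerDr.
  have -> : y 0 (rshift n (rshift 1 i)) = jp y 0 i by rewrite !mxE.
  by apply: le_trans (enorm_coord _ _ _) _; apply: le_trans hp _; rewrite lerDr.
have -> : K = jet_dom (closure Omega) `&`
    ((fun y : 'rV[R]_(n + (1 + n)) => `|y 0 (rshift n (lshift n 0))|) @^-1` [set t | t <= M] `&`
     (fun y : 'rV[R]_(n + (1 + n)) => sqn (jp y)) @^-1` [set t | t <= M ^+ 2]).
  have zE y : `|@jz R n y| = `|y 0 (rshift n (lshift n 0))| by rewrite /jz !mxE.
  apply/seteqP; split => y /=; rewrite -zE.
    by case=> hx hz; rewrite enorm_leE // => hp; split.
  by case=> hx [hz hp]; split; rewrite // enorm_leE.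
apply: closedI.
  rewrite -openC; have -> : ~` jet_dom (closure Omega) = jet_dom (~` closure Omega) by [].
  by apply: jet_dom_open; rewrite openC; exact: closed_closure.
have cc s : continuous (fun y : 'rV[R]_(n + (1 + n)) => y 0 s) by exact: coord_continuous.
apply: closedI; apply: preimage_closed; try exact: closed_le.
  by move=> y _; apply: continuous_comp (cc _ y) (@norm_continuous _ _ _).
have -> : (fun y : 'rV[R]_(n + (1 + n)) => sqn (jp y)) =
   fun y => \sum_(i < n) (y 0 (rshift n (rshift 1 i)) * y 0 (rshift n (rshift 1 i))).
  by apply/funext => y; apply: eq_bigr => i _; rewrite /jp !mxE expr2.
move=> y _; apply: continuous_sum_fin => i _.
exact: continuousM (cc _ y) (cc _ y).
Qed.

Lemma jet_cpt_sub : K `<=` closure (jet_dom Omega).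
Proof.
move=> y [/= hx _ _] B hB.
have [e /= e0 he] := (@nbhs_ballP _ _ y _).1 hB.
have [x' [Ox' xx']] := hx _ (@nbhsx_ballx _ _ (jx y) e e0).
exists (row_mx x' (rsubmx y)); split; first by rewrite /jet_dom /= /jx row_mxKl.
apply: he; move: xx'; rewrite -!ball_normE /=; apply: le_lt_trans.
apply: norm_rV_le => // s; case: (split_ordP s) => [i|i] ->.
  rewrite !mxE; have := coord_le_norm (jx y - x') i; rewrite /jx !mxE.
  by rewrite (unsplitK (inl i)).
by rewrite !mxE (unsplitK (inr i)) !mxE subrr normr0.
Qed.

Lemma inf_jet_gt0 : (forall x z p, closure Omega x -> 0 < f x z p) ->
  Ck_closure 2 (jet_dom Omega) (jfun f) -> K !=set0 ->
  0 < inf [set jfun f y | y in K] /\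
  forall y, K y -> inf [set jfun f y | y in K] <= jfun f y.
Proof.
move=> fpos [_ cf _] K0.
have cK : {within K, continuous (jfun f)} by apply: continuous_subspaceW cf; exact: jet_cpt_sub.
have [c] := compact_EVT_min K0 jet_cpt_compact cK; rewrite inE => Kc hc.
have f0 : 0 < jfun f c by apply: fpos; have [] := Kc.
have lb : lbound [set jfun f y | y in K] (jfun f c).
  by move=> _ [y Ky <-]; apply: hc; rewrite inE.
have E0 : [set jfun f y | y in K] !=set0 by have [y Ky] := K0; exists (jfun f y); exists y.
split; first by apply: lt_le_trans f0 _; exact: lb_le_inf.
by move=> y Ky; apply: ge_inf; [exists (jfun f c)|exists y].
Qed.

End JetCompact.

(** * The interior estimate *)

Section Supporting.
Variables (R : realType) (n k : nat).
Local Notation V := 'rV[R]_n.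
Local Notation full := [set: 'I_n]%SET.
Implicit Types (O A : 'M[R]_n).

Lemma bf_scalar (c : R) O a b : orth O -> bf c%:M (row a O) (row b O) = c * (a == b)%:R.
Proof.
move=> /orthP oO; rewrite -oO /bf mul_mx_scalar mulmx1 -scalemxAl mxE.
by [].
Qed.

Lemma bf_eta (phi : V -> R) O x a b : orth O -> bf (eta phi x) (row a O) (row b O) =
  (\sum_c bf (hess phi x) (row c O) (row c O)) * (a == b)%:R
  - bf (hess phi x) (row a O) (row b O).
Proof.
move=> oO; rewrite /eta {1}/bf mulmxBr mulmxBl mxE -/(bf _ _ _) [X in _ + X]mxE -/(bf _ _ _).
rewrite bf_scalar //; congr (_ * _ - _).
transitivity (\tr (O *m hess phi x *m O^T)).
  rewrite mxtrace_mulC mulmxA orth_tr // mul1mx.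
  by apply: eq_bigr => i _; rewrite mxE.
by apply: eq_bigr => c _; rewrite conj_bf.
Qed.

Lemma eta_sym (phi : V -> R) x : (hess phi x)^T = hess phi x -> (eta phi x)^T = eta phi x.
Proof. by move=> h; rewrite /eta linearB /= h tr_scalar_mx. Qed.

Lemma sum_hess_coef (e u : 'I_n -> R) :
  \sum_i sigma_grad k e i * (\sum_b u b - u i) = \sum_b hess_coef k e b * u b.
Proof.
rewrite /hess_coef; under [RHS]eq_bigr do rewrite mulr_suml.
rewrite (exchange_big_dep xpredT) //=; apply: eq_bigr => i _.
rewrite (bigD1 i) //= addrAC subrr add0r mulr_sumr; apply: eq_bigl => b.
by rewrite eq_sym.
Qed.

(** Homogeneity of degree [k.+1]: the constant in [hess_supporting] is the value of the linear
    functional at x0 itself. *)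
Lemma sum_hess_coef_kap (kap : 'I_n -> R) : gam k.+1 (eta_of kap) full ->
  \sum_b hess_coef k (eta_of kap) b * kap b = k.+1%:R.
Proof.
move=> ge; rewrite -sum_hess_coef; have := es_euler (eta_of kap) full k.
have e0 := lt0r_neq0 (ge _ (leqnn _)).
move=> /(congr1 (fun t => t / es (eta_of kap) full k.+1)); rewrite mulfK // => <-.
rewrite mulr_suml; apply: eq_big => [i|i _]; first by rewrite finset.in_setT.
by rewrite /sigma_grad mulrC mulrA.
Qed.

Lemma hess_supporting (phi : V -> R) O x (e : 'I_n -> R) : orth O ->
  (hess phi x)^T = hess phi x -> gam k.+1 e full ->
  Gamma k.+1 (eigenvalues (eta phi x)) ->
  k.+1%:R + 1 - es e full k.+1 / sigma k.+1 (eigenvalues (eta phi x)) <=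
  \sum_b hess_coef k e b * bf (hess phi x) (row b O) (row b O).
Proof.
move=> oO sH ge GE.
pose E := O *m eta phi x *m O^T.
have sE : E^T = E by rewrite /E !trmx_mul trmxK eta_sym // mulmxA.
have eE : eigenvalues E = eigenvalues (eta phi x) by exact: eigenvalues_orth.
have := @matrix_garding R n k E e sE ge; rewrite eE => /(_ GE) h.
apply: le_trans h _; rewrite -sum_hess_coef le_eqVlt; apply/orP; left; apply/eqP.
by apply: eq_bigr => i _; rewrite /E conj_bf bf_eta // eqxx mulr1.
Qed.

End Supporting.

Section InteriorEstimate.
Variables (R : realType) (n : nat).
Local Notation V := 'rV[R]_n.
Local Notation full := [set: 'I_n]%SET.

Lemma three_sum_le (a b c d : R) : 0 <= a -> 0 <= b -> 0 <= c -> a + b + c <= d ->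
  [/\ a <= d, b <= d & c <= d].
Proof. by move=> a0 b0 c0 h; split; lra. Qed.

(** Maximality of u / v with v = K - w - s becomes maximality of a sum linear in u, w, s, with
    multiplier mu = k / v. *)
Lemma quotient_max (u k v K w s w0 s0 : R) : 0 < v -> v = K - w0 - s0 ->
  u * v <= k * (K - w - s) -> u + k / v * (w + s) <= k + k / v * (w0 + s0).
Proof.
move=> v0 vE; rewrite -ler_pdivlMr // => h.
have e : k = k / v * (K - w0 - s0) by rewrite -vE divfK // gt_eqF.
have e2 : k * (K - w - s) / v = k / v * (K - w - s) by ring.
rewrite e2 in h; rewrite [X in _ <= X + _]e; move: (k / v) h => m h; lra.
Qed.

Definition dirD2 (phi : V -> R) (O : 'M[R]_n) (b : 'I_n) (x : V) : R :=
  bf (hess phi x) (row b O) (row b O).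
Definition dirD (phi : V -> R) (O : 'M[R]_n) (x : V) (a : 'I_n) : R :=
  \sum_j O a j * partial j phi x.
Definition dirX (O : 'M[R]_n) (x : V) (a : 'I_n) : R := \sum_j O a j * x 0 j.

(** The functions enter the estimates only through the numbers [M], [c0], [F], [D], so the final
    bound can be chosen before [phi] and [f]. *)
Record interior_point (k : nat) (M c0 F D : R) (Omega : set V) (phi : V -> R)
    (f : V -> R -> V -> R) (x0 : V) (O : 'M[R]_n) (i : 'I_n) : Prop := InteriorPoint {
  ip_open : open Omega;
  ip_phi : Ck 4 Omega phi;
  ip_f : Ck 2 (jet_dom Omega) (jfun f);
  ip_pos : forall x, Omega x -> 0 < jfun f (jet_at phi x);
  ip_convex : eta_convex k.+1 Omega phi;
  ip_eq : forall x, Omega x ->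
    sigma k.+1 (eigenvalues (eta phi x)) = jfun f (jet_at phi x);
  ip_x0 : Omega x0;
  ip_orth : orth O;
  ip_diag : forall a b, a != b -> bf (hess phi x0) (row a O) (row b O) = 0;
  ip_max : forall a, dirD2 phi O a x0 <= dirD2 phi O i x0;
  ip_grad : enorm (grad phi x0) <= M;
  ip_c0 : c0 <= jfun f (jet_at phi x0);
  ip_F0 : jfun f (jet_at phi x0) <= F;
  ip_F1 : enorm (grad (jfun f) (jet_at phi x0)) <= F;
  ip_F2 : enorm (hess (jfun f) (jet_at phi x0)) <= F;
  ip_D : sqn x0 <= D }.

Lemma gather_jets k M c0 F D Omega phi f x0 O i :
  0 <= F -> interior_point k M c0 F D Omega phi f x0 O i ->
  exists J : local_jets (dirD2 phi O) (half_grad phi) (@half_sqr R n)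
      (fun x => jfun f (jet_at phi x)) (fun a => row a O) x0
      (fun a => dirD2 phi O a x0) (dirD phi O x0) (dirX O x0),
  [/\ `|fz J| <= F, \sum_a fx J a ^+ 2 <= F ^+ 2, \sum_a fp J a ^+ 2 <= F ^+ 2,
     (forall a, `|fx J a| <= F /\ `|fp J a| <= F) &
     forall a, `|fq J a| <= (n + (1 + n))%:R * F *
        (1 + dirD phi O x0 a ^+ 2 + dirD2 phi O a x0 ^+ 2)].
Proof.
move=> F0 [oOm c4 cf _ _ _ Ox0 oO off _ _ _ _ hF1 hF2 _].
pose J : local_jets (dirD2 phi O) (half_grad phi) (@half_sqr R n)
      (fun x => jfun f (jet_at phi x)) (fun a => row a O) x0
      (fun a => dirD2 phi O a x0) (dirD phi O x0) (dirX O x0) :=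
  LocalJets (d4C O oOm c4 Ox0) (jet2_hess O oOm c4 Ox0)
    (jet2_half_grad oOm c4 Ox0 oO off) (jet2_half_sqr x0 oO)
    (jet2_f oOm c4 Ox0 oO off cf).
have hg := fgradE phi x0 oO f.
have g2 : enorm (grad (jfun f) (jet_at phi x0)) ^+ 2 <= F ^+ 2.
  by rewrite ler_sqr ?nnegrE ?enorm_ge0.
rewrite -hg in g2; exists J.
have x2 : 0 <= \sum_a fx J a ^+ 2 by apply: sumr_ge0 => a _; exact: sqr_ge0.
have p2 : 0 <= \sum_a fp J a ^+ 2 by apply: sumr_ge0 => a _; exact: sqr_ge0.
have hs : \sum_a fx J a ^+ 2 + fz J ^+ 2 + \sum_a fp J a ^+ 2 <= F ^+ 2 by exact: g2.
have z2 := sqr_ge0 (fz J).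
have [sx sz sp] := three_sum_le x2 z2 p2 hs.
have small (t : R) : t ^+ 2 <= F ^+ 2 -> `|t| <= F.
  by move=> h; rewrite -ler_sqr ?nnegrE // real_normK ?num_real.
have one (u : 'I_n -> R) a : \sum_b u b ^+ 2 <= F ^+ 2 -> `|u a| <= F.
  move=> h; apply: small; apply: le_trans h; rewrite (bigD1 a) //= lerDl.
  by apply: sumr_ge0 => b _; exact: sqr_ge0.
split; [exact: small sz|exact: sx|exact: sp|move=> a; exact: (conj (one _ a sx) (one _ a sp))|].
move=> a; apply: le_trans (fquad_le phi x0 oO f a) _.
rewrite ler_wpM2r ?addr_ge0 ?sqr_ge0 // ler_wpM2l //.
Qed.

Lemma interior_gam k M c0 F D Omega phi f x0 O i :
  interior_point k M c0 F D Omega phi f x0 O i ->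
  gam k.+1 (eta_of (fun a => dirD2 phi O a x0)) full /\
  es (eta_of (fun a => dirD2 phi O a x0)) full k.+1 = jfun f (jet_at phi x0).
Proof.
move=> [oOm c4 _ _ conv eqn Ox0 oO off _ _ _ _ _ _ _].
have offE a b : a != b -> bf (eta phi x0) (row a O) (row b O) = 0.
  by move=> ab; rewrite bf_eta // off // (negPf ab) mulr0 subr0.
have E : (fun a => bf (eta phi x0) (row a O) (row a O)) = eta_of (fun a => dirD2 phi O a x0).
  by apply/funext => a; rewrite bf_eta // eqxx mulr1.
rewrite -E; split; first exact: Gamma_gam oO offE (conv _ Ox0).
by rewrite -(sigma_eigenvalues k.+1 oO offE) eqn.
Qed.

Lemma interior_supporting k M c0 F D Omega phi f x0 O i x (e : 'I_n -> R) :
  interior_point k M c0 F D Omega phi f x0 O i -> Omega x -> gam k.+1 e full ->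
  k.+1%:R + 1 - es e full k.+1 / jfun f (jet_at phi x) <=
  \sum_b hess_coef k e b * dirD2 phi O b x.
Proof.
move=> [oOm c4 _ _ conv eqn Ox0 oO off _ _ _ _ _ _ _] Ox ge.
rewrite -eqn //; apply: hess_supporting => //; last exact: conv.
exact: (hess_sym oOm c4 Ox).
Qed.

Lemma interior_radius k M c0 F D Omega phi f x0 O i :
  interior_point k M c0 F D Omega phi f x0 O i ->
  exists2 r, 0 < r & forall a (t : R), `|t| < r -> Omega (x0 + t *: row a O).
Proof.
move=> [oOm _ _ _ _ _ Ox0 oO _ _ _ _ _ _ _ _].
have nO : nbhs x0 Omega by apply: open_nbhs_nbhs.
have [r /= r0 hr] := (@nbhs_ballP _ _ x0 _).1 nO.
exists r => // a t tr; apply: hr; rewrite -ball_normE /= opprD addrA subrr add0r normrN.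
rewrite normrZ; apply: le_lt_trans tr; rewrite ler_piMr //.
by apply: norm_sqn => //; rewrite expr1n sqn_row.
Qed.

Lemma dirD_le k M c0 F D Omega phi f x0 O i : 0 <= M ->
  interior_point k M c0 F D Omega phi f x0 O i ->
  \sum_a dirD phi O x0 a ^+ 2 <= M ^+ 2 /\ forall a, `|dirD phi O x0 a| <= M.
Proof.
move=> M0 [_ _ _ _ _ _ _ oO _ _ hM _ _ _ _ _].
have h : \sum_a dirD phi O x0 a ^+ 2 <= M ^+ 2.
  apply: (@le_trans _ _ (enorm (grad phi x0) ^+ 2)); last by rewrite ler_sqr ?nnegrE ?enorm_ge0.
  rewrite (half_gradE phi x0 oO) /half_grad mulrA divff // mul1r enorm_row_sqr.
  by rewrite le_eqVlt; apply/orP; left; apply/eqP; apply: eq_bigr => j _; rewrite mxE.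
split=> // a; rewrite -ler_sqr ?nnegrE // real_normK ?num_real //.
apply: le_trans h; rewrite (bigD1 a) //= lerDl; apply: sumr_ge0 => b _; exact: sqr_ge0.
Qed.

Lemma interior_case1 k (M c0 F D K : R) : (2 <= n)%N -> (k < n)%N ->
  ~ (n = 2 /\ k = 1)%N -> 0 <= M -> 0 < c0 -> 0 <= F -> 0 <= D -> 0 <= K ->
  exists B, forall Omega phi f x0 O i (v : V -> R),
  interior_point k M c0 F D Omega phi f x0 O i ->
  (forall x, Omega x -> v x = K - half_grad phi x - half_sqr x) ->
  0 < v x0 -> v x0 <= K ->
  (forall x, Omega x -> dirD2 phi O i x * v x0 <= dirD2 phi O i x0 * v x) ->
  dirD2 phi O i x0 <= B.
Proof.
move=> n2 kn nk M0 c00 F0 D0 K0.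
pose N : R := (n + (1 + n))%:R.
pose C := 2 * quad_const M c0 F N * K + lin_const M c0 F D.
have N0 : 0 <= N by [].
have C0 : 0 <= C.
  by rewrite /C addr_ge0 ?lin_const_ge0 // !mulr_ge0 ?quad_const_ge0.
have t1 : 1 <= 1 + F by rewrite lerDl.
have [B hB] := kappa_bound n2 kn nk C0 t1.
exists (1 + `|B|) => Omega phi f x0 O i v ip vE v0 vK maxU.
have [k1|k1] := ltP (dirD2 phi O i x0) 1.
  by apply: le_trans (ltW k1) _; rewrite lerDl.
have [J [hz hfx hfp hxp hq]] := gather_jets F0 ip.
have [ge esE] := interior_gam ip.
have [r r0 hr] := interior_radius ip.
have [hp hpa] := dirD_le M0 ip.
have Ox0 := ip_x0 ip; have g0 := ip_pos ip Ox0.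
have mu0 : 0 <= dirD2 phi O i x0 / v x0 by rewrite divr_ge0 ?(ltW v0) // (le_trans ler01).
have sk := sum_hess_coef_kap ge.
have supp a t : `|t| < r -> 0 < jfun f (jet_at phi (x0 + t *: row a O)) /\
    \sum_b hess_coef k (eta_of (fun a => dirD2 phi O a x0)) b * dirD2 phi O b x0 + 1
      - jfun f (jet_at phi x0) / jfun f (jet_at phi (x0 + t *: row a O)) <=
       \sum_b hess_coef k (eta_of (fun a => dirD2 phi O a x0)) b *
          dirD2 phi O b (x0 + t *: row a O).
  move=> tr; have Ox := hr a t tr; split; first exact: (ip_pos ip Ox).
  have h := interior_supporting ip Ox ge; rewrite esE in h.
  rewrite [X in X + 1 - _]sk.
  exact: h.
have maxmu a t : `|t| < r -> dirD2 phi O i (x0 + t *: row a O) +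
    dirD2 phi O i x0 / v x0 * (half_grad phi (x0 + t *: row a O) + half_sqr (x0 + t *: row a O)) <=
    dirD2 phi O i x0 + dirD2 phi O i x0 / v x0 * (half_grad phi x0 + half_sqr x0).
  move=> tr; have Ox := hr a t tr.
  have h := maxU _ Ox.
  have e := vE _ Ox.
  rewrite e in h.
  have q := quotient_max v0 (vE _ Ox0) h.
  exact: q.
have ineq := interior_ineq J r0 g0 mu0 (fun a => hess_coef_ge0 a ge) supp maxmu.
have [hfxi hfpi] := hxp i.
have hy : \sum_l dirX O x0 l ^+ 2 <= D.
  have := ip_D ip; rewrite (half_sqrE x0 (ip_orth ip)) /half_sqr mulrA divff // mul1r.
  by [].
have X := case1_bound M0 c00 F0 D0 N0 k1 (ip_c0 ip) hz hp hy hfx hfp (hpa i) hfxi hfpi (hq i)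
  (erefl _) v0 vK ineq.
apply: le_trans (_ : B <= _); last by apply: le_trans (ler_norm B) _; rewrite lerDr.
apply: (hB _ i ge _ (ip_max ip) X).
by rewrite esE; apply: le_trans (ip_F0 ip) _; rewrite lerDr.
Qed.

End InteriorEstimate.

(** * The case n = k = 2 *)

Section TwoDimensional.
Variables (R : realType) (n : nat).
Local Notation V := 'rV[R]_n.
Local Notation full := [set: 'I_n]%SET.

Lemma other_index (i : 'I_n) : n = 2%N -> exists2 j, i != j & forall l, l = i \/ l = j.
Proof.
move=> n2; have c : #|(full :\ i)%SET| = 1%N.
  have := cardsD1 i full; rewrite finset.in_setT cardsT card_ord.
  by move: #|_| => c e; apply/eqP; rewrite -eqSS -n2 e.
have /cards1P[j hj] : #|(full :\ i)%SET| == 1%N by rewrite c.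
have jm l : (l \in (full :\ i)%SET) = (l == j) by rewrite hj inE.
exists j; first by have := jm j; rewrite eqxx !inE eq_sym => /andP[].
move=> l; have := jm l; rewrite !inE andbT; case: eqP => [->|_] /=; first by left.
by move/esym/eqP; right.
Qed.

Section Pair.
Variables (i j : 'I_n) (e : 'I_n -> R).
Hypotheses (ij : i != j) (all : forall l, l = i \/ l = j).

Lemma eta_of_pair (kap : 'I_n -> R) : eta_of kap i = kap j /\ eta_of kap j = kap i.
Proof. by rewrite /eta_of (sum_pair _ ij all) addrAC subrr add0r addrK. Qed.

Lemma full_pairD1 : (full :\ i)%SET = [set j]%SET /\ (full :\ j)%SET = [set i]%SET.
Proof.
have ji : j != i by rewrite eq_sym.
split; apply/setP => l; rewrite !inE andbT.
  by case: (all l) => ->; rewrite ?eqxx // (negPf ij).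
by case: (all l) => ->; rewrite ?eqxx ?ij ?(negPf ji).
Qed.

Lemma es_set1 (T : finType) (x : T -> R) l : es x [set l]%SET 1 = x l.
Proof. by rewrite -(cards1 l) es_card big_set1. Qed.

Lemma es_pair1 : es e full 1 = e j + e i.
Proof.
have [ei ej] := full_pairD1.
by rewrite (es_D1 e 0 (finset.in_setT i)) ei es_set1 es0 mulr1.
Qed.

Lemma es_pair2 : es e full 2 = e i * e j.
Proof.
have [ei ej] := full_pairD1.
rewrite (es_D1 e 1 (finset.in_setT i)) ei es_set1 es_gt ?add0r //.
by rewrite cards1.
Qed.

Lemma gam_pair : 0 < e i -> 0 < e j -> gam 2 e full.
Proof.
move=> ei ej [|[|[|l]]] //; first by rewrite es0.
  by rewrite es_pair1 addr_gt0.
by rewrite es_pair2 mulr_gt0.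
Qed.

Lemma hess_coef_pair : e i != 0 -> e j != 0 ->
  hess_coef 1 e i = (e j)^-1 /\ hess_coef 1 e j = (e i)^-1.
Proof.
move=> ei0 ej0; have [ei ej] := full_pairD1.
have ji : j != i by rewrite eq_sym.
split; rewrite /hess_coef.
  rewrite (big_pred1 j) => [|l]; first by rewrite /sigma_grad ej es_set1 es_pair2; field; rewrite ?ei0 ?ej0.
  by rewrite /=; case: (all l) => ->; rewrite ?eqxx ?(negPf ij) ?ji.
rewrite (big_pred1 i) => [|l]; first by rewrite /sigma_grad ei es_set1 es_pair2; field; rewrite ?ei0 ?ej0.
by rewrite /=; case: (all l) => ->; rewrite ?eqxx ?(negPf ji) ?ij.
Qed.
End Pair.

(** As a b = G, the supporting inequality at the test point (a, b) reads 2 <= Ui / b + Uj / a, and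
    Ui <= b forces a <= Uj. Then exp(z) G / G0 >= 1 + z + ln(G / G0) bounds a below. *)
Lemma two_dim_min (G G0 ki kj z a b Ui Uj : R) : 0 < G -> 0 < G0 -> 0 < ki -> 0 < kj ->
  ki * kj = G0 -> b = ki * expR (- z) -> a = G / b -> Ui <= b ->
  3 - a * b / G <= Ui / b + Uj / a -> kj * (2 - G0 / G + z) <= Uj.
Proof.
move=> g g0 ki0 kj0 kk bE aE hU h.
have b0 : 0 < b by rewrite bE mulr_gt0 // expR_gt0.
have a0 : 0 < a by rewrite aE divr_gt0.
have h1 : Ui / b <= 1 by rewrite ler_pdivrMr // mul1r.
have h2 : a * b / G = 1 by rewrite aE divfK ?divff // gt_eqF.
have aU : a <= Uj by rewrite -[leLHS]mul1r -ler_pdivlMr //; rewrite h2 in h; lra.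
apply: le_trans aU.
have -> : a = kj * (G / G0 * expR z).
  rewrite aE bE expRN -kk; field; rewrite !gt_eqF // ?expR_gt0 //.
apply: ler_wpM2l; first exact: ltW.
have r0 : 0 < G / G0 by rewrite divr_gt0.
rewrite -[in leRHS](lnK (_ : G / G0 \is Num.pos)) ?posrE // -expRD.
apply: le_trans (expR_ge1Dx _).
have := ln_le_sub1 (divr_gt0 g0 g).
by rewrite -invf_div lnV ?posrE //; lra.
Qed.

(** Replaces the exponential weight by a quadratic polynomial, to which jets apply; 2 z^2 is the
    source of the beta^2 terms. *)
Lemma expRN_le (z : R) : - (1 / 2) <= z -> expR (- z) <= 1 - z + 2 * z ^+ 2.
Proof.
move=> hz; rewrite expRN; have z1 : 0 < 1 + z by lra.
apply: (@le_trans _ _ (1 + z)^-1).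
  by rewrite lef_pV2 ?posrE ?expR_gt0 // expR_ge1Dx.
rewrite -[leLHS]mul1r ler_pdivrMr //; nra.
Qed.

Lemma fin_radius (P : 'I_n -> R -> Prop) :
  (forall a, exists2 r, 0 < r & forall t, `|t| < r -> P a t) ->
  exists2 r, 0 < r & forall a t, `|t| < r -> P a t.
Proof.
move=> h; have /choice[r hr] : forall a, exists r, 0 < r /\ forall t, `|t| < r -> P a t.
  by move=> a; have [r r0 hr] := h a; exists r.
exists (\big[Num.min/1]_a r a); first by apply: lt_bigmin => // a _; have [] := hr a.
by move=> a t ta; apply: (hr a).2; apply: lt_le_trans ta (bigmin_le _ _ _).
Qed.

Lemma interior_case2 (M c0 F D : R) : n = 2%N -> 0 <= M -> 0 < c0 -> 0 <= F ->
  exists B beta, 0 <= beta /\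
    forall (Omega : set V) (phi : V -> R) f (x0 : V) (O : 'M[R]_n) (i : 'I_n),
  interior_point 1 M c0 F D Omega phi f x0 O i ->
  (forall x, Omega x -> dirD2 phi O i x * expR (- (beta * half_grad phi x0)) <=
     dirD2 phi O i x0 * expR (- (beta * half_grad phi x))) ->
  dirD2 phi O i x0 <= B.
Proof.
move=> n2 M0 c00 F0; pose N : R := (n + (1 + n))%:R; have N0 : 0 <= N by [].
pose beta := 4 * quad_const M c0 F N + 1.
have b0 : 0 <= beta by have := quad_const_ge0 M c00 F0 N0; rewrite /beta; lra.
pose B := beta * lin_const M c0 F 0 + 4 * beta ^+ 2 * (F * M ^+ 2).
exists (1 + `|B|), beta; split=> // Omega phi f x0 O i ip maxU.
have [k1|k1] := ltP (dirD2 phi O i x0) 1.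
  by apply: le_trans (ltW k1) _; rewrite lerDl.
have [J [hz hfx hfp hxp hq]] := gather_jets F0 ip.
have [ge esE] := interior_gam ip.
have [hp hpa] := dirD_le M0 ip.
have Ox0 := ip_x0 ip; have g0 := ip_pos ip Ox0.
have [j ij all] := other_index i n2.
have ki0 : 0 < dirD2 phi O i x0 := lt_le_trans ltr01 k1.
have kk : dirD2 phi O i x0 * dirD2 phi O j x0 = jfun f (jet_at phi x0).
  have [e1 e2] := eta_of_pair ij all (fun a => dirD2 phi O a x0).
  by rewrite -esE (es_pair2 _ ij all) e1 e2; exact: mulrC.
have kj0 : 0 < dirD2 phi O j x0 by rewrite -(pmulr_rgt0 _ ki0) kk.
have sup1 x : Omega x -> dirD2 phi O i x <=
    dirD2 phi O i x0 * expR (- (beta * (half_grad phi x - half_grad phi x0))).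
  move=> Ox; have h := maxU x Ox.
  rewrite -ler_pdivlMr ?expR_gt0 // in h; apply: le_trans h _.
  rewrite -mulrA -expRN -expRD opprK le_eqVlt; apply/orP; left; apply/eqP.
  by congr (_ * expR _); ring.
have minj x : Omega x -> dirD2 phi O j x0 * (2 - jfun f (jet_at phi x0) / jfun f (jet_at phi x)
     + beta * (half_grad phi x - half_grad phi x0)) <= dirD2 phi O j x.
  move=> Ox; have gx := ip_pos ip Ox.
  have hi := sup1 x Ox.
  have e0 := expR_gt0 (- (beta * (half_grad phi x - half_grad phi x0))).
  pose b := dirD2 phi O i x0 * expR (- (beta * (half_grad phi x - half_grad phi x0))).
  have bp : 0 < b by rewrite mulr_gt0.
  pose a := jfun f (jet_at phi x) / b.
  have ap : 0 < a by rewrite divr_gt0.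
  (* In two dimensions eta swaps the eigenvalues: the entry at [i] goes with the second derivative
     along [j]. Unlike in the general case, the test point varies with x. *)
  pose e l := if l == i then a else b.
  have ei : e i = a by rewrite /e eqxx.
  have ej : e j = b by rewrite /e eq_sym (negPf ij).
  have ge2 : gam 2 e full by apply: (gam_pair ij all); rewrite ?ei ?ej.
  have h := interior_supporting ip Ox ge2.
  have [c1 c2] : hess_coef 1 e i = (e j)^-1 /\ hess_coef 1 e j = (e i)^-1.
    by apply: (hess_coef_pair ij all); rewrite ?ei ?ej gt_eqF.
  rewrite (es_pair2 _ ij all) (sum_pair _ ij all) c1 c2 ei ej in h.
  apply: (two_dim_min (a := a) (b := b) gx g0 ki0 kj0 kk (erefl _) (erefl _) hi).
  move: h; rewrite (mulrC b^-1) (mulrC a^-1); apply: le_trans.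
  by rewrite lerD2r -natr1 lerD2r.
have [r0 r00 hr0] := interior_radius ip.
(* Near x0 the exponent stays above -1/2, as [expRN_le] requires. *)
have [r r_gt0 hr] : exists2 r, 0 < r & forall a (t : R), `|t| < r ->
    `|t| < r0 /\ - (1 / 2) <= beta * (half_grad phi (x0 + t *: row a O) - half_grad phi x0).
  apply: fin_radius => a.
  have jW : jet2 (fun t => half_grad phi (x0 + t *: row a O) - half_grad phi x0) 0
      (dirD2 phi O a x0 * dirD phi O x0 a)
      (dirD2 phi O a x0 ^+ 2 + \sum_l dirD phi O x0 l * T J l a).
    have h := jet2D (jetW J a) (jet2_cst (- half_grad phi x0)).
    rewrite subrr !addr0 in h; exact: h.
  have e1 : 0 < 1 / 2 / (beta + 1) by rewrite !divr_gt0 // ltr_wpDl.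
  have [d d0 hd] := jet2_small jW e1.
  exists (Num.min r0 d); first by rewrite lt_min r00.
  move=> t; rewrite lt_min => /andP[tr td]; split=> //.
  have := hd t td; move: (half_grad _ _ - _) => w hw.
  have h : `|beta * w| <= 1 / 2.
    rewrite normrM (ger0_norm b0); apply: (@le_trans _ _ ((beta + 1) * `|w|)).
      by rewrite ler_wpM2r // lerDl.
    by rewrite mulrC -ler_pdivlMr // ltr_wpDl.
  by move: h; rewrite ler_norml => /andP[].
have maxi a (t : R) : `|t| < r -> dirD2 phi O i (x0 + t *: row a O) <=
   dirD2 phi O i x0 * (1 - beta * (half_grad phi (x0 + t *: row a O) - half_grad phi x0) +
       2 * beta ^+ 2 * (half_grad phi (x0 + t *: row a O) - half_grad phi x0) ^+ 2).
  move=> tr; have [tr0 hw] := hr a t tr.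
  have h := sup1 _ (hr0 a t tr0); apply: le_trans h _.
  apply: ler_wpM2l; first exact: ltW.
  have h := expRN_le hw; apply: le_trans h _.
  by rewrite exprMn mulrA.
have minj' a (t : R) : `|t| < r -> 0 < jfun f (jet_at phi (x0 + t *: row a O)) /\
    dirD2 phi O j x0 * (2 - jfun f (jet_at phi x0) / jfun f (jet_at phi (x0 + t *: row a O))
     + beta * (half_grad phi (x0 + t *: row a O) - half_grad phi x0))
      <= dirD2 phi O j (x0 + t *: row a O).
  move=> tr; have [tr0 _] := hr a t tr; have Ox := hr0 a t tr0.
  exact: (conj (ip_pos ip Ox) (minj _ Ox)).
have ineq := interior_ineq2 J r_gt0 g0 ij all kk ki0 kj0 minj' maxi.
have [hfxi hfpi] := hxp i.
have X := case2_bound M0 c00 F0 N0 k1 (ip_c0 ip) (ip_F0 ip) hz hp hfx hfp (hpa i) (hpa j)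
  hfxi hfpi (hq i) kk ineq.
apply: le_trans (_ : B <= _); last by apply: le_trans (ler_norm B) _; rewrite lerDr.
exact: X.
Qed.

End TwoDimensional.

(** * The global estimate *)

Section Global.
Variables (R : realType) (n k : nat).
Local Notation V := 'rV[R]_n.
Local Notation full := [set: 'I_n]%SET.

Definition admissible (Omega : set V) (f : V -> R -> V -> R) (phi : V -> R) : Prop :=
  [/\ (forall x z p, closure Omega x -> 0 < f x z p),
      Ck_closure 2 (jet_dom Omega) (jfun f),
      Ck 4 Omega phi /\ Ck_closure 2 Omega phi,
      eta_convex k.+1 Omega phi &
      forall x, Omega x ->
         sigma k.+1 (eigenvalues (eta phi x)) = f x (phi x) (grad phi x)].

Variable Omega : set V.
Hypotheses (hn : (2 <= n)%N) (hk : (k < n)%N) (O0 : Omega !=set0) (oO : open Omega)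
  (bO : bounded_set Omega).

(** The trace of eta is sigma_1, positive in the cone, and equals n - 1 times the trace of the
    Hessian. *)
Lemma trace_hess_ge0 phi x : Ck 4 Omega phi -> eta_convex k.+1 Omega phi -> Omega x ->
  0 <= \tr (hess phi x).
Proof.
move=> c4 conv Ox; have sH := hess_sym oO c4 Ox.
have [Q [oQ off _]] := diagonalizing_frame (fun=> 0) sH.
have offE a b : a != b -> bf (eta phi x) (row a Q) (row b Q) = 0.
  by move=> ab; rewrite bf_eta // off // (negPf ab) mulr0 subr0.
have := Gamma_gam oQ offE (conv x Ox) (isT : (1 <= k.+1)%N).
have -> : (fun a => bf (eta phi x) (row a Q) (row a Q)) = eta_of (fun a => dirD2 phi Q a x).
  by apply/funext => a; rewrite bf_eta // eqxx mulr1.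
have -> : \tr (hess phi x) = \sum_a dirD2 phi Q a x.
  transitivity (\tr (Q *m hess phi x *m Q^T)); last by apply: eq_bigr => a _; rewrite conj_bf.
  by rewrite mxtrace_mulC mulmxA orth_tr // mul1mx.
have := es_euler (eta_of (fun a => dirD2 phi Q a x)) full 0; rewrite mul1r => <-.
under eq_bigr do rewrite es0 mulr1.
set u := (fun a => dirD2 phi Q a x); rewrite -[X in 0 <= X]/(\sum_a u a); move: u => u.
have -> : \sum_(i in full) eta_of u i = n.-1%:R * \sum_a u a.
  rewrite (eq_bigl xpredT) => [|i]; last by rewrite finset.in_setT.
  rewrite sumrB sumr_const card_ord; move: (\sum_i u i) => s.
  have nE : n%:R = n.-1%:R + 1 :> R by rewrite natr1 prednK // ltnW.
  by rewrite -[s *+ n]mulr_natl nE mulrDl mul1r addrK.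
have nn : 0 < n.-1%:R :> R by rewrite ltr0n -subn1 subn_gt0.
by rewrite (pmulr_rgt0 _ nn) => /ltW.
Qed.

(** Stated for a general weight [v], so that both weights share the passage from one eigenvalue to
    the Hessian norm. *)
Lemma hess_bound (phi v : V -> R) (m K B : R) :
  Ck 4 Omega phi -> Ck_closure 2 Omega phi -> eta_convex k.+1 Omega phi ->
  {within closure Omega, continuous v} -> 0 < m ->
  (forall x, closure Omega x -> m <= v x <= K) ->
  (forall x0 O i, Omega x0 -> orth O ->
     (forall a b, a != b -> bf (hess phi x0) (row a O) (row b O) = 0) ->
     (forall a, dirD2 phi O a x0 <= dirD2 phi O i x0) ->
     (forall x, Omega x -> dirD2 phi O i x * v x0 <= dirD2 phi O i x0 * v x) ->
     dirD2 phi O i x0 <= B) ->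
  let Bd := sup [set enorm (hess_ext Omega phi x) | x in closure Omega `\` Omega] in
  forall x, Omega x -> enorm (hess phi x) <=
    (n * n)%:R * (n%:R * (n%:R * (K / m * (`|B| + n%:R * Bd)))).
Proof.
move=> c4 cphi conv cv m0 mv hB Bd x Ox.
have n0 : (0 < n)%N := ltnW hn.
apply: (enorm_le_of_upper n0 (hess_sym oO c4 Ox)); last exact: trace_hess_ge0.
move=> xi sxi.
have Bd0 : 0 <= Bd by apply: sup_image_ge0 => y; exact: enorm_ge0.
have mK : m <= K by have /andP[h1 h2] := mv x (subset_closure Ox); exact: le_trans h2.
have Km : 0 <= K / m by rewrite divr_ge0 ?(ltW m0) // (le_trans (ltW m0)).
have nB : 0 <= n%:R * Bd by rewrite mulr_ge0.
have [h|[x0 [xi0 [Ox0 sxi0 hmax]]]] := weighted_max n0 O0 bO cphi cv m0 mv.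
  apply: le_trans (h x xi Ox sxi) _; rewrite -/Bd; apply: ler_wpM2l => //.
  by rewrite lerDr.
have [Q [i [oQ off imax hi]]] := maximal_direction n0 (hess_sym oO c4 Ox0) sxi0.
have v0 y : Omega y -> 0 < v y.
  by move=> Oy; have /andP[h _] := mv y (subset_closure Oy); exact: lt_le_trans h.
have kB : dirD2 phi Q i x0 <= B.
  apply: (hB x0 Q i Ox0 oQ off imax) => y Oy.
  apply: le_trans (hmax y (row i Q) Oy (sqn_row i oQ)) _.
  by apply: ler_wpM2r hi; exact: ltW (v0 y Oy).
have h1 : bf (hess phi x) xi xi * v x0 <= `|B| * K.
  apply: le_trans (hmax x xi Ox sxi) _.
  have /andP[_ vK] := mv x (subset_closure Ox).
  apply: (@le_trans _ _ (`|B| * v x)); last by rewrite ler_wpM2l.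
  apply: ler_wpM2r; first exact: ltW (v0 x Ox).
  exact: le_trans hi (le_trans kB (ler_norm B)).
have /andP[vm _] := mv x0 (subset_closure Ox0).
move: h1; move: (bf _ _ _) => b h1.
have [b0|b0] := ltP b 0.
  by apply: le_trans (ltW b0) _; rewrite mulr_ge0 // addr_ge0.
have h2 : b * m <= `|B| * K by apply: le_trans h1; rewrite ler_wpM2l.
rewrite -ler_pdivlMr // in h2; apply: le_trans h2 _.
have -> : `|B| * K / m = K / m * `|B| by ring.
by rewrite ler_wpM2l ?lerDl.
Qed.

Section Data.
Variables (f : V -> R -> V -> R) (phi : V -> R).
Hypothesis adm : admissible Omega f phi.
Let M := normC1 Omega (closure Omega) phi.
Let K := jet_cpt Omega M.
Let c0 := inf [set jfun f y | y in K].
Let F := normC2 (jet_dom Omega) K (jfun f).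

Lemma normC1_bounds : [/\ 0 <= M, (forall x, closure Omega x -> `|phi x| <= M),
   (forall x, closure Omega x -> enorm (grad_ext Omega phi x) <= M) &
   (forall x, Omega x -> grad_ext Omega phi x = grad phi x)].
Proof.
have [_ _ [_ cphi] _ _] := adm.
have [h1 h2 _] := norm_ext_bounds cphi (closure_compact bO) (@subset_refl _ _).
have s1 : 0 <= sup [set `|phi y| | y in closure Omega] by apply: sup_image_ge0.
have s2 : 0 <= sup [set enorm (grad_ext Omega phi y) | y in closure Omega].
  by apply: sup_image_ge0 => y; exact: enorm_ge0.
have [g1 [g2 [_ _ [_ gO]]]] := Ck_closure_ext cphi.
split.
- exact: addr_ge0.
- by move=> x /h1 h; apply: le_trans h _; rewrite /M /normC1 lerDl.
- by move=> x /h2 h; apply: le_trans h _; rewrite /M /normC1 lerDr.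
- by move=> x Ox; have [] := gO x Ox.
Qed.

Lemma jet_at_cpt x : Omega x -> K (jet_at phi x).
Proof.
have [M0 h1 h2 h3] := normC1_bounds; move=> Ox; have cx := subset_closure Ox.
split; rewrite /jx /jz /jp /jet_at ?row_mxKl ?row_mxKr ?row_mxKl //.
  by rewrite mxE eqxx mulr1n; exact: h1.
by rewrite -h3 //; exact: h2.
Qed.

Lemma normC2_bounds : [/\ 0 < c0, 0 <= F & forall x, Omega x ->
  [/\ c0 <= jfun f (jet_at phi x), jfun f (jet_at phi x) <= F,
      enorm (grad (jfun f) (jet_at phi x)) <= F &
      enorm (hess (jfun f) (jet_at phi x)) <= F]].
Proof.
have [M0 _ _ _] := normC1_bounds.
have [fpos cf _ _ _] := adm.
have K0 : K !=set0 by have [x Ox] := O0; exists (jet_at phi x); exact: jet_at_cpt.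
have [c0p hc0] := inf_jet_gt0 bO M0 fpos cf K0.
have [h1 h2 h3] := norm_ext_bounds cf (jet_cpt_compact bO M0) (@jet_cpt_sub _ _ Omega M).
have s1 : 0 <= sup [set `|jfun f y| | y in K] by apply: sup_image_ge0.
have s2 : 0 <= sup [set enorm (grad_ext (jet_dom Omega) (jfun f) y) | y in K].
  by apply: sup_image_ge0 => y; exact: enorm_ge0.
have s3 : 0 <= sup [set enorm (hess_ext (jet_dom Omega) (jfun f) y) | y in K].
  by apply: sup_image_ge0 => y; exact: enorm_ge0.
have [g1 [g2 [_ _ [_ gO]]]] := Ck_closure_ext cf.
split=> //; first by rewrite /F /normC2 /normC1 !addr_ge0.
move=> x Ox; have Kx := jet_at_cpt Ox.
have dx : jet_dom Omega (jet_at phi x) by rewrite /jet_dom /= /jx /jet_at row_mxKl.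
have [<- <-] := gO _ dx.
split; first exact: hc0.
- apply: le_trans (ler_norm _) _; apply: le_trans (h1 _ Kx) _.
  by rewrite /F /normC2 /normC1 -addrA lerDl addr_ge0.
- apply: le_trans (h2 _ Kx) _; rewrite /F /normC2 /normC1 addrAC.
  by rewrite lerDr addr_ge0.
- apply: le_trans (h3 _ Kx) _; rewrite /F /normC2 /normC1.
  by rewrite lerDr addr_ge0.
Qed.

Lemma admissible_interior (D : R) x0 O i :
  (forall x, closure Omega x -> sqn x <= D) -> Omega x0 -> orth O ->
  (forall a b, a != b -> bf (hess phi x0) (row a O) (row b O) = 0) ->
  (forall a, dirD2 phi O a x0 <= dirD2 phi O i x0) ->
  interior_point k M c0 F D Omega phi f x0 O i.
Proof.
move=> hD Ox0 oQ off imax.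
have [fpos [cf _ _] [c4 _] conv eqn] := adm.
have [M0 _ h2 h3] := normC1_bounds.
have [_ _ hx] := normC2_bounds; have [a1 a2 a3 a4] := hx x0 Ox0.
have pos x : Omega x -> 0 < jfun f (jet_at phi x).
  by move=> Ox; rewrite jfun_jet_at; apply: fpos; exact: subset_closure.
have eqj x : Omega x -> sigma k.+1 (eigenvalues (eta phi x)) = jfun f (jet_at phi x).
  by move=> Ox; rewrite jfun_jet_at; exact: eqn.
have cx0 := subset_closure Ox0.
have gM : enorm (grad phi x0) <= M by rewrite -(h3 x0 Ox0); exact: h2.
exact: (InteriorPoint oO c4 cf pos conv eqj Ox0 oQ off imax gM a1 a2 a3 a4 (hD x0 cx0)).
Qed.

(** The weight must be continuous up to the boundary, where [partial j phi] carries no information;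
    it is built from the extensions. *)
Lemma half_grad_ext : exists w : V -> R, [/\ {within closure Omega, continuous w},
  (forall x, Omega x -> w x = half_grad phi x) &
  forall x, closure Omega x -> 0 <= w x <= M ^+ 2 / 2].
Proof.
have [_ _ [_ cphi] _ _] := adm; have [M0 _ h2 _] := normC1_bounds.
have [g1 [g2 [c1 _ [ge gO]]]] := Ck_closure_ext cphi.
exists (fun x => 2^-1 * \sum_j g1 j x ^+ 2); split.
- apply/subspace_continuousP => x cx.
  apply: cvgM; first exact: cvg_cst.
  apply: cvg_sum_fin => j _.
  have h : g1 j @ within (closure Omega) (nbhs x) --> g1 j x.
    by have := c1 j; move/subspace_continuousP; apply.
  exact: (cvgM h h).
- move=> x Ox; have cx := subset_closure Ox.
  have [e _] := ge x cx; have [e' _] := gO x Ox; rewrite e' in e.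
  rewrite /half_grad; apply: (f_equal (fun t => 2^-1 * t)); apply: eq_bigr => j _.
  have := congr1 (fun u : V => u 0 j) e; rewrite !mxE => ->.
  by [].
- move=> x cx; have [e _] := ge x cx; have := h2 x cx.
  rewrite e enorm_leE // /sqn => h.
  have s : \sum_i (\row_i0 g1 i0 x : V) 0 i ^+ 2 = \sum_j g1 j x ^+ 2.
    by apply: eq_bigr => j _; rewrite mxE.
  rewrite s in h; rewrite mulr_ge0 ?sumr_ge0 // => [|j _]; last exact: sqr_ge0.
  by rewrite mulrC ler_wpM2r.
Qed.
End Data.

Lemma continuous_half_sqr : continuous (@half_sqr R n).
Proof.
move=> x.
have h : {for x, continuous (fun y : V => \sum_j y 0 j ^+ 2)}.
  apply: continuous_sum_fin => j _.
  exact: (continuousM (@coord_continuous R 1 n 0 j x) (@coord_continuous R 1 n 0 j x)).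
exact: (@continuousM R V (fun=> 2^-1) _ x (@cst_continuous V R _ x) h).
Qed.

(** [B] and [K] precede [f] and [phi]: this order of quantifiers makes the constant uniform. *)
Lemma hess_estimate (M c0 F : R) : 0 <= M -> 0 < c0 -> 0 <= F ->
  exists B K : R, 0 <= K /\ forall f phi, admissible Omega f phi ->
  M = normC1 Omega (closure Omega) phi ->
  c0 = inf [set jfun f y | y in jet_cpt Omega M] ->
  F = normC2 (jet_dom Omega) (jet_cpt Omega M) (jfun f) ->
  forall x, Omega x -> enorm (hess phi x) <=
    (n * n)%:R * (n%:R * (n%:R * (K * (`|B| + n%:R *
      sup [set enorm (hess_ext Omega phi x) | x in closure Omega `\` Omega])))).
Proof.
move=> M0 c00 F0.
have [b b0 hb] := closure_bounded bO.
pose D : R := n%:R * b ^+ 2.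
have D0 : 0 <= D by rewrite mulr_ge0 ?sqr_ge0.
have hD x : closure Omega x -> sqn x <= D.
  move=> /hb xb; apply: (@le_trans _ _ (\sum_(i < n) b ^+ 2)).
    apply: ler_sum => i _; rewrite -(real_normK (num_real (x 0 i))) ler_sqr ?nnegrE //.
    exact: le_trans (coord_le_norm x i) xb.
  by rewrite sumr_const card_ord -mulr_natl.
have hsq x : half_sqr x = sqn x / 2 by rewrite /half_sqr mulrC.
have [nk|nk] := pselect (n = 2 /\ k = 1)%N.
  have [n2 k1] := nk.
  have [B [beta [beta0 hB]]] := interior_case2 D n2 M0 c00 F0.
  (* A lower bound of the weight, since half the squared gradient is at most M^2 / 2. *)
  pose m := expR (- (beta * (M ^+ 2 / 2))).
  exists B, (1 / m); split; first by rewrite divr_ge0 // expR_ge0.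
  move=> f phi adm ME cE FE x Ox.
  have [w [cw wO wM]] := half_grad_ext adm; rewrite -ME in wM.
  have [_ _ [c4 cphi] conv _] := adm.
  apply: (@hess_bound phi (fun y => expR (- (beta * w y))) m 1 B c4 cphi conv) => //.
  - apply/subspace_continuousP => y cy.
    have h : w @ within (closure Omega) (nbhs y) --> w y.
      by have := cw; move/subspace_continuousP; apply.
    have h' : - (beta * w x) @[x --> within (closure Omega) (nbhs y)] --> - (beta * w y).
      by apply: cvgN; apply: cvgM h; exact: cvg_cst.
    by apply: continuous_cvg h'; exact: continuous_expR.
  - exact: expR_gt0.
  - move=> y cy; have /andP[w0 w1] := wM y cy; apply/andP; split.
      by rewrite ler_expR lerN2 ler_wpM2l.
    by rewrite -expR0 ler_expR oppr_le0 mulr_ge0.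
  - move=> x0 Q i Ox0 oQ off imax hmax.
    have ip := admissible_interior adm hD Ox0 oQ off imax.
    rewrite -ME -cE -FE k1 in ip.
    apply: (hB Omega phi f x0 Q i ip) => y Oy.
    rewrite -(wO _ Ox0) -(wO _ Oy); exact: hmax.
(* Chosen so that the weight lies between 1 and K on the closure. *)
pose K : R := 1 + M ^+ 2 / 2 + D / 2.
have K0 : 0 <= K by rewrite /K !addr_ge0 ?divr_ge0 ?sqr_ge0.
have [B hB] := interior_case1 hn hk nk M0 c00 F0 D0 K0.
exists B, (K / 1); split; first by rewrite divr1.
move=> f phi adm ME cE FE x Ox.
have [w [cw wO wM]] := half_grad_ext adm; rewrite -ME in wM.
have [_ _ [c4 cphi] conv _] := adm.
have vb y : closure Omega y -> 1 <= K - w y - half_sqr y <= K.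
  move=> cy; have /andP[w0 w1] := wM y cy; have := hD y cy; have := sqn_ge0 y.
  by rewrite hsq /K => h1 h2; apply/andP; split; lra.
apply: (@hess_bound phi (fun y => K - w y - half_sqr y) 1 K B c4 cphi conv) => //.
- apply/subspace_continuousP => y cy.
  have h : w @ within (closure Omega) (nbhs y) --> w y.
    by have := cw; move/subspace_continuousP; apply.
  have h' : @half_sqr R n @ within (closure Omega) (nbhs y) --> half_sqr y.
    by apply: cvg_within_filter; exact: continuous_half_sqr.
  by apply: cvgB h'; apply: cvgB h; exact: cvg_cst.
- move=> x0 Q i Ox0 oQ off imax hmax.
  have ip := admissible_interior adm hD Ox0 oQ off imax.
  rewrite -ME -cE -FE in ip.
  have /andP[v1 vK] := vb x0 (subset_closure Ox0).
  apply: (hB Omega phi f x0 Q i (fun y => K - w y - half_sqr y) ip _ _ vK hmax).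
    by move=> y Oy; rewrite wO.
  exact: lt_le_trans ltr01 v1.
Qed.

End Global.

Theorem theorem1p4 (R : realType) (n k : nat) (Omega : set 'rV[R]_n)
    (hn : (2 <= n)%N) (hk : (1 <= k <= n)%N)
    (Omega_neq0 : Omega !=set0) (Omega_open : open Omega)
    (Omega_connected : connected Omega) (Omega_bounded : bounded_set Omega) :
  exists C : R -> R -> R -> R,
    forall (f : 'rV[R]_n -> R -> 'rV[R]_n -> R) (phi : 'rV[R]_n -> R),
      (forall x z p, closure Omega x -> 0 < f x z p) ->
      Ck_closure 2 (jet_dom Omega) (jfun f) ->
      Ck 4 Omega phi ->
      Ck_closure 2 Omega phi ->
      eta_convex k Omega phi ->
      (forall x, Omega x ->
         sigma k (eigenvalues (eta phi x)) = f x (phi x) (grad phi x)) ->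
      let M := normC1 Omega (closure Omega) phi in
      let K := jet_cpt Omega M in
      let c0 := inf [set jfun f y | y in K] in
      let F := normC2 (jet_dom Omega) K (jfun f) in
      sup [set enorm (hess phi x) | x in Omega] <=
        C M c0 F *
        (1 + sup [set enorm (hess_ext Omega phi x) |
                    x in closure Omega `\` Omega]).
Proof.
case: k hk => [|k] // hk.
(* Choice over triples of numbers turns the individual constants into a function. *)
have /choice[C hC] : forall t : R * R * R, exists C : R, forall f phi,
    admissible k Omega f phi ->
    t.1.1 = normC1 Omega (closure Omega) phi ->
    t.1.2 = inf [set jfun f y | y in jet_cpt Omega t.1.1] ->
    t.2 = normC2 (jet_dom Omega) (jet_cpt Omega t.1.1) (jfun f) ->
    sup [set enorm (hess phi x) | x in Omega] <=
      C * (1 + sup [set enorm (hess_ext Omega phi x) | x in closure Omega `\` Omega]).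
  move=> [[M c0] F] /=.
  (* Triples violating these signs arise from no solution, so 0 serves for them. *)
  have [[M0 [c00 F0]]|ncond] := pselect (0 <= M /\ 0 < c0 /\ 0 <= F); last first.
    exists 0 => f phi adm ME cE FE; exfalso; apply: ncond.
    have [M0 _ _ _] := normC1_bounds Omega_bounded adm.
    have [c00 F0 _] := normC2_bounds Omega_neq0 Omega_bounded adm.
    by rewrite FE cE ME.
  have [B [K [K0 hK]]] := hess_estimate hn hk Omega_neq0 Omega_open Omega_bounded M0 c00 F0.
  (* By |B| + n Bd <= (|B| + n)(1 + Bd) the boundary term factors out. *)
  exists ((n * n)%:R * (n%:R * (n%:R * (K * (`|B| + n%:R))))) => f phi adm ME cE FE.
  apply: (sup_image_le Omega_neq0) => x Ox.
  apply: le_trans (hK f phi adm ME cE FE x Ox) _.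
  set Bd := sup _; have Bd0 : 0 <= Bd by apply: sup_image_ge0 => y; exact: enorm_ge0.
  rewrite -!mulrA; do 4 (apply: ler_wpM2l => //).
  have := normr_ge0 B; have := ler0n R n; move: `|B| n%:R => b N N0 b0.
  have := mulr_ge0 b0 Bd0; lra.
exists (fun M c0 F => C (M, c0, F)) => f phi fpos cf c4 cphi conv eqn.
exact: (hC (_, _, _) f phi (And5 fpos cf (conj c4 cphi) conv eqn) erefl erefl erefl).
Qed.
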